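(* Let $\Omega\subset\mathbb{R}^N$, $N\ge 2$, be a bounded domain with smooth boundary, and let $(u,v)$ be a non-negative solution on $\Omega\times(0,t^* )$ of $$u_t+\delta_1(t)\Delta^2u-h_1(t)\Delta u=k_1(t)f_1(v),\qquad v_t+\delta_2(t)\Delta^2v-h_2(t)\Delta v=k_2(t)f_2(u),\qquad x\in\Omega,\ t\in(0,t^* ),$$ $$u=v=0,\quad \frac{\partial u}{\partial n}=\frac{\partial v}{\partial n}=0,\qquad x\in\partial\Omega,\ t\in(0,t^* ),\qquad u(x,0)=u_0(x),\ v(x,0)=v_0(x),\quad x\in\Omega.$$ Put $\Phi(t)=\|\Delta u(\cdot,t)\|_2^2+\|\Delta v(\cdot,t)\|_2^2$ and $\Phi_0=\Phi(0)=\|\Delta u_0\|_2^2+\|\Delta v_0\|_2^2>0$, and suppose that the solution blows up at the finite time $t^*$ in the sense that $\lim_{t\to t^*}\Phi(t)=\infty$. Assume that $$f_1(s)\le s^p,\qquad f_2(s)\le s^q,\qquad s\ge 0,\qquad\text{with } p\ge q>1,$$ where both ${\sf r}=2p$ and ${\sf r}=2q$ satisfy $2\le {\sf r}<\infty$ if $N\le 4$ and $2\le {\sf r}<\frac{2N}{N-4}$ if $N>4$. Let $A,\widetilde A,B$ be the positive (finite) constants defined in the context. Then $\Phi(t)$ remains bounded in the interval $[0,T]$, with $T<t^*$, where $$T:=\frac{1}{B(p-1)}\ln\Big[1+\frac{B}{2A}\Phi_0^{1-p}\Big]\quad\text{if } p>q,\qquad T:=\frac{1}{B(p-1)}\ln\Big[1+\frac{B}{\widetilde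 A}\Phi_0^{1-p}\Big]\quad\text{if } p=q.$$
   Context: Notation and standing assumptions: $\|\cdot\|_{\sf r}$ is the $L^{\sf r}(\Omega)$ norm; $\partial/\partial n$ is the outward normal derivative on $\partial\Omega$; $W_0^{2,2}(\Omega)$ is normed by $\|\Delta w\|_2$. The coefficients $\delta_i,h_i,k_i$ ($i=1,2$) are positive bounded functions of $t$; $f_1,f_2$ are non-negative functions; $u_0,v_0\in W^{2,2}_0(\Omega)$ are non-negative. Solution: for every $T'\in(0,t^* )$, $u$ and $v$ belong to $C(0,T';W_0^{2,2}(\Omega))\cap L^2(0,T';W^{4,2}(\Omega))\cap W^{1,2}(0,T';L^2(\Omega))$, continuity in time including $t=0$, and the source terms $f_1(v),f_2(u)$ belong to $L^2(0,T';L^2(\Omega))$. Constants: for admissible ${\sf r}$ let $S({\sf r},\Omega)>0$ be a constant such that $\|w\|_{\sf r}\le S({\sf r},\Omega)\|\Delta w\|_2$ for all $w\in W_0^{2,2}(\Omega)$ (Sobolev embedding). Let $\epsilon_1(t),\dots,\epsilon_4(t)$ be positive functions on $(0,t^* )$ chosen so that $$\frac{h_1}{\epsilon_2}+\frac{k_1}{\epsilon_1}=2\delta_1,\qquad \frac{h_2}{\epsilon_4}+\frac{k_2}{\epsilon_3}=2\delta_2 .$$ With suprema over $t\in(0,t^* )$, assumed finite, define $$B=\max\Big\{\sup_t h_1(t)\epsilon_2(t),\ \sup_t h_2(t)\epsilon_4(t)\Big\},$$ $$A=\max\Big\{\sup_t k_2(t)\epsilon_3(t)\,S(2q,\Omega)^{2q}\,\Phi_0^{q-p},\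 \sup_t k_1(t)\epsilon_1(t)\,S(2p,\Omega)^{2p}\Big\},$$ and, when $p=q$, $$\widetilde A=S(2p,\Omega)^{2p}\max\Big\{\sup_t k_2(t)\epsilon_3(t),\ \sup_t k_1(t)\epsilon_1(t)\Big\}.$$ *)

(* Defs.v *)
From HB Require Import structures.
From mathcomp Require Import all_boot all_order all_algebra.
From mathcomp Require Import all_classical all_reals all_analysis.
Import Order.TTheory GRing.Theory Num.Theory.
Import numFieldNormedType.Exports.

Set Implicit Arguments.
Unset Strict Implicit.
Unset Printing Implicit Defensive.

Local Open Scope classical_set_scope.
Local Open Scope ring_scope.

(** * Lebesgue measure on R^N *)

Section Lebesgue_outer_measure.
Context {R : realType} {N : nat}.

(* [Some (a, b)] is the closed box with corners a and b. [None] is the empty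
   box; it is only needed for N = 0, where every other box has volume 1. *)
Definition box (o : option ('rV[R]_N * 'rV[R]_N)) : set 'rV[R]_N :=
  if o is Some (a, b) then [set x | forall i, a 0 i <= x 0 i <= b 0 i]
  else set0.

Definition box_vol (o : option ('rV[R]_N * 'rV[R]_N)) : \bar R :=
  if o is Some (a, b) then (\prod_(i < N) Num.max 0 (b 0 i - a 0 i))%:E
  else 0%E.

Definition leb_outer (A : set 'rV[R]_N) : \bar R :=
  ereal_inf [set (\sum_(0 <= k <oo) box_vol (F k))%E
            | F in [set F | A `<=` \bigcup_k box (F k)]].

Lemma box_vol_ge0 o : (0 <= box_vol o)%E.
Proof.
case: o => [[a b]|] //=; rewrite lee_fin.
by apply: prodr_ge0 => i _; rewrite le_max lexx.
Qed.

Lemma leb_outer_ge0 A : (0 <= leb_outer A)%E.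
Proof.
apply: le_ereal_inf_tmp => _ [F _ <-].
by apply: nneseries_ge0 => n _ _; exact: box_vol_ge0.
Qed.

Lemma leb_outer0 : leb_outer set0 = 0%E.
Proof.
apply/eqP; rewrite eq_le leb_outer_ge0 andbT.
apply: ereal_inf_lbound; exists (fun=> None) => //=.
by rewrite eseries0.
Qed.

Lemma le_leb_outer : {homo leb_outer : A B / A `<=` B >-> (A <= B)%E}.
Proof.
move=> A B AB; apply: ereal_inf_le_tmp => _ [F BF <-].
by exists F => //; exact: subset_trans BF.
Qed.

Lemma leb_outer_sigma_subadditive : sigma_subadditive leb_outer.
Proof.
move=> A; have [[i ioo]|] := pselect (exists i, leb_outer (A i) = +oo%E).
  rewrite (eseries_pinfty _ _ ioo) ?leey// => n _.
  by rewrite -ltNye (lt_le_trans _ (leb_outer_ge0 _)).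
rewrite -forallNE => Aoo.
suff add2e (e : {posnum R}) :
    (leb_outer (\bigcup_n A n) <=
     \sum_(0 <= i <oo) leb_outer (A i) + e%:num%:E)%E.
  by apply/lee_addgt0Pr => _/posnumP[].
rewrite (le_trans _ (epsilon_trick _ _ _))//; last first.
  by move=> n; exact: leb_outer_ge0.
pose P n (B : nat -> option ('rV[R]_N * 'rV[R]_N)) :=
  A n `<=` \bigcup_k box (B k) /\
  (\sum_(0 <= k <oo) box_vol (B k) <=
   leb_outer (A n) + (e%:num / (2 ^ n.+1)%:R)%:E)%E.
have [G PG] : {G & forall n, P n (G n)}.
  apply: (@choice _ _ P) => n; rewrite /P.
  have en1 : (0 < e%:num / (2 ^ n.+1)%:R :> R)%R by [].
  have fin : leb_outer (A n) \is a fin_num.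
    by rewrite ge0_fin_numE ?leb_outer_ge0// ltey; apply/eqP; exact: Aoo.
  have [_ [B AB <-] muB] := lb_ereal_inf_adherent en1 fin.
  by exists B; split => //; exact: ltW.
pose V (x : nat * nat) := box_vol (G x.1 x.2).
have V_ge0 x : (0 <= V x)%E by exact: box_vol_ge0.
apply: (@le_trans _ _ (\esum_(i in setT) V i)).
  apply: ereal_inf_lbound => /=.
  have /card_esym/ppcard_eqP[f] := card_nat2.
  exists (fun n => G (f n).1 (f n).2).
    move=> t [i _ Ait]; have [j _ Bijt] := (PG i).1 _ Ait.
    by exists (f^-1%FUN (i, j)) => //=; rewrite invK ?inE.
  rewrite -(esum_pred_image V _ xpredT) ?[fun=> _]set_true//.
  by rewrite image_eq.
rewrite (_ : esum _ _ =
    (\sum_(0 <= i <oo) \sum_(0 <= j <oo) V (i, j))%E); last first.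
  pose J : nat -> set (nat * nat) := fun i => [set (i, j) | j in setT].
  rewrite (_ : setT = \bigcup_k J k); last first.
    by rewrite predeqE => -[a b]; split => // _; exists a => //; exists b.
  rewrite esum_bigcupT /=; last 2 first.
    - apply/trivIsetP => i j _ _ ij.
      rewrite predeqE => -[n m] /=; split => //= -[] [_] _ [<-{n} _].
      by move=> [m' _] [] /esym/eqP; rewrite (negbTE ij).
    - by move=> x; exact: V_ge0.
  rewrite -(image_id [set: nat]) -fun_true esum_pred_image//; last first.
    by move=> n _; exact: esum_ge0.
  apply: eq_eseriesr => /= j _.
  rewrite -(esum_pred_image V (pair j) predT)//=; last first.
    by move=> ? ? _ _; exact: (@can_inj _ _ _ snd).
  by congr esum; rewrite predeqE => -[a b]; split; move=> [i _ <-]; exists i.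
apply: lee_lim.
- apply: is_cvg_nneseries => n *.
  by apply: nneseries_ge0 => m *; exact: (V_ge0 (n, m)).
- apply: is_cvg_nneseries => n *; apply: adde_ge0 => //.
  exact: leb_outer_ge0.
- by near=> n; apply: lee_sum => i _; exact: (PG i).2.
Unshelve. all: by end_near. Qed.

HB.instance Definition _ := isOuterMeasure.Build R 'rV[R]_N leb_outer
  leb_outer0 leb_outer_ge0 le_leb_outer leb_outer_sigma_subadditive.

End Lebesgue_outer_measure.

Definition leb_outer_measure (R : realType) (N : nat) :
  {outer_measure set 'rV[R]_N -> \bar R} := @leb_outer R N.

(* R^N with the (complete) sigma-algebra of Lebesgue measurable sets; this type
   is convertible to 'rV[R]_N. *)
Notation space R N := (caratheodory_type (leb_outer_measure R N)).

Definition leb (R : realType) (N : nat) :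
    {measure set (space R N) -> \bar R} :=
  (leb_outer_measure R N : set (space R N) -> \bar R).

(** * Smooth functions and domains *)

Section Smooth.
Context {R : realType} {N : nat}.
Implicit Types (Omega : set 'rV[R]_N) (phi : 'rV[R]_N -> R) (s : seq 'I_N).

Definition unitv (i : 'I_N) : 'rV[R]_N := delta_mx 0 i.

(* The partial derivative d_(i_1) ... d_(i_m) phi, for s = [:: i_1; ...; i_m].
   Multi-indices are encoded as such lists throughout. *)
Definition pderiv s phi : 'rV[R]_N -> R :=
  foldr (fun i f => 'D_(unitv i) f) phi s.

Definition smooth phi : Prop :=
  forall s, continuous (pderiv s phi) /\
            forall i x, derivable (pderiv s phi) x (unitv i).

(* C_c^infty(Omega) *)
Definition test_function Omega phi : Prop :=
  [/\ smooth phi, compact (closure [set x | phi x != 0])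
    & closure [set x | phi x != 0] `<=` Omega].

Definition bounded_domain Omega : Prop :=
  [/\ Omega !=set0, open Omega, connected Omega & bounded_set Omega].

(* Near each boundary point, Omega is the region on one side of the graph of a
   smooth function gamma of N - 1 of the coordinates (all but the i-th); the
   sign b tells which side. *)
Definition smooth_boundary Omega : Prop :=
  forall x, closure Omega x -> ~ Omega x ->
  exists (i : 'I_N) (b : bool) (gamma : 'rV[R]_N -> R) (U : set 'rV[R]_N),
    [/\ smooth gamma,
        forall y c, gamma (y + c *: unitv i) = gamma y,
        nbhs x U
      & forall y, U y -> (Omega y <-> 0 < (-1) ^+ b * (y 0 i - gamma y))].

End Smooth.

(** * Lebesgue and Sobolev spaces on Omega *)

Section Spaces.
Context {R : realType} {N : nat}.
Variable Omega : set 'rV[R]_N.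
Implicit Types (w g : 'rV[R]_N -> R) (s : seq 'I_N).

Definition Lp_norm (r : R) w : \bar R :=
  Lnorm (leb R N) r%:E (EFin \o (w \_ Omega) : space R N -> \bar R).

Definition L2 : set ('rV[R]_N -> R) :=
  [set w | measurable_fun (Omega : set (space R N)) (w : space R N -> R) /\
           (Lp_norm 2 w < +oo)%E].

Definition inner w g : R := \int[leb R N]_(x in Omega) (w x * g x).

Definition weak_derivative s w g : Prop :=
  L2 g /\ forall phi, test_function Omega phi ->
    inner w (pderiv s phi) = (-1) ^+ size s * inner g phi.

(* A chosen weak derivative, determined up to a null set when there is one. *)
Definition wD s w : 'rV[R]_N -> R :=
  xget (cst 0) [set g | weak_derivative s w g].

(* W^{k,2}(Omega) *)
Definition Sobolev (k : nat) : set ('rV[R]_N -> R) :=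
  [set w | L2 w /\
           forall s, (size s <= k)%N -> exists g, weak_derivative s w g].

(* Mixed derivatives are counted once for each ordering of the indices. *)
Definition Sobolev_norm (k : nat) w : \bar R :=
  ((\sum_(j < k.+1) \sum_(s : j.-tuple 'I_N) Lp_norm 2 (wD s w) ^+ 2)
     `^ 2^-1)%E.

(* W_0^{2,2}(Omega), the closure of C_c^infty(Omega) in W^{2,2}(Omega) *)
Definition W022 : set ('rV[R]_N -> R) :=
  [set w | Sobolev 2 w /\
    exists phi : nat -> 'rV[R]_N -> R,
      (forall n, test_function Omega (phi n)) /\
      Sobolev_norm 2 (w - phi n) @[n --> \oo] --> 0%E].

Definition lap w : 'rV[R]_N -> R := \sum_(i < N) wD [:: i; i] w.

Definition W022_norm w : \bar R := Lp_norm 2 (lap w).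

End Spaces.

(** * Functions of time with values in a space of functions on Omega *)

Section Time.
Context {R : realType} {N : nat}.
Variables (Omega : set 'rV[R]_N) (T : R).
Implicit Types (u : R -> 'rV[R]_N -> R) (X : set ('rV[R]_N -> R))
  (nrm : ('rV[R]_N -> R) -> \bar R).

Definition simple_in X u : Prop :=
  exists (m : nat) (A : 'I_m -> set R) (g : 'I_m -> 'rV[R]_N -> R),
    [/\ forall k, measurable (A k), forall k, X (g k)
      & forall t, u t = \sum_(k < m) \1_(A k) t *: g k].

Definition strongly_measurable X nrm u : Prop :=
  exists s : nat -> R -> 'rV[R]_N -> R,
    (forall n, simple_in X (s n)) /\
    {ae lebesgue_measure, forall t, t \in `]0, T[ ->
       nrm (s n t - u t) @[n --> \oo] --> 0%E}.

(* The Bochner space L^2(0, T; X). Here t |-> nrm (u t) is only almost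
   everywhere equal to a Borel function; \int is then the integral of that
   function, being a supremum over the simple functions below the integrand. *)
Definition L2_time X nrm : set (R -> 'rV[R]_N -> R) :=
  [set u | [/\ {ae lebesgue_measure, forall t, t \in `]0, T[ -> X (u t)},
               strongly_measurable X nrm u
             & (\int[lebesgue_measure]_(t in `]0%R, T[) nrm (u t) ^+ 2
                < +oo)%E]].

(* C([0, T]; X) *)
Definition C_time X nrm : set (R -> 'rV[R]_N -> R) :=
  [set u | (forall t, t \in `[0, T] -> X (u t)) /\
           forall t0, t0 \in `[0, T] ->
             nrm (u t - u t0) @[t --> within `[0, T] (nbhs t0)] --> 0%E].

Definition time_test_function (eta : R -> R) : Prop :=
  [/\ forall n t, derivable (eta^`(n)%classic) t 1,
      compact (closure [set t | eta t != 0])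
    & closure [set t | eta t != 0] `<=` `]0, T[].

(* u is in W^{1,2}(0, T; L^2(Omega)) with weak derivative ut, i.e. the Bochner
   integrals of eta' u and - eta ut over (0, T) are equal in L^2(Omega); this
   equality is written against every psi in L^2(Omega). *)
Definition W12_time u ut : Prop :=
  [/\ L2_time (L2 Omega) (Lp_norm Omega 2) u,
      L2_time (L2 Omega) (Lp_norm Omega 2) ut
    & forall eta psi, time_test_function eta -> L2 Omega psi ->
        \int[lebesgue_measure]_(t in `]0, T[)
          (eta^`()%classic t * inner Omega (u t) psi) =
        - \int[lebesgue_measure]_(t in `]0, T[)
          (eta t * inner Omega (ut t) psi)].

End Time.

(** * The parabolic system *)

Section System.
Context {R : realType} {N : nat}.
Variables (Omega : set 'rV[R]_N) (tstar : R).
Implicit Types (u ut F : R -> 'rV[R]_N -> R) (w z : 'rV[R]_N -> R).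

Definition pos_bounded (c : R -> R) : Prop :=
  (forall t, t \in `]0, tstar[ -> 0 < c t) /\
  exists M, forall t, t \in `]0, tstar[ -> c t <= M.

(* u_t + delta Lap^2 u - h Lap u = k F in Omega x (0, tstar), u(., 0) = u0, and
   u = du/dn = 0 on the boundary: the boundary conditions are expressed, as
   usual, by u(., t) belonging to W_0^{2,2}(Omega). *)
Definition solves (delta h k : R -> R) F (u0 : 'rV[R]_N -> R) u : Prop :=
  exists ut,
    [/\ forall T', 0 < T' < tstar ->
          [/\ C_time T' (W022 Omega) (W022_norm Omega) u,
              L2_time T' (Sobolev Omega 4) (Sobolev_norm Omega 4) u,
              W12_time Omega T' u ut
            & L2_time T' (L2 Omega) (Lp_norm Omega 2) F],
        {ae lebesgue_measure, forall t, t \in `]0, tstar[ ->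
          {ae leb R N, forall x, Omega x ->
            ut t x + delta t * lap Omega (lap Omega (u t)) x
              - h t * lap Omega (u t) x = k t * F t x}}
      & {ae leb R N, forall x, Omega x -> u 0 x = u0 x}].

Definition nonneg_ae w : Prop :=
  {ae leb R N, forall x, Omega x -> 0 <= w x}.

Definition nonneg_solution (delta1 h1 k1 delta2 h2 k2 f1 f2 : R -> R)
    (u0 v0 : 'rV[R]_N -> R) (u v : R -> 'rV[R]_N -> R) : Prop :=
  [/\ solves delta1 h1 k1 (fun t x => f1 (v t x)) u0 u,
      solves delta2 h2 k2 (fun t x => f2 (u t x)) v0 v
    & forall t, t \in `]0, tstar[ -> nonneg_ae (u t) /\ nonneg_ae (v t)].

(* ||Lap w||_2^2 + ||Lap z||_2^2 *)
Definition energy w z : R :=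
  fine (W022_norm Omega w) ^+ 2 + fine (W022_norm Omega z) ^+ 2.

Definition admissible (r : R) : Prop :=
  2 <= r /\ ((4 < N)%N -> r < 2 * N%:R / (N%:R - 4)).

Definition Sobolev_constants (S : R -> R) : Prop :=
  forall r, admissible r ->
    0 < S r /\
    forall w, W022 Omega w ->
      (Lp_norm Omega r w <= (S r)%:E * W022_norm Omega w)%E.

(* The supremum over (0, tstar); meaningful when it is finite. *)
Definition finite_sup (c : R -> R) : Prop := has_ubound (c @` `]0, tstar[).
Definition tsup (c : R -> R) : R := sup (c @` `]0, tstar[).

End System.

Arguments admissible {R} N r.

(* Main.v *)
(* Let x = ||Lap u||^2 and y = ||Lap v||^2. Formally x' = 2 (u_t, Lap^2 u), so that the
   equation, Young's inequality with the weights eps_i and the Sobolev inequality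
   give x' <= B x + K1 y^p and y' <= B y + K2 x^q. Since u_t is only in
   L^2(0, t*; L^2), these are proved in integrated form: by convexity
   x(t) - x(s) <= 2 (u(t) - u(s), Lap^2 u(t)) = 2 int_s^t (u_t, Lap^2 u(t)), which bounds
   both the left difference quotients of x and, almost everywhere, their limit.

   Let Phi = x + y and let t1 be the last time with Phi(t1) <= Phi(0), so that
   Phi >= Phi(0) on [t1, t*[ and there Phi' <= B Phi + A Phi^p. Then
   exp(B (p - 1) t) (Phi^(1-p) + A/B) is nondecreasing on [t1, t*[, and letting t -> t*
   gives 1 + (B/A) Phi(0)^(1-p) <= exp(B (p - 1) (t* - t1)). For p > q, the factor 2 in
   the definition of T makes T < t* strict. For p = q, either t1 > 0, or A can be
   lowered on some interval: where x and y are both positive because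
   x^p + y^p < (x + y)^p, and where one of them vanishes because the other one
   then has no source. *)

Require Import Defs.
From mathcomp Require Import all_boot all_order all_algebra.
From mathcomp Require Import all_classical all_reals all_analysis.
From mathcomp Require Import measurable_realfun.
From mathcomp Require Import ring lra.
Import Order.TTheory GRing.Theory Num.Theory.
Import numFieldNormedType.Exports.

Local Open Scope classical_set_scope.
Local Open Scope ring_scope.

Local Notation space R N := (Defs.space R N).

(** The obstacle is that neither ut nor Lap^2 u is known to be continuous in time, so that the
    difference quotients of x have no evident integrable majorant. The remedy is to subtract the
    primitive P of ||ut||^2. The convexity bound pairs ut at varying times r with Lap^2 u at the
    single time t, so Young's inequality gives x(t) - x(s) <= P(t) - P(s) + (t - s) ||Lap^2
    u(t)||^2, and the left quotients of x - P lie below an integrable function. An upper bound is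
    enough, because the integrals of these quotients over [a, b] tend to the increment of x - P by
    continuity alone. In space, functions are not identified almost everywhere and weak derivatives
    are choices; the Laplacian is therefore linear only almost everywhere, through the fundamental
    lemma. That lemma rests on coverings by boxes, and integration by parts on the translation
    invariance of Lebesgue measure. The boundary conditions give (u(s), Lap^2 u(t)) = (Lap u(s), Lap
    u(t)), by approximating u(s) with test functions. *)

Lemma cvg_sumr (R : realType) (J : Type) (r : seq J) (F : J -> nat -> R) (l : J -> R) :
  (forall j, F j n @[n --> \oo] --> l j) ->
  (\sum_(j <- r) F j n) @[n --> \oo] --> \sum_(j <- r) l j.
Proof.
move=> Fl.
suff H : exists2 G : nat -> R, (forall n, G n = \sum_(j <- r) F j n) &
    G n @[n --> \oo] --> \sum_(j <- r) l j.
  by have [G GE cG] := H; rewrite -(funext GE).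
elim: r => [|j r [G GE cG]].
  by exists (fun=> 0) => [n|]; rewrite big_nil//; exact: cvg_cst.
exists (fun n => F j n + G n) => [n|]; rewrite big_cons ?GE//.
by apply: cvgD.
Qed.

Section Almost_everywhere.
Context {d} {T : measurableType d} {R : realType} (mu : {measure set T -> \bar R}).

Lemma ae_impl (P Q : T -> Prop) : (forall x, P x -> Q x) ->
  {ae mu, forall x, P x} -> {ae mu, forall x, Q x}.
Proof. by move=> PQ; apply: filterS. Qed.

Lemma ae_impl2 (P Q S : T -> Prop) : (forall x, P x -> Q x -> S x) ->
  {ae mu, forall x, P x} -> {ae mu, forall x, Q x} -> {ae mu, forall x, S x}.
Proof. by move=> PQS; apply: filterS2. Qed.

Lemma ae_impl3 (P Q S U : T -> Prop) : (forall x, P x -> Q x -> S x -> U x) ->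
  {ae mu, forall x, P x} -> {ae mu, forall x, Q x} -> {ae mu, forall x, S x} ->
  {ae mu, forall x, U x}.
Proof. by move=> PQS; apply: filterS3. Qed.

End Almost_everywhere.

(** * The space L^2 of a measurable set and its inner product *)

Section Square_integrable.
Context {d} {T : measurableType d} {R : realType}.
Context {mu : {measure set T -> \bar R}} {D : set T}.
Hypothesis mD : measurable D.
Implicit Types (f g h : T -> R) (a b : R).

(** [Lp_norm] integrates the extension by zero over the whole space, whereas the integrals here are
    over D; [LnormE] and [sqintegrable_Lnorm] pass from one to the other. *)
Definition sqintegrable f : Prop :=
  measurable_fun D f /\ mu.-integrable D (fun x => (f x ^+ 2)%:E).

Definition ip f g : R := \int[mu]_(x in D) (f x * g x).

Lemma sqintegrableM f g : sqintegrable f -> sqintegrable g ->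
  mu.-integrable D (fun x => (f x * g x)%:E).
Proof.
move=> [mf if2] [mg ig2].
apply: le_integrable (integrableD mD if2 ig2) => //.
  by apply/measurable_EFinP; exact: measurable_funM.
move=> x Dx; rewrite /= lee_fin normrM [leRHS]ger0_norm ?addr_ge0 ?sqr_ge0//.
rewrite -(real_normK (num_real (f x))) -(real_normK (num_real (g x))).
move: `|f x| `|g x| (normr_ge0 (f x)) (normr_ge0 (g x)) => u v u0 v0.
have := sqr_ge0 (u - v); nra.
Qed.

Lemma ipC f g : ip f g = ip g f.
Proof. by apply: eq_Rintegral => x _; rewrite mulrC. Qed.

Lemma ip_ge0 f : 0 <= ip f f.
Proof. by apply: Rintegral_ge0 => x _; rewrite -expr2 sqr_ge0. Qed.

Lemma sqintegrable0 : sqintegrable (fun=> 0).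
Proof.
split; first exact: measurable_cst.
by under eq_fun do rewrite expr0n/=; exact: integrable0.
Qed.

Lemma sqintegrableZ a f : sqintegrable f -> sqintegrable (fun x => a * f x).
Proof.
move=> [mf if2]; split; first exact: measurable_funM.
under eq_fun do rewrite exprMn EFinM.
exact: integrableZl.
Qed.

Lemma sqintegrableD f g : sqintegrable f -> sqintegrable g ->
  sqintegrable (fun x => f x + g x).
Proof.
move=> sf sg; have [mf if2] := sf; have [mg ig2] := sg.
split; first exact: measurable_funD.
have ifg := integrableZl mD 2 (sqintegrableM _ _ sf sg).
apply: eq_integrable (integrableD mD (integrableD mD if2 ifg) ig2) => //.
by move=> x _ /=; rewrite -!EFinM -!EFinD sqrrD mulr2n mulrDl !mul1r.
Qed.

Lemma sqintegrableB f g : sqintegrable f -> sqintegrable g ->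
  sqintegrable (fun x => f x - g x).
Proof.
move=> sf sg; under eq_fun do rewrite -mulN1r.
by apply: sqintegrableD => //; exact: sqintegrableZ.
Qed.

Lemma sqintegrable_sum (I : Type) (r : seq I) (F : I -> T -> R) :
  (forall i, sqintegrable (F i)) -> sqintegrable (fun x => \sum_(i <- r) F i x).
Proof.
move=> sF; elim: r => [|i r IH].
  by under eq_fun do rewrite big_nil; exact: sqintegrable0.
by under eq_fun do rewrite big_cons; exact: sqintegrableD.
Qed.

Lemma ipZr a f g : sqintegrable f -> sqintegrable g ->
  ip f (fun x => a * g x) = a * ip f g.
Proof.
move=> sf sg; rewrite /ip -RintegralZl//; last exact: sqintegrableM.
by apply: eq_Rintegral => x _; rewrite mulrCA.
Qed.

Lemma ipDr f g h : sqintegrable f -> sqintegrable g -> sqintegrable h ->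
  ip f (fun x => g x + h x) = ip f g + ip f h.
Proof.
move=> sf sg sh; rewrite /ip -RintegralD//; try exact: sqintegrableM.
by apply: eq_Rintegral => x _; rewrite mulrDr.
Qed.

Lemma ipBr f g h : sqintegrable f -> sqintegrable g -> sqintegrable h ->
  ip f (fun x => g x - h x) = ip f g - ip f h.
Proof.
move=> sf sg sh; rewrite /ip -RintegralB//; try exact: sqintegrableM.
by apply: eq_Rintegral => x _; rewrite mulrBr.
Qed.

Lemma ip0r f : ip f (fun=> 0) = 0.
Proof.
rewrite /ip; under eq_Rintegral do rewrite mulr0.
by rewrite /Rintegral integral0.
Qed.

Lemma ip_sumr (I : Type) (r : seq I) f (F : I -> T -> R) : sqintegrable f ->
  (forall i, sqintegrable (F i)) ->
  ip f (fun x => \sum_(i <- r) F i x) = \sum_(i <- r) ip f (F i).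
Proof.
move=> sf sF; elim: r => [|i r IH].
  by under eq_fun do rewrite big_nil; rewrite big_nil ip0r.
under eq_fun do rewrite big_cons; rewrite big_cons ipDr ?IH//.
exact: sqintegrable_sum.
Qed.

Lemma ipZl a f g : sqintegrable f -> sqintegrable g ->
  ip (fun x => a * f x) g = a * ip f g.
Proof. by move=> sf sg; rewrite ipC ipZr// ipC. Qed.

Lemma ipDl f g h : sqintegrable f -> sqintegrable g -> sqintegrable h ->
  ip (fun x => g x + h x) f = ip g f + ip h f.
Proof. by move=> sf sg sh; rewrite ipC ipDr// ipC (ipC h). Qed.

Lemma ipBl f g h : sqintegrable f -> sqintegrable g -> sqintegrable h ->
  ip (fun x => g x - h x) f = ip g f - ip h f.
Proof. by move=> sf sg sh; rewrite ipC ipBr// ipC (ipC h). Qed.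

Lemma ip_sqrB a f g : sqintegrable f -> sqintegrable g ->
  ip (fun x => f x - a * g x) (fun x => f x - a * g x) =
  ip f f - 2 * a * ip f g + a ^+ 2 * ip g g.
Proof.
move=> sf sg; have sag := sqintegrableZ a _ sg; have sB := sqintegrableB _ _ sf sag.
by rewrite ipBr// !ipBl// !ipZl// !ipZr// (ipC g f); ring.
Qed.

Lemma ip_CauchySchwarz f g : sqintegrable f -> sqintegrable g ->
  ip f g ^+ 2 <= ip f f * ip g g.
Proof.
move=> sf sg; have [gg0|gg0] := eqVneq (ip g g) 0.
  have := ip_ge0 (fun x => f x - (ip f f + 1) * ip f g * g x).
  rewrite ip_sqrB// gg0 !mulr0 addr0.
  have := ip_ge0 f; set a := ip f f; set b := ip f g => a0 h.
  have : a - 2 * (a + 1) * b ^+ 2 >= 0 by rewrite (le_trans h)// le_eqVlt; apply/orP; left; apply/eqP; ring.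
  have [->|b0 {}h] := eqVneq b 0; first by rewrite expr0n.
  exfalso.
  (* With (g, g) = 0 the quadratic is affine in its parameter, and the value (a + 1) / b brings it
     down to a - 2 (a + 1) < 0. *)
  have := ip_ge0 (fun x => f x - (ip f f + 1) * (b ^-1) * g x).
  rewrite ip_sqrB// gg0 !mulr0 addr0 -/a -/b -!mulrA mulVf// mulr1; lra.
have g0 : 0 < ip g g by rewrite lt_neqAle eq_sym gg0 ip_ge0.
have := ip_ge0 (fun x => f x - (ip f g / ip g g) * g x).
rewrite ip_sqrB//; set a := ip f f; set b := ip f g; set c := ip g g.
have -> : a - 2 * (b / c) * b + (b / c) ^+ 2 * c = (a * c - b ^+ 2) / c by field.
by rewrite pmulr_lge0 ?invr_gt0// subr_ge0.
Qed.

Lemma ip_Young f g : sqintegrable f -> sqintegrable g ->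
  2 * ip f g <= ip f f + ip g g.
Proof.
move=> sf sg; have := ip_ge0 (fun x => f x - 1 * g x).
by rewrite ip_sqrB//; lra.
Qed.

Lemma ip_sqrD f g : sqintegrable f -> sqintegrable g ->
  ip (fun x => f x + g x) (fun x => f x + g x) = ip f f + 2 * ip f g + ip g g.
Proof.
move=> sf sg; have sfg := sqintegrableD _ _ sf sg.
by rewrite ipDr// !ipDl// (ipC g f); ring.
Qed.

(** The recursion C -> 2 + 2 C comes from ||f + g||^2 <= 2 ||f||^2 + 2 ||g||^2. The constant depends
    on the index sequence alone, which makes [bilap] a bounded map on W^{4,2}. *)
Lemma ip_sum_le (J : Type) (r : seq J) : exists2 C : R, 0 <= C &
  forall (F : J -> T -> R) (M : R), (forall j, sqintegrable (F j)) ->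
    (forall j, ip (F j) (F j) <= M) -> 0 <= M ->
    ip (fun x => \sum_(j <- r) F j x) (fun x => \sum_(j <- r) F j x) <= C * M.
Proof.
elim: r => [|j r [C C0 IH]].
  exists 0 => // F M sF FM M0; under eq_fun do rewrite big_nil.
  by rewrite ip0r mul0r.
exists (2 + 2 * C); first by rewrite addr_ge0// mulr_ge0.
move=> F M sF FM M0; under eq_fun do rewrite big_cons.
have sS := sqintegrable_sum _ r F sF.
have := ip_Young _ _ (sF j) sS; have := IH F M sF FM M0; have := FM j.
rewrite ip_sqrD// => ? ? ?.
lra.
Qed.

Lemma eq_ip_ae f f' g g' : measurable_fun D f -> measurable_fun D f' ->
  measurable_fun D g -> measurable_fun D g' ->
  {ae mu, forall x, D x -> f x = f' x} -> {ae mu, forall x, D x -> g x = g' x} ->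
  ip f g = ip f' g'.
Proof.
move=> mf mf' mg mg' ff' gg'; congr fine; apply: ae_eq_integral => //.
- by apply/measurable_EFinP; exact: measurable_funM.
- by apply/measurable_EFinP; exact: measurable_funM.
by move: ff' gg'; apply: filterS2 => x h1 h2 Dx; rewrite h1// h2.
Qed.

Lemma LnormE f : sqintegrable f ->
  Lnorm mu 2%:E (EFin \o (f \_ D)) = (Num.sqrt (ip f f))%:E.
Proof.
move=> [mf if2].
rewrite unlock /Lnorm.
have -> : (\int[mu]_x `|(EFin \o (f \_ D)) x| `^ 2)%E = (ip f f)%:E.
  rewrite /ip /Rintegral fineK; last first.
    by under eq_integral do rewrite -expr2; exact: integrable_fin_num.
  rewrite [RHS]integral_mkcond; apply: eq_integral => x _ /=.
  rewrite /patch; case: ifPn => _; last by rewrite normr0 powR0 ?pnatr_eq0.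
  by rewrite powR_mulrn// real_normK ?num_real// expr2.
by rewrite poweR_EFin powR12_sqrt ?ip_ge0.
Qed.

Lemma sqintegrable_Lnorm f : measurable_fun D f ->
  (Lnorm mu 2%:E (EFin \o (f \_ D)) < +oo)%E -> sqintegrable f.
Proof.
move=> mf; rewrite unlock /Lnorm => foo; split=> //; apply/integrableP; split.
  by apply/measurable_EFinP; exact: measurable_funX.
rewrite integral_mkcond.
move: foo.
have -> : (\int[mu]_x `|(EFin \o (f \_ D)) x| `^ 2)%E =
    (\int[mu]_x ((fun x0 : T => `|(f x0 ^+ 2)%:E|) \_ D) x)%E.
  apply: eq_integral => x _ /=.
  rewrite /patch; case: ifPn => _; last by rewrite normr0 powR0 ?pnatr_eq0.
  by rewrite powR_mulrn// real_normK ?num_real// ger0_norm ?sqr_ge0.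
move: (integral _ _ _) => [r||] //; first by move=> _; rewrite ltry.
by rewrite /poweR invr_eq0 pnatr_eq0.
Qed.

Lemma sqintegrable_indic (A : set T) : measurable A -> (mu A < +oo)%E ->
  sqintegrable (\1_A).
Proof.
move=> mA Aoo; split; first exact: measurable_indic.
apply/integrableP; split.
  by apply/measurable_EFinP; apply: measurable_funX; exact: measurable_indic.
under eq_integral.
  move=> x _; rewrite (_ : `|_|%E = (\1_A x)%:E); first over.
  by rewrite gee0_abs ?lee_fin ?sqr_ge0// indicE; case: (_ \in _); rewrite ?expr1n ?expr0n.
rewrite integral_indic// (le_lt_trans _ Aoo)// le_measure ?inE//.
exact: measurableI.
Qed.

(** Quantitative absolute continuity of the set function (f, 1_A): sets of small measure contribute
    little, so that coverings by boxes reach all measurable sets. *)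
Lemma ip_indic_CauchySchwarz f (A : set T) : sqintegrable f -> measurable A ->
  (mu A < +oo)%E -> ip f (\1_A) ^+ 2 <= ip f f * fine (mu A).
Proof.
move=> sf mA Aoo; have sA := sqintegrable_indic _ mA Aoo.
apply: le_trans (ip_CauchySchwarz _ _ sf sA) _; apply: ler_wpM2l; first exact: ip_ge0.
have -> : ip \1_A \1_A = fine (mu (A `&` D)).
  rewrite /ip -integral_indic//; apply: eq_Rintegral => x _.
  by rewrite indicE; case: (_ \in _); rewrite ?mulr1 ?mulr0.
have mAD : measurable (A `&` D) by exact: measurableI.
have le : (mu (A `&` D) <= mu A)%E by rewrite le_measure ?inE.
by rewrite fine_le// ge0_fin_numE// (le_lt_trans le).
Qed.

Lemma ip_dominated_cvg f h (g_ : nat -> T -> R) g : sqintegrable f -> sqintegrable h ->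
  (forall n, measurable_fun D (g_ n)) ->
  (forall n x, D x -> `|g_ n x| <= `|h x|) ->
  (forall x, D x -> g_ n x @[n --> \oo] --> g x) ->
  ip f (g_ n) @[n --> \oo] --> ip f g.
Proof.
move=> sf sh mg gh cg; have ifh := sqintegrableM _ _ sf sh.
have ig n : mu.-integrable D (fun x => (f x * g_ n x)%:E).
  apply: le_integrable ifh => //.
    by apply/measurable_EFinP; apply: measurable_funM => //; case: sf.
  by move=> x Dx; rewrite /= lee_fin !normrM ler_wpM2l// gh.
have cvgI : (\int[mu]_(x in D) (f x * g_ n x)%:E @[n --> \oo] -->
    \int[mu]_(x in D) (f x * g x)%:E)%E.
  apply: (@dominated_cvg _ _ _ mu D mD _ _ (fun x => `|(f x * h x)%:E|%E)).
- by move=> n; exact: measurable_int (ig n).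
- by move=> x Dx; apply: cvg_EFin; [exact: nearW|apply: cvgM; [exact: cvg_cst|exact: cg]].
- by [].
- exact: integrable_abse.
- by move=> n x Dx; rewrite /= lee_fin !normrM ler_wpM2l// gh.
(* Convergence passes through [fine] only at a finite limit. *)
have ifg : (\int[mu]_(x in D) (f x * g x)%:E)%E \is a fin_num.
  apply: integrable_fin_num => //; apply: le_integrable ifh => //.
    apply: (emeasurable_fun_cvg (fun n x => (f x * g_ n x)%:E)).
      by move=> n; exact: measurable_int (ig n).
    by move=> x Dx; apply: cvg_EFin; [exact: nearW|apply: cvgM; [exact: cvg_cst|exact: cg]].
  move=> x Dx; rewrite /= lee_fin !normrM ler_wpM2l//.
  have cn : `|g_ n x| @[n --> \oo] --> `|g x| by apply: cvg_norm; exact: cg.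
  rewrite -(cvg_lim (@Rhausdorff R) cn); apply: limr_le; first by apply/cvg_ex; eexists; exact: cn.
  by apply: nearW => n; exact: gh.
by apply: fine_cvg; rewrite fineK.
Qed.

End Square_integrable.

Arguments sqintegrable {d T R} mu D f.
Arguments ip {d T R} mu D f g.

Lemma integral_measure_preserving d (X : measurableType d) (R : realType)
    (mu : {measure set X -> \bar R}) (phi : X -> X)
    (mphi : measurable_fun setT phi) (f : X -> \bar R) :
  (forall A, measurable A -> mu (phi @^-1` A) = mu A) ->
  measurable_fun setT f -> mu.-integrable setT (f \o phi) ->
  (\int[mu]_x f (phi x) = \int[mu]_x f x)%E.
Proof.
move=> pres mf intf.
have := integral_pushforward mphi mf intf measurableT => /= <-.
by apply: eq_measure_integral => A mA _; exact: pres.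
Qed.

(** * Lebesgue measure on R^N *)

Section Lebesgue_space.
Context {R : realType} {N : nat}.
Implicit Types (A : set 'rV[R]_N) (a b x : 'rV[R]_N) (i : 'I_N) (c : R).

Definition upd a i c : 'rV[R]_N := \row_j (if j == i then c else a 0 j).

(** With the truncation by min, and by max for [box_above], the volumes of the two pieces add up
    exactly even when the hyperplane misses the box, one of the pieces then having volume 0. *)
Definition box_below i c (o : option ('rV[R]_N * 'rV[R]_N)) :=
  if o is Some (a, b) then Some (a, upd b i (Num.min (b 0 i) c)) else None.

Definition box_above i c (o : option ('rV[R]_N * 'rV[R]_N)) :=
  if o is Some (a, b) then Some (upd a i (Num.max (a 0 i) c), b) else None.

Lemma box_vol_cut i c o :
  (box_vol (box_below i c o) + box_vol (box_above i c o) = box_vol o)%E.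
Proof.
case: o => [[a b]|]; last by rewrite /= adde0.
rewrite /= -EFinD; congr EFin.
rewrite [X in X + _](bigD1 i)//= [X in _ + X](bigD1 i)//= [RHS](bigD1 i)//=.
rewrite !mxE eqxx.
have -> : \prod_(j < N | j != i) Num.max 0 (upd b i (Num.min (b 0 i) c) 0 j - a 0 j)
    = \prod_(j < N | j != i) Num.max 0 (b 0 j - a 0 j).
  by apply: eq_bigr => j /negPf ji; rewrite mxE ji.
have -> : \prod_(j < N | j != i) Num.max 0 (b 0 j - upd a i (Num.max (a 0 i) c) 0 j)
    = \prod_(j < N | j != i) Num.max 0 (b 0 j - a 0 j).
  by apply: eq_bigr => j /negPf ji; rewrite mxE ji.
rewrite -mulrDl; congr (_ * _).
by rewrite !maxEle !minEle; do ! case: ifP; lra.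
Qed.

(** Caratheodory's criterion: cutting each box of a cover of A along the hyperplane covers both
    parts of A, at the same total volume. *)
Lemma halfspace_measurable i c :
  measurable ([set x : 'rV[R]_N | x 0 i <= c] : set (space R N)).
Proof.
apply: le_caratheodory_measurable => A.
apply: le_ereal_inf_tmp => _ [F AF <-].
under eq_eseriesr do rewrite -(box_vol_cut i c).
rewrite nneseriesD; [|by move=> *; exact: box_vol_ge0..].
apply: leeD; apply: ereal_inf_lbound.
- exists (fun k => box_below i c (F k)) => //= x [/AF[k _ Fkx] xc]; exists k => //.
  move: Fkx xc; case: (F k) => [[a b]|] //= Fkx xc j; rewrite mxE.
  by case: eqP => [->|_]; have /andP[h1 h2] := Fkx j; rewrite ?h1 ?h2 //= le_min -?(eqP _) ?xc; move: (Fkx i) => /andP[-> ->].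
- exists (fun k => box_above i c (F k)) => //= x [/AF[k _ Fkx] xc]; exists k => //.
  move: Fkx xc; case: (F k) => [[a b]|] //= Fkx /negP; rewrite -ltNge => /ltW xc j; rewrite mxE.
  case: eqP => [->|_]; last exact: Fkx.
  by rewrite ge_max xc; move: (Fkx i) => /andP[-> ->].
Qed.

Lemma coord_measurable i : measurable_fun setT ((fun x => x 0 i) : space R N -> R).
Proof.
apply: (measurability _ (RGenOInfty.measurableE R)) => _ [_ [c ->] <-].
rewrite setTI.
have -> : (fun x : 'rV[R]_N => x 0 i) @^-1` `]c, +oo[ = ~` [set x | x 0 i <= c].
  apply/seteqP; split => x /=; rewrite in_itv/= andbT; first by move=> h /(lt_le_trans h); rewrite ltxx.
  by move=> /negP; rewrite -ltNge.
by apply: measurableC; exact: halfspace_measurable.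
Qed.

Lemma box_measurable o : measurable (box o : set (space R N)).
Proof.
case: o => [[a b]|]; last exact: measurable0.
have -> : box (Some (a, b)) =
    \bigcap_(i in [set: 'I_N]) ((fun x : 'rV[R]_N => x 0 i) @^-1` `[a 0 i, b 0 i]).
  apply/seteqP; split => [x h i _|x h i] /=; first by rewrite in_itv/= h.
  by have := h i I; rewrite /= in_itv.
apply: fin_bigcap_measurable; first exact: finite_finset.
move=> i _; rewrite -[X in measurable X]setTI; exact: coord_measurable.
Qed.

(** The margin e leaves room for the supports of smooth approximations of the indicator of the
    box. *)
Definition inflate (e : R) (a b : 'rV[R]_N) : set 'rV[R]_N :=
  box (Some (\row_j (a 0 j - e), \row_j (b 0 j + e))).

Lemma open_box_cover (U : set 'rV[R]_N) : open U ->
  exists2 F : nat -> option ('rV[R]_N * 'rV[R]_N), U `<=` \bigcup_k box (F k) &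
    forall k a b, F k = Some (a, b) -> exists2 e, 0 < e & inflate e a b `<=` U.
Proof.
move=> oU; pose r k : R := k.+1%:R^-1.
have r0 k : 0 < r k by rewrite invr_gt0 ltr0n.
pose a (z : 'rV[rat]_N * nat) : 'rV[R]_N := \row_j (ratr (z.1 0 j) - r z.2).
pose b (z : 'rV[rat]_N * nat) : 'rV[R]_N := \row_j (ratr (z.1 0 j) + r z.2).
(* The boxes are cubes with rational centre and radius 1/(k + 1), enumerated by their codes; a
   number that is not a code, or whose inflated cube leaves U, gives the empty box. *)
exists (fun n => if unpickle n is Some z then
    if `[< inflate (r z.2) (a z) (b z) `<=` U >] then Some (a z, b z) else None
  else None); last first.
  move=> n a' b'; case: (unpickle n) => // z; case: asboolP => // h [<- <-].
  by exists (r z.2).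
move=> x Ux; have := oU; rewrite openE => /(_ _ Ux).
rewrite /interior -nbhs_ballE => -[e /= e0 eU].
(* The inflated cube has radius 2 r, and its centre is within r of x; hence 3 r < e. *)
pose k := Num.truncn (3 / e).
have ke : 3 * r k < e.
  by rewrite ltr_pdivrMr// -ltr_pdivrMl// mulrC; exact: Num.Theory.truncnS_gt.
have /choice[q qP] : forall j : 'I_N, exists q : rat, x 0 j - r k < ratr q < x 0 j + r k.
  move=> j; have [|q] := @rat_in_itvoo R (x 0 j - r k) (x 0 j + r k).
    by rewrite ltrBlDr -addrA ltrDl addr_gt0.
  by rewrite in_itv; exists q.
exists (pickle (\row_j q j, k)) => //; rewrite pickleK asboolT; last first.
  move=> y yB; apply: eU; split => // i j; rewrite ord1.
  have := yB j; have := qP j; rewrite !mxE /ball/= => /andP[h1 h2] /andP[h3 h4].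
  by rewrite ltr_norml; apply/andP; split; lra.
move=> j; rewrite !mxE; have /andP[h1 h2] := qP j.
by apply/andP; split; lra.
Qed.

Lemma open_space_measurable (U : set 'rV[R]_N) : open U -> measurable (U : set (space R N)).
Proof.
move=> oU; have [F UF Fe] := open_box_cover U oU.
have -> : U = \bigcup_k box (F k).
  apply/seteqP; split=> // x [k _]; move Fk : (F k) => [[a b]|]// xab.
  have [e e0] := Fe _ _ _ Fk; apply => i.
  have /andP[h1 h2] := xab i; rewrite !mxE; apply/andP; split; lra.
by apply: bigcupT_measurable => k; exact: box_measurable.
Qed.

Lemma continuous_space_measurable (f : 'rV[R]_N -> R) : continuous f ->
  measurable_fun setT (f : space R N -> R).
Proof.
move=> /continuousP cf.
apply: (measurability _ (RGenOpens.measurableE R)) => _ [_ [a [b ->]] <-].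
by rewrite setTI; apply: open_space_measurable; apply: cf; exact: itv_open.
Qed.

Lemma leb_outer_shift (h : 'rV[R]_N) A :
  (leb_outer [set x | A (x + h)%R] <= leb_outer A)%E.
Proof.
apply: le_ereal_inf_tmp => _ [F AF <-].
pose sh (o : option ('rV[R]_N * 'rV[R]_N)) :=
  if o is Some (a, b) then Some (a - h, b - h) else None.
apply: ereal_inf_lbound; exists (fun k => sh (F k)).
  move=> x /AF[k _ Fk]; exists k => //.
  move: Fk; case: (F k) => [[a b]|] //= + i; move=> /(_ i); rewrite !mxE; lra.
apply: eq_eseriesr => k _; case: (F k) => [[a b]|] //=; congr EFin.
by apply: eq_bigr => i _; rewrite !mxE; congr Num.max; ring.
Qed.

Lemma leb_shift (h : 'rV[R]_N) A : leb_outer [set x | A (x + h)] = leb_outer A.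
Proof.
apply/eqP; rewrite eq_le leb_outer_shift/=.
have := leb_outer_shift (- h) [set x | A (x + h)].
have -> // : [set x | [set x | A (x + h)] (x + (- h))] = A.
by apply/seteqP; split => x /=; rewrite subrK.
Qed.

(** The Caratheodory condition for the shifted set, tested on X, is the condition for A tested on a
    translate of X. *)
Lemma shift_measurable (h : 'rV[R]_N) :
  measurable_fun setT ((fun x => x + h) : space R N -> space R N).
Proof.
move=> _ A mA; rewrite setTI; apply: le_caratheodory_measurable => X.
have {}mA Y : leb_outer Y = (leb_outer (Y `&` A) + leb_outer (Y `&` ~` A))%E := mA Y.
rewrite [X in (_ <= X)%E](_ : _ = leb_outer X)//.
rewrite -[X in (_ <= X)%E](leb_shift (- h)) mA.
rewrite -[X in (_ <= X + _)%E](leb_shift h) -[X in (_ <= _ + X)%E](leb_shift h).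
rewrite le_eqVlt; apply/orP; left; apply/eqP; congr (_ + _)%E; congr leb_outer.
  by apply/seteqP; split => x /=; rewrite addrK.
by apply/seteqP; split => x /=; rewrite addrK.
Qed.

Lemma integral_shift (h : 'rV[R]_N) (f : space R N -> \bar R) :
  measurable_fun setT f ->
  (leb R N).-integrable setT (fun x => f ((x : 'rV[R]_N) + h)) ->
  (\int[leb R N]_x f ((x : 'rV[R]_N) + h)%R = \int[leb R N]_x f x)%E.
Proof.
move=> mf intf.
apply: (integral_measure_preserving _ _ _ _ _ (shift_measurable h)) => // A _.
exact: (leb_shift h A).
Qed.

Lemma leb_box_lty a b : (leb R N (box (Some (a, b))) < +oo)%E.
Proof.
apply: (@le_lt_trans _ _ (box_vol (Some (a, b)))); last exact: ltry.
apply: ereal_inf_lbound.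
(* The padding is by [None], whose volume is 0 in every dimension. *)
exists (fun k => if k == 0%N then Some (a, b) else None).
  by move=> x xB; exists 0%N.
rewrite (nneseries_split 0 1)//=; last by move=> k _; exact: box_vol_ge0.
by rewrite big_nat1 eseries0 ?adde0// => -[].
Qed.

Lemma bounded_sub_box A : bounded_set A -> exists a b, A `<=` box (Some (a, b)).
Proof.
move=> [M [_ MA]]; exists (\row_j (- (M + 1))), (\row_j (M + 1)) => x Ax i.
have /= := MA (M + 1) _ x Ax; rewrite ltrDl ltr01 => /(_ isT) xM.
rewrite !mxE -ler_norml (le_trans _ xM)// [X in _ <= X]/Num.norm/= mx_normrE.
exact: (le_bigmax _ (fun ij : 'I_1 * 'I_N => `|x ij.1 ij.2|) (ord0, i)).
Qed.

End Lebesgue_space.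

(** * Test functions and the fundamental lemma *)

Section Smooth_functions_of_one_variable.
Context {R : realType}.
Implicit Types (f g : R -> R) (x h : R).

(** For k = 0 this is the classical function that is flat at 0; the powers of x^-1 are those that
    its derivatives produce. *)
Definition rho k x : R := if 0 < x then x^-1 ^+ k * expR (- x^-1) else 0.

(** The exponential exp(1/x) dominates its Taylor term of order k + 2. Quadratic decay is what makes
    every [rho k] differentiable at 0 with derivative 0. *)
Lemma rho_le_sqr k : exists C, forall x, `|rho k x| <= C * x ^+ 2.
Proof.
exists (k.+2)`!%:R => x; rewrite /rho; case: ifPn => x0; last first.
  by rewrite normr0 mulr_ge0 ?sqr_ge0.
have x1 : 0 < x^-1 by rewrite invr_gt0.
rewrite ger0_norm; last by rewrite mulr_ge0 ?exprn_ge0 ?expR_ge0// ltW.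
rewrite expRN ler_pdivrMr ?expR_gt0//.
have h : x^-1 ^+ k.+2 / (k.+2)`!%:R <= expR x^-1.
  by rewrite (le_trans _ (expR_ge1Dxn k.+1 (ltW x1)))// lerDr.
have -> : x^-1 ^+ k = (k.+2)`!%:R * x ^+ 2 * (x^-1 ^+ k.+2 / (k.+2)`!%:R).
  have c0 : (k.+2)`!%:R != 0 :> R by rewrite pnatr_eq0 -lt0n fact_gt0.
  have -> : x^-1 ^+ k = x ^+ 2 * x^-1 ^+ k.+2.
    by rewrite -(addn2 k) exprD mulrCA -exprMn divff ?gt_eqF// expr1n mulr1.
  by move: (_ `!%:R) c0 => c c0; field.
by rewrite ler_wpM2l// mulr_ge0 ?sqr_ge0.
Qed.

Lemma is_derive_sqr_bound f C : (forall h, `|f h| <= C * h ^+ 2) ->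
  is_derive (0 : R) (1 : R) f 0.
Proof.
move=> fC.
have f0 : f 0 = 0.
  by apply/eqP; rewrite -normr_le0 (le_trans (fC 0))// expr0n/= mulr0.
have ch : `|C| * `|h| @[h --> (0 : R)^'] --> (0 : R).
  apply: cvg_within_filter.
  have := @cvgM _ _ (nbhs (0 : R)) _ _ _ _ _ (cvg_cst `|C|) (cvg_norm (@cvg_id _ (nbhs (0 : R)))).
  by rewrite normr0 mulr0; apply.
have cv : (fun h => h^-1 *: ((f \o shift (0 : R)) (h *: (1 : R)) - f 0)) @ (0 : R)^' --> (0 : R).
  rewrite f0.
  apply: (@squeeze_cvgr _ _ _ _ (fun h => - (`|C| * `|h|)) (fun h => `|C| * `|h|)).
  - near=> h; rewrite -ler_norml /= addr0 subr0 [h *: _]mulr1.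
    have h0 : h != 0 by near: h; exact: nbhs_dnbhs_neq.
    rewrite normrM normfV ler_pdivrMl ?normr_gt0// (le_trans (fC h))//.
    rewrite [leRHS]mulrCA -expr2 (real_normK (num_real h)).
    by rewrite ler_wpM2r ?sqr_ge0// ler_norm.
  - by rewrite -[X in _ --> X]oppr0; exact: cvgN.
  - exact: ch.
by apply: DeriveDef; [apply/cvg_ex; exists 0|exact: cvg_lim cv].
Unshelve. all: by end_near. Qed.

Lemma is_derive_rho k x :
  is_derive x (1 : R) (rho k) (- k%:R * rho k.+1 x + rho k.+2 x).
Proof.
have [x0|x0|->] := ltgtP x 0.
- have -> : - k%:R * rho k.+1 x + rho k.+2 x = 0.
    by rewrite /rho ltNge (ltW x0)/= mulr0 addr0.
  have : \forall y \near x, cst 0 y = rho k y.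
    near=> y; rewrite /rho ltNge /cst.
    by have -> : y <= 0 by apply: ltW; near: y; exact: lt_nbhsl.
  by move/near_eq_is_derive; apply; exact: is_derive_cst.
- have dV : is_derive x (1 : R) (fun y : R => y^-1) (- x ^- 2).
    have d1 : derivable (id : R -> R) x 1 by [].
    have := derivableP (derivableV (lt0r_neq0 x0 : id x != 0) d1).
    by rewrite deriveV ?lt0r_neq0// derive_id /= [_ *: _]mulr1.
  have dE : is_derive x (1 : R) (fun y : R => expR (- y^-1)) (expR (- x^-1) * - - x ^- 2).
    apply: (@is_derive1_comp _ expR (fun y => - y^-1)); exact: is_deriveN.
  have := is_deriveM (is_deriveX k dV) dE.
  set l := (X in is_derive _ _ _ X).
  have -> : l = - k%:R * rho k.+1 x + rho k.+2 x.
    rewrite {}/l /rho x0 exprfctE /GRing.scale/= opprK -exprVn.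
    by clear; case: k => [|k] /=; rewrite ?mul0r ?oppr0 ?expr0 ?exprS; ring.
  have : \forall y \near x, ((fun y : R => y^-1) ^+ k * (fun y => expR (- y^-1))) y = rho k y.
    near=> y; rewrite /rho.
    have -> : 0 < y by near: y; exact: lt_nbhsr.
    by rewrite fctE exprfctE.
  by move=> /near_eq_is_derive; exact.
- have -> : - k%:R * rho k.+1 0 + rho k.+2 0 = 0.
    by rewrite /rho ltxx/= mulr0 addr0.
  by have [C hC] := rho_le_sqr k; apply: is_derive_sqr_bound hC.
Unshelve. all: by end_near. Qed.

(* A class closed under differentiation: the derivative of rho k is
   - k rho k.+1 + rho k.+2. *)
Inductive smooth1 : (R -> R) -> Prop :=
| smooth1_cst c : smooth1 (fun=> c)
| smooth1_rho k : smooth1 (rho k)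
| smooth1D f g : smooth1 f -> smooth1 g -> smooth1 (fun x => f x + g x)
| smooth1M f g : smooth1 f -> smooth1 g -> smooth1 (fun x => f x * g x)
| smooth1_affine f a b : smooth1 f -> smooth1 (fun x => f (a * x + b))
| smooth1V f : (forall x, f x != 0) -> smooth1 f -> smooth1 (fun x => (f x)^-1).

Lemma smooth1_is_derive f : smooth1 f ->
  exists2 g, smooth1 g & forall x, is_derive x (1 : R) f (g x).
Proof.
elim => {f} [c|k|f g sf [f' sf' df] sg [g' sg' dg]|f g sf [f' sf' df] sg [g' sg' dg]
   |f a b sf [f' sf' df]|f f0 sf [f' sf' df]].
- by exists (fun=> 0); [exact: smooth1_cst|move=> x; exact: is_derive_cst].
- exists (fun x => - k%:R * rho k.+1 x + rho k.+2 x); last exact: is_derive_rho.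
  by apply: smooth1D; [apply: smooth1M; [exact: smooth1_cst|]|]; exact: smooth1_rho.
- exists (fun x => f' x + g' x); first exact: smooth1D.
  by move=> x; apply: is_deriveD.
- exists (fun x => f x * g' x + g x * f' x); first by apply: smooth1D; exact: smooth1M.
  by move=> x; apply: is_deriveM.
- exists (fun x => f' (a * x + b) * a).
    by apply: smooth1M; [exact: smooth1_affine|exact: smooth1_cst].
  move=> x; apply: (@is_derive1_comp _ f (fun x => a * x + b)) => //.
  have := is_deriveD (is_deriveZ a (is_derive_id x (1 : R))) (is_derive_cst b x (1 : R)).
  by rewrite addr0 [_ *: _]mulr1.
- exists (fun x => (-1) * ((f x)^-1 * (f x)^-1) * f' x).
    apply: smooth1M => //; apply: smooth1M; first exact: smooth1_cst.
    by apply: smooth1M; exact: smooth1V.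
  move=> x; have [d1 d2] := df x.
  apply: DeriveDef; first exact: derivableV.
  by rewrite deriveV// d2 mulN1r -invfM -expr2.
Qed.

Lemma smooth1_derive1n f n : smooth1 f -> smooth1 (f^`(n)%classic).
Proof.
move=> sf; elim: n => [//|n /smooth1_is_derive[g sg dg]].
have <- : g = f^`(n.+1)%classic; last by [].
by apply/funext => x; rewrite derive1nS derive1E; have [_ ->] := dg x.
Qed.

Lemma smooth1_continuous f : smooth1 f -> continuous f.
Proof.
move=> /smooth1_is_derive[g _ dg] x.
by apply: differentiable_continuous; apply/derivable1_diffP; have [] := dg x.
Qed.

End Smooth_functions_of_one_variable.

(** * Smooth approximations of indicators of intervals *)

Section Bumps.
Context {R : realType}.
Implicit Types (a b x : R) (m : nat).

(* The support is [a - 1/(m+1), b + 1/(m+1)]; on [a, b] both arguments are at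
   least m + 1, hence the convergence to the indicator of [a, b]. *)
Definition bump m a b x : R :=
  rho 0 (m.+1%:R ^+ 2 * x + (m.+1%:R - m.+1%:R ^+ 2 * a)) *
  rho 0 (- m.+1%:R ^+ 2 * x + (m.+1%:R + m.+1%:R ^+ 2 * b)).

Lemma smooth1_bump m a b : smooth1 (bump m a b).
Proof. by apply: smooth1M; apply: smooth1_affine; exact: smooth1_rho. Qed.

Lemma rho0_itv x : 0 <= rho 0 x <= 1.
Proof.
rewrite /rho; case: ifPn => [x0|_]; last by rewrite lexx ler01.
by rewrite expr0 mul1r expR_ge0 expR_le1 oppr_le0 invr_ge0 ltW.
Qed.

Lemma bump_itv m a b x : 0 <= bump m a b x <= 1.
Proof.
by have /andP[? ?] := rho0_itv (m.+1%:R ^+ 2 * x + (m.+1%:R - m.+1%:R ^+ 2 * a));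
   have /andP[? ?] := rho0_itv (- m.+1%:R ^+ 2 * x + (m.+1%:R + m.+1%:R ^+ 2 * b));
   rewrite mulr_ge0//= mulr_ile1.
Qed.

Lemma bump_neq0 m a b x : bump m a b x != 0 ->
  a - m.+1%:R^-1 < x < b + m.+1%:R^-1.
Proof.
rewrite mulf_eq0 negb_or /rho => /andP[].
have c0 : 0 < m.+1%:R :> R by rewrite ltr0n.
move: (m.+1%:R) c0 => c c0.
case: ifPn => [+ _|_]; last by rewrite eqxx.
case: ifPn => [h1 h2 _|_ _]; last by rewrite eqxx.
have ci : c * c^-1 = 1 by rewrite divff// gt_eqF.
have ci0 : 0 < c^-1 by rewrite invr_gt0.
have cn : c != 0 by rewrite gt_eqF.
rewrite -(subr_gt0 _ x) -(subr_gt0 x).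
have -> : x - (a - c^-1) = c^-1 ^+ 2 * (c ^+ 2 * x + (c - c ^+ 2 * a)) by field.
have -> : b + c^-1 - x = c^-1 ^+ 2 * (- c ^+ 2 * x + (c + c ^+ 2 * b)) by field.
by rewrite !mulr_gt0 ?exprn_gt0.
Qed.

Lemma cvg_bump a b x : bump m a b x @[m --> \oo] --> (if a <= x <= b then 1 else 0 : R).
Proof.
have cinv : (m.+1%:R^-1 : R) @[m --> \oo] --> 0 by exact: cvg_harmonic.
case: ifPn => [/andP[ax xb]|nx].
  apply: (@squeeze_cvgr _ _ _ _ (fun m => expR (- m.+1%:R^-1) * expR (- m.+1%:R^-1)) (fun=> 1)).
  - near=> m; have /andP[_ ->] := bump_itv m a b x; rewrite andbT.
    have c0 : 0 < m.+1%:R :> R by rewrite ltr0n.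
    rewrite /bump; move: (m.+1%:R) c0 => c c0.
    have h y : c <= y -> expR (- c^-1) <= rho 0 y.
      move=> cy; rewrite /rho (lt_le_trans c0 cy) expr0 mul1r ler_expR lerN2.
      by rewrite lef_pV2// posrE (lt_le_trans c0 cy).
    have c2 : 0 <= c ^+ 2 by rewrite sqr_ge0.
    apply: ler_pM; rewrite ?expR_ge0//; apply: h.
      by have := mulr_ge0 c2 (_ : 0 <= x - a); rewrite subr_ge0 => /(_ ax); lra.
    by have := mulr_ge0 c2 (_ : 0 <= b - x); rewrite subr_ge0 => /(_ xb); lra.
  - have e1 : expR (- m.+1%:R^-1 : R) @[m --> \oo] --> (1 : R).
      have := cvg_comp _ _ (cvgN cinv) (@continuous_expR R (- 0)).
      by rewrite oppr0 expR0; apply.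
    by rewrite -[X in _ --> X]mulr1; exact: cvgM.
  - exact: cvg_cst.
(* Off [a, b] the bump vanishes as soon as 1/(m + 1) is less than the distance from x to [a, b]. *)
apply: cvg_near_cst.
move: nx; rewrite negb_and -!ltNge => /orP[xa|bx].
  have := cvgr_lt 0 cinv (a - x); rewrite subr_gt0 => /(_ _ xa).
  apply: filterS => m hm; apply/eqP; apply: contraTT isT => /bump_neq0 /andP[+ _].
  by rewrite ltrBlDr -ltrBlDl; move=> h; have := lt_trans h hm; rewrite ltxx.
have := cvgr_lt 0 cinv (x - b); rewrite subr_gt0 => /(_ _ bx).
apply: filterS => m hm; apply/eqP; apply: contraTT isT => /bump_neq0 /andP[_].
by rewrite -ltrBlDl => h; have := lt_trans h hm; rewrite ltxx.
Unshelve. all: by end_near. Qed.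

End Bumps.

Section Product_functions.
Context {R : realType} {N : nat}.
Implicit Types (g : 'I_N -> R -> R) (x : 'rV[R]_N) (i : 'I_N).

(** Tensor products: a partial derivative changes a single factor, so smoothness in N variables
    reduces to [smooth1]. *)
Definition prodf g x : R := \prod_i g i (x 0 i).

Lemma prodf_continuous g : (forall i, smooth1 (g i)) -> continuous (prodf g).
Proof.
move=> sg; rewrite /prodf; elim: (index_enum _) => [|i r IH] x.
  by under eq_fun do rewrite big_nil; exact: cst_continuous.
under eq_fun do rewrite big_cons; apply: continuousM; last exact: IH.
apply: (@continuous_comp _ _ _ (fun x : 'rV[R]_N => x 0 i) (g i)).
  exact: coord_continuous.
exact: smooth1_continuous.
Qed.

Lemma prodf_is_derive g i (g' : R -> R) x :
  (forall y, is_derive y (1 : R) (g i) (g' y)) ->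
  is_derive x (unitv i) (prodf g) (prodf (fun j => if j == i then g' else g j) x).
Proof.
move=> dg; set C := \prod_(j < N | j != i) g j (x 0 j).
have E h : (prodf g \o shift x) (h *: unitv i) = g i (h + x 0 i) * C.
  rewrite /prodf /= (bigD1 i)//= !mxE !eqxx mulr1; congr (_ * _).
  by apply: eq_bigr => j ji; rewrite !mxE eqxx (negbTE ji) mulr0 add0r.
have E0 : prodf g x = g i (x 0 i) * C by rewrite -[x in LHS]add0r -(scale0r (unitv i)) [LHS]E add0r.
have -> : prodf (fun j => if j == i then g' else g j) x = g' (x 0 i) * C.
  rewrite /prodf (bigD1 i)//= eqxx; congr (_ * _).
  by apply: eq_bigr => j /negPf ->.
have [dgi gi'] := dg (x 0 i).
have cv : (fun h => h^-1 *: ((prodf g \o shift x) (h *: unitv i) - prodf g x)) @ 0^' -->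
    g' (x 0 i) * C.
  under eq_fun do rewrite E E0 -mulrBl scalerAl.
  apply: cvgM; last exact: cvg_cst.
  have := dgi; rewrite /derivable => /cvg_ex[l] cl.
  have el : l = g' (x 0 i) by rewrite -gi'; apply/esym/cvg_lim.
  by move: cl; rewrite el; under eq_fun do rewrite /= [_ *: (1 : R)]mulr1.
by apply: DeriveDef; [apply/cvg_ex; eexists; exact: cv|exact: cvg_lim cv].
Qed.

Lemma pderiv_prodf g s : (forall i, smooth1 (g i)) ->
  exists2 g', (forall i, smooth1 (g' i)) & pderiv s (prodf g) = prodf g'.
Proof.
move=> sg; elim: s => [|i s [g' sg' IH]]; first by exists g.
have [h sh dh] := smooth1_is_derive _ (sg' i).
exists (fun j => if j == i then h else g' j); first by move=> j; case: ifP.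
rewrite /= -/(pderiv s _) IH; apply/funext => x.
by have [_ ->] := prodf_is_derive g' i h x dh.
Qed.

Lemma smooth_prodf g : (forall i, smooth1 (g i)) -> smooth (prodf g).
Proof.
move=> sg s; have [g' sg' ->] := pderiv_prodf g s sg; split.
  exact: prodf_continuous.
move=> i x; have [h sh dh] := smooth1_is_derive _ (sg' i).
by have [] := prodf_is_derive g' i h x dh.
Qed.

Lemma box_closed (a b : 'rV[R]_N) : closed (box (Some (a, b))).
Proof.
have -> : box (Some (a, b)) = \bigcap_(i in [set: 'I_N])
    ((fun x : 'rV[R]_N => x 0 i) @^-1` `[a 0 i, b 0 i]).
  apply/seteqP; split => [x h i _|x h i] /=; first by rewrite in_itv/= h.
  by have := h i I; rewrite /= in_itv.
apply: closed_bigI => i _.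
apply: (@preimage_closed _ _ (fun x : 'rV[R]_N => x 0 i)); last exact: itv_closed.
by move=> x _; exact: coord_continuous.
Qed.

Lemma box_compact (a b : 'rV[R]_N) : compact (box (Some (a, b))).
Proof.
have -> : box (Some (a, b)) = [set x : 'rV[R]_N | forall i, `[a 0 i, b 0 i]%classic (x ord0 i)].
  by apply/seteqP; split => x h i; have := h i; rewrite /= in_itv.
by have := @rV_compact R N (fun i => `[a 0 i, b 0 i]%classic) (fun i => @segment_compact R _ _).
Qed.

Definition bumpN m (a b : 'rV[R]_N) := prodf (fun i => bump m (a 0 i) (b 0 i)).

Lemma bumpN_neq0 m a b x : bumpN m a b x != 0 -> inflate m.+1%:R^-1 a b x.
Proof.
move=> /prodf_neq0 h i; have /bump_neq0/andP[h1 h2] := h i isT.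
by rewrite !mxE !ltW.
Qed.

Lemma test_function_bumpN (Omega : set 'rV[R]_N) m a b :
  inflate m.+1%:R^-1 a b `<=` Omega -> test_function Omega (bumpN m a b).
Proof.
move=> ab; have sub : closure [set x | bumpN m a b x != 0] `<=` inflate m.+1%:R^-1 a b.
  rewrite (closure_id (inflate _ _ _)).1; last exact: box_closed.
  by apply: closure_subset => x; exact: bumpN_neq0.
split; [|  | exact: subset_trans ab].
- by apply: smooth_prodf => i; exact: smooth1_bump.
- by apply: subclosed_compact sub; [exact: closed_closure|exact: box_compact].
Qed.

Lemma bumpN_itv m a b x : 0 <= bumpN m a b x <= 1.
Proof.
rewrite /bumpN /prodf prodr_ge0 => [|i _]; last by have /andP[] := bump_itv m (a 0 i) (b 0 i) (x 0 i).
by rewrite Num.Theory.prodr_ile1// => i _; exact: bump_itv.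
Qed.

Lemma cvg_bumpN a b x : bumpN m a b x @[m --> \oo] --> (\1_(box (Some (a, b))) x : R).
Proof.
have -> : \1_(box (Some (a, b))) x = \prod_i (if a 0 i <= x 0 i <= b 0 i then 1 else 0) :> R.
  rewrite indicE; case: (boolP (x \in _)) => [|].
    by rewrite inE => h; rewrite big1// => i _; rewrite h.
  rewrite notin_setE => /existsNP[i /negP/negPf hi].
  by rewrite (bigD1 i)//= hi mul0r.
rewrite /bumpN /prodf; elim: (index_enum _) => [|i r IH].
  by under eq_fun do rewrite big_nil; rewrite big_nil; exact: cvg_cst.
under eq_fun do rewrite big_cons; rewrite big_cons.
by apply: cvgM => //; exact: cvg_bump.
Qed.

End Product_functions.

(** * The fundamental lemma of the calculus of variations *)

Section Fundamental_lemma.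
Context {R : realType} {N : nat}.
Variable Omega : set 'rV[R]_N.
Hypothesis oO : open Omega.
Notation mu := (leb R N).
Implicit Types (g : 'rV[R]_N -> R) (a b : 'rV[R]_N) (o : option ('rV[R]_N * 'rV[R]_N)).

Let mO : measurable (Omega : set (space R N)) := open_space_measurable _ oO.
Notation sqi := (sqintegrable mu (Omega : set (space R N))).
Notation I := (ip mu (Omega : set (space R N))).

Lemma smooth_measurable (phi : 'rV[R]_N -> R) : smooth phi ->
  measurable_fun setT (phi : space R N -> R).
Proof. by move=> sphi; apply: continuous_space_measurable; have [] := sphi [::]. Qed.

Definition meet_box o o' : option ('rV[R]_N * 'rV[R]_N) :=
  if o is Some (a, b) then
    if o' is Some (a', b') then
      Some (\row_j Num.max (a 0 j) (a' 0 j), \row_j Num.min (b 0 j) (b' 0 j))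
    else None
  else None.

Lemma box_meet o o' : box (meet_box o o') = box o `&` box o'.
Proof.
case: o o' => [[a b]|] [[a' b']|]; rewrite ?setI0 ?set0I//=.
apply/seteqP; split => x /=.
  by move=> h; split=> i; have := h i; rewrite !mxE ge_max le_min => /andP[/andP[? ?] /andP[? ?]]; apply/andP.
by move=> [h h'] i; rewrite !mxE ge_max le_min; have /andP[-> ->] := h i; have /andP[-> ->] := h' i.
Qed.

Lemma box_lty o : (mu (box o) < +oo)%E.
Proof. by case: o => [[a b]|]; [exact: leb_box_lty|rewrite measure0]. Qed.

Section Orthogonal_to_test_functions.
Variable g : 'rV[R]_N -> R.
Hypothesis sg : sqi g.
Hypothesis g_orth : forall phi, test_function Omega phi -> I g phi = 0.

(** The functions [bumpN] are test functions that tend to the indicator of the box and are dominated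
    by the indicator of the inflated box. *)
Lemma orthogonal_box (e : R) a b : 0 < e -> inflate e a b `<=` Omega ->
  I g (\1_(box (Some (a, b)))) = 0.
Proof.
(* Starting at m0 keeps the margin 1/(m + m0 + 1) of the bumps within e. *)
move=> e0 abO; pose m0 := Num.truncn e^-1.
have m0e m : (m + m0).+1%:R^-1 <= e :> R.
  rewrite -[leRHS]invrK lef_pV2 ?posrE ?invr_gt0 ?ltr0n// ltW//.
  rewrite (lt_le_trans (Num.Theory.truncnS_gt _))// ler_nat ltnS; exact: leq_addl.
have sub m : inflate (m + m0).+1%:R^-1 a b `<=` inflate e a b.
  move=> x h i; have := h i; rewrite !mxE => /andP[h1 h2]; move: (m0e m) h1 h2; move: ((m + m0).+1%:R^-1) => c h0 h1 h2; apply/andP; split; lra.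
have tf m : test_function Omega (bumpN (m + m0) a b).
  by apply: test_function_bumpN; apply: subset_trans abO; exact: sub.
have mB : measurable (inflate e a b : set (space R N)) by exact: box_measurable.
have := @ip_dominated_cvg _ _ _ mu Omega mO g (\1_(inflate e a b))
  (fun m => bumpN (m + m0) a b) (\1_(box (Some (a, b)))) sg
  (sqintegrable_indic mO _ mB (box_lty _)).
under eq_fun do rewrite g_orth//.
move=> h; apply/esym; apply: cvg_unique (cvg_cst 0) (h _ _ _) => //.
- move=> m; apply: (measurable_funS measurableT) => //.
  by apply: smooth_measurable; have [] := tf m.
- move=> m x _; have /andP[h0 h1] := bumpN_itv (m + m0) a b x.
  rewrite ger0_norm// ger0_norm ?indicE//.
  have [|] := boolP (x \in inflate e a b); first by move=> _; exact: h1.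
  rewrite notin_setE => nx; have [->//|/bumpN_neq0/sub/nx[]] := eqVneq (bumpN (m + m0) a b x) 0.
- by move=> x _; have := cvg_bumpN a b x; rewrite -(cvg_shiftn m0).
Qed.

Section In_a_box.
Variables (e : R) (a0 b0 : 'rV[R]_N).
Hypotheses (e0 : 0 < e) (abO : inflate e a0 b0 `<=` Omega).
Let Q0 := box (Some (a0, b0)).

Let mQ0 : measurable (Q0 : set (space R N)) := box_measurable _.

(** The intersection is again a box, and it inherits the margin e of Q0 whatever o is. *)
Lemma orthogonal_box_meet o : I g (\1_(box o `&` Q0)) = 0.
Proof.
rewrite /Q0 -box_meet; case: o => [[a b]|] /=; last by rewrite indic0 ip0r.
apply: (orthogonal_box _ _ _ e0) => x h; apply: abO => i; have := h i; rewrite !mxE.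
have : a0 0 i <= Num.max (a 0 i) (a0 0 i) by rewrite le_max lexx orbT.
have : Num.min (b 0 i) (b0 0 i) <= b0 0 i by rewrite ge_min lexx orbT.
move: (Num.max _ _) (Num.min _ _) => c c' h1 h2 /andP[h3 h4].
by apply/andP; split; lra.
Qed.

Let bunion (r : seq (option ('rV[R]_N * 'rV[R]_N))) : set 'rV[R]_N :=
  \big[setU/set0]_(o <- r) box o.

Let bunion_measurable r : measurable (bunion r : set (space R N)).
Proof. by apply: bigsetU_measurable => o _; exact: box_measurable. Qed.

Let capQ0 (A : set 'rV[R]_N) : measurable (A : set (space R N)) ->
  measurable (A `&` Q0 : set (space R N)) /\ (mu (A `&` Q0) < +oo)%E.
Proof.
move=> mA; have mAQ : measurable (A `&` Q0 : set (space R N)) by exact: measurableI.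
split=> //; apply: le_lt_trans (box_lty (Some (a0, b0))).
by apply: le_measure; rewrite ?inE//; exact: subIsetr.
Qed.

Let ip_indicU (A B : set 'rV[R]_N) : measurable (A : set (space R N)) ->
  measurable (B : set (space R N)) ->
  I g (\1_((A `|` B) `&` Q0)) =
  I g (\1_(A `&` Q0)) + I g (\1_(B `&` Q0)) - I g (\1_(A `&` B `&` Q0)).
Proof.
move=> mA mB.
have [mAQ Aoo] := capQ0 _ mA; have [mBQ Boo] := capQ0 _ mB.
have [mABQ ABoo] := capQ0 _ (measurableI _ _ mA mB).
have sA := sqintegrable_indic (mu := mu) mO _ mAQ Aoo.
have sB := sqintegrable_indic (mu := mu) mO _ mBQ Boo.
have sAB := sqintegrable_indic (mu := mu) mO _ mABQ ABoo.
rewrite -ipDr// -ipBr//; last exact: sqintegrableD.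
apply: eq_Rintegral => x _; congr (_ * _).
rewrite !indicE !in_setI in_setU.
by case: (x \in A); case: (x \in B); case: (x \in Q0); rewrite /= ?addr0 ?subr0 ?add0r ?subrr ?addrK.
Qed.

(** Inclusion-exclusion. The intersections of one box with the others form a new list of the same
    length as the tail, so the induction is on the length and not on the list. *)
Let orthogonal_bunion r : I g (\1_(bunion r `&` Q0)) = 0.
Proof.
move: {2}(size r) (leqnn (size r)) => n; elim: n r => [|n IH] [|o r]//.
- by rewrite /bunion big_nil set0I indic0 ip0r.
- by rewrite /bunion big_nil set0I indic0 ip0r.
rewrite ltnS => rn; rewrite /bunion big_cons -/(bunion r) ip_indicU//; last exact: box_measurable.
have -> : box o `&` bunion r = bunion [seq meet_box o o' | o' <- r].
  rewrite /bunion big_map big_distrr/=; apply: eq_bigr => o' _.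
  by rewrite box_meet.
by rewrite orthogonal_box_meet !IH ?size_map// addr0 subr0.
Qed.

Let orthogonal_bigcup (F : nat -> option ('rV[R]_N * 'rV[R]_N)) :
  I g (\1_((\bigcup_k box (F k)) `&` Q0)) = 0.
Proof.
pose V n := bunion [seq F k | k <- iota 0 n].
have VE n : V n = \bigcup_(k < n) box (F k).
  by rewrite /V /bunion big_map bigcup_mkord -(big_mkord xpredT (fun k => box (F k))) /index_iota subn0.
have V0 : (fun n => I g (\1_(V n `&` Q0))) = (fun=> 0).
  by apply/funext => n; exact: orthogonal_bunion.
suff : I g (\1_(V n `&` Q0)) @[n --> \oo] --> I g (\1_((\bigcup_k box (F k)) `&` Q0)).
  by rewrite V0 => h; apply/esym; exact: cvg_unique (cvg_cst 0) h.
apply: (ip_dominated_cvg mO _ _ _ _ sg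
  (sqintegrable_indic mO _ mQ0 (box_lty (Some (a0, b0))))).
- by move=> n; apply: measurable_indic; have [] := capQ0 _ (bunion_measurable [seq F k | k <- iota 0 n]).
- move=> n x _; rewrite !indicE in_setI; case: (x \in Q0); last by rewrite andbF.
  by rewrite andbT; case: (x \in _); rewrite ?normr0 ?normr1.
- move=> x _; apply: cvg_near_cst.
  have [[k _ xk]|nx] := pselect ((\bigcup_k box (F k)) x).
    exists k.+1 => // n /= kn; rewrite !indicE !in_setI.
    rewrite (mem_set (_ : (\bigcup_k box (F k)) x)); last by exists k.
    by rewrite (mem_set (_ : V n x))// VE; exists k.
  apply: nearW => n; rewrite !indicE !in_setI.
  rewrite (memNset nx) memNset// VE => -[k _ xk]; apply: nx; exists k => //.
Qed.

(** By definition of the outer measure, E is covered by a countable union U of boxes with excess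
    less than d. As g integrates to 0 over the part of U in Q0, the Cauchy-Schwarz inequality on the
    excess gives (g, 1_E)^2 <= (g, g) d. *)
Lemma orthogonal_measurable (E : set 'rV[R]_N) : measurable (E : set (space R N)) ->
  E `<=` Q0 -> I g (\1_E) = 0.
Proof.
move=> mE EQ.
have muE : (mu E < +oo)%E.
  by apply: le_lt_trans (box_lty (Some (a0, b0))); apply: le_measure; rewrite ?inE.
have fE : leb_outer E \is a fin_num by rewrite ge0_fin_numE// leb_outer_ge0.
suff h d : 0 < d -> I g (\1_E) ^+ 2 <= I g g * d.
  apply/eqP; rewrite -sqrf_eq0 eq_le sqr_ge0.
  rewrite andbT; apply/ler_addgt0Pr => d d0; rewrite add0r.
  have gg0 : 0 <= I g g by exact: ip_ge0.
  (* The + 1 covers the case (g, g) = 0. *)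
  apply: le_trans (h (d / (I g g + 1)) _) _; first by rewrite divr_gt0// ltr_wpDl.
  by rewrite mulrCA ger_pMr// ler_pdivrMr ?ltr_wpDl// mul1r lerDl.
move=> d0.
have [_ [F EF <-] Fd] := lb_ereal_inf_adherent d0 fE.
set U := \bigcup_k box (F k).
have mU : measurable (U : set (space R N)) by apply: bigcupT_measurable => k; exact: box_measurable.
have [mUQ UQoo] := capQ0 _ mU.
have EUQ : E `<=` U `&` Q0 by move=> x Ex; split; [exact: EF|exact: EQ].
have muU : (mu (U `&` Q0) <= mu E + d%:E)%E.
  apply: le_trans (ltW Fd); apply: (@le_trans _ _ (leb_outer U)).
    by apply: le_leb_outer; exact: subIsetl.
  by apply: ereal_inf_lbound; exists F.
have mD : measurable ((U `&` Q0) `\` E : set (space R N)) by exact: measurableD.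
have Doo : (mu ((U `&` Q0) `\` E) < +oo)%E.
  by apply: le_lt_trans UQoo; apply: le_measure; rewrite ?inE//; exact: subDsetl.
have -> : I g (\1_E) = - I g (\1_((U `&` Q0) `\` E)).
  have sE := sqintegrable_indic (mu := mu) mO _ mE muE.
  have sD := sqintegrable_indic (mu := mu) mO _ mD Doo.
  apply/eqP; rewrite -addr_eq0 -ipDr//; apply/eqP.
  rewrite -[RHS](orthogonal_bigcup F); apply: eq_Rintegral => x _; congr (_ * _).
  rewrite !indicE in_setD; case: (boolP (x \in E)) => [xE|]; last by rewrite add0r andbT.
  by rewrite andbF addr0 mem_set//; apply: EUQ; rewrite inE in xE.
rewrite sqrrN (le_trans (ip_indic_CauchySchwarz mO _ _ sg mD Doo))//.
apply: ler_wpM2l; first exact: ip_ge0.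
rewrite -lee_fin fineK; last by rewrite ge0_fin_numE.
have -> : (mu ((U `&` Q0) `\` E) = mu (U `&` Q0) - mu E)%E.
  rewrite -[in RHS](setIidr EUQ).
  exact: measureD.
by rewrite leeBlDl// ge0_fin_numE.
Qed.

Lemma ae_eq0_box : {ae mu, forall x, Q0 x -> g x = 0}.
Proof.
have Q0O : Q0 `<=` Omega.
  move=> x h; apply: abO => i; have := h i; rewrite !mxE => /andP[h1 h2].
  by have := e0; move=> e0'; apply/andP; split; lra.
have sQ := sqintegrable_indic (mu := mu) mO _ mQ0 (box_lty (Some (a0, b0))).
have ig : mu.-integrable Q0 (EFin \o g).
  have ig1 := sqintegrableM mO _ _ sg sQ.
  have := integrableS mO mQ0 Q0O ig1.
  by apply: eq_integrable => // x xQ /=; rewrite indicE xQ mulr1.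
have := @integral_ae_eq _ _ _ mu Q0 mQ0 (cst 0) (EFin \o g) ig (measurable_cst _).
move=> h; have {h} : ae_eq mu Q0 (EFin \o g) (cst 0).
  apply: h => E EQ mE; rewrite integral0.
  have := orthogonal_measurable E mE EQ.
  rewrite /ip => h.
  have iE : mu.-integrable E (EFin \o g) by apply: integrableS ig.
  rewrite -[LHS]fineK; last exact: integrable_fin_num.
  congr EFin; rewrite -h /Rintegral; congr fine.
  have EE : Omega `&` E = E by rewrite setIidr//; exact: subset_trans Q0O.
  rewrite -[X in integral _ X _]EE integral_mkcondr; apply: eq_integral => x _.
  by rewrite /patch indicE; case: (x \in E) => /=; rewrite ?mulr1 ?mulr0.
by apply: filterS => x h /h[].
Qed.

End In_a_box.

(** Omega is a countable union of boxes that have a margin inside it, and g vanishes almost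
    everywhere on each of them. *)
Lemma orthogonal_ae_eq0 : {ae mu, forall x, Omega x -> g x = 0}.
Proof.
have [F OF Fe] := open_box_cover Omega oO.
have h k : {ae mu, forall x, box (F k) x -> g x = 0}.
  move Fk : (F k) => [[a b]|]; last first.
    by apply: aeW => x [].
  have [e e0 abO] := Fe _ _ _ Fk; exact: (ae_eq0_box e a b e0 abO).
have := ae_foralln h; apply: filterS => x hx /OF[k _]; exact: hx.
Qed.

End Orthogonal_to_test_functions.
End Fundamental_lemma.

(** * Weak derivatives and Sobolev spaces *)

Section Integration_by_parts.
Context {R : realType} {N : nat}.
Notation mu := (leb R N).
Implicit Types (F phi psi : 'rV[R]_N -> R) (a b x : 'rV[R]_N) (i : 'I_N).

Lemma derive_eq0_off_support F a b i x : (forall x, F x != 0 -> box (Some (a, b)) x) ->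
  ~ box (Some (a, b)) x -> 'D_(unitv i) F x = 0.
Proof.
move=> supp nx; rewrite -(derive_cst (0 : R) x (unitv i)); apply: near_eq_derive.
have : open (~` box (Some (a, b))) by apply: closed_openC; exact: box_closed.
rewrite openE => /(_ x nx); apply: filterS => y ny.
by apply/eqP; apply: contraT => /supp/ny.
Qed.

Lemma continuous_bounded_support F a b : continuous F ->
  (forall x, F x != 0 -> box (Some (a, b)) x) -> exists M : R, forall x, `|F x| <= M.
Proof.
move=> cF supp.
have : compact (F @` box (Some (a, b))).
  by apply: continuous_compact (box_compact a b); exact: continuous_subspaceT.
move=> /compact_bounded[M [_ hM]]; exists (`|M| + 1) => x.
have [->|/supp bx] := eqVneq (F x) 0; first by rewrite normr0 addr_ge0.
apply: hM; last by exists x.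
by rewrite (le_lt_trans (ler_norm M))// ltrDl.
Qed.

Lemma integrable_indic_box a b M :
  mu.-integrable setT (fun x : space R N => (M * \1_(box (Some (a, b))) x)%:E).
Proof.
have mB : measurable (box (Some (a, b)) : set (space R N)) by exact: box_measurable.
under eq_fun do rewrite EFinM; apply: integrableZl => //.
apply/integrableP; split; first by apply/measurable_EFinP; exact: measurable_indic.
under eq_integral do rewrite gee0_abs ?lee_fin//.
by rewrite integral_indic// setIT; exact: leb_box_lty.
Qed.

Lemma integrable_bounded_support F a b M : measurable_fun setT (F : space R N -> R) ->
  (forall x, F x != 0 -> box (Some (a, b)) x) -> (forall x, `|F x| <= M) ->
  mu.-integrable setT (EFin \o (F : space R N -> R)).
Proof.
move=> mF supp FM.
have mEF : measurable_fun setT (EFin \o (F : space R N -> R)) by exact/measurable_EFinP.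
apply: (le_integrable measurableT mEF _ (integrable_indic_box a b M)).
move=> x _; rewrite /= lee_fin indicE.
have [Fx0|/supp Bx] := eqVneq (F x) 0; first by rewrite Fx0 normr0.
by rewrite mem_set// mulr1 (le_trans (FM x))// ler_norm.
Qed.

(** Each difference quotient of F in direction i has integral 0, because the integral is invariant
    under translation. The mean value theorem bounds the quotients by the maximum M of the
    derivative, so dominated convergence applies. *)
Lemma Rintegral_derive_eq0 F a b i : continuous F ->
  (forall x, derivable F x (unitv i)) -> continuous ('D_(unitv i) F) ->
  (forall x, F x != 0 -> box (Some (a, b)) x) ->
  \int[mu]_x ('D_(unitv i) F x) = 0.
Proof.
move=> cF dF cG supp; set G := 'D_(unitv i) F.
have suppG x : G x != 0 -> box (Some (a, b)) x.
  by move=> nx; apply: contrapT => /(derive_eq0_off_support F a b i x supp)/eqP; rewrite (negbTE nx).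
have [M GM] := continuous_bounded_support _ _ _ cG suppG.
have [M' FM'] := continuous_bounded_support _ _ _ cF supp.
have lip x h : `|F (x + h *: unitv i) - F x| <= M * `|h|.
  pose f t := F (x + t *: unitv i).
  have df t : is_derive t (1 : R) f (G (x + t *: unitv i)).
    have := derivableP (dF (x + t *: unitv i)).
    have E : (fun h : R => h^-1 *: ((f \o shift t) (h *: (1 : R)) - f t)) =
      (fun h => h^-1 *: ((F \o shift (x + t *: unitv i)) (h *: unitv i) - F (x + t *: unitv i))).
      apply/funext => u; rewrite /f /= [u *: 1]mulr1 scalerDl.
      by rewrite [_ *: _ + (x + _)]addrC -addrA [_ + u *: _]addrC.
    move=> [d1 d2]; apply: DeriveDef; first by rewrite /derivable E.
    by rewrite /derive E.
  have cf : continuous f.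
    by move=> t; apply: differentiable_continuous; apply/derivable1_diffP; have [] := df t.
  have f0 : F x = f 0 by rewrite /f scale0r addr0.
  rewrite f0 -/(f h).
  have wf u v : {within `[u, v], continuous f} by exact: continuous_subspaceT.
  have [h0|h0] := leP 0 h.
    have [c _ ->] := MVT_segment h0 (fun t _ => df t) (wf _ _).
    by rewrite subr0 normrM ler_wpM2r // GM.
  have [c _ hc] := MVT_segment (ltW h0) (fun t _ => df t) (wf _ _).
  by rewrite distrC hc sub0r normrM normrN ler_wpM2r // GM.
pose e n : R := n.+1%:R^-1.
have e0 n : e n != 0 by rewrite invr_neq0// pnatr_eq0.
pose q n x := (e n)^-1 * (F (x + e n *: unitv i) - F x).
have mF : measurable_fun setT (F : space R N -> R) by exact: continuous_space_measurable.
have mFs n : measurable_fun setT ((fun x => F (x + e n *: unitv i)) : space R N -> R).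
  by apply: (measurableT_comp mF); exact: shift_measurable.
(* All steps e n are at most 1, so one box, inflated by 1, contains the supports of all the
   quotients. *)
have suppFs n x : F (x + e n *: unitv i) != 0 -> inflate 1 a b x.
  move=> /supp h j; have /andP[] := h j; rewrite !mxE eqxx /=.
  have : 0 <= e n <= 1 by rewrite invr_ge0 ler0n/= invf_le1 ?ltr0n// ler1n.
  move: (e n) => c /andP[? ?]; case: (j == i); rewrite ?mulr1 ?mulr0 ?addr0 => ? ?;
  apply/andP; split; lra.
have emF : measurable_fun setT (EFin \o (F : space R N -> R)) by exact/measurable_EFinP.
have iF := integrable_bounded_support _ _ _ _ mF supp FM'.
have iFs n := integrable_bounded_support _ _ _ _ (mFs n) (suppFs n) (fun x => FM' _).
have Iq n : \int[mu]_x q n x = 0.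
  have iB := integrableB measurableT (iFs n) iF.
  rewrite /q RintegralZl//.
  rewrite RintegralB// [X in X - _](_ : _ = \int[mu]_x F x) ?subrr ?mulr0//.
  rewrite /Rintegral; congr fine.
  exact: (integral_shift (e n *: unitv i) (EFin \o (F : space R N -> R)) emF (iFs n)).
have iG : mu.-integrable setT (EFin \o (G : space R N -> R)).
  apply: integrable_bounded_support suppG GM.
  exact: continuous_space_measurable.
have mq n : measurable_fun setT (q n : space R N -> R).
  apply: measurable_funM; first exact: measurable_cst.
  by apply: measurable_funB; [exact: mFs|exact: mF].
have cvgq : (\int[mu]_x (q n x)%:E @[n --> \oo] --> \int[mu]_x (G x)%:E)%E.
  apply: (@dominated_cvg _ _ _ mu setT measurableT _ _
    (fun x => (M * \1_(inflate 1 a b) x)%:E)).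
  - by move=> n; apply/measurable_EFinP.
  - move=> x _; apply: cvg_EFin; first exact: nearW.
    have := derivableP (dF x); rewrite -/G => -[+ dG]; rewrite /derivable.
    move=> /cvg_ex[l cl]; have lG : l = G x by apply/esym; rewrite /G /derive; exact: cvg_lim cl.
    rewrite lG in cl.
    have ce : e n @[n --> \oo] --> (0 : R)^'.
      have ceh : e n @[n --> \oo] --> (0 : R) by exact: cvg_harmonic.
      move=> A hA; have hn : \forall n \near \oo, (e n != 0 -> A (e n)) := ceh _ hA.
      suff : \forall n \near \oo, A (e n) by [].
      by apply: filterS hn => n; apply; exact: e0.
    have := cvg_comp _ _ ce cl; apply: cvg_trans; apply: near_eq_cvg.
    by apply: nearW => n /=; rewrite /q [in RHS](addrC x).
  - by [].
  - exact: integrable_indic_box.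
  - move=> n x _; rewrite /= lee_fin indicE.
    have [xB|nxB] := boolP (x \in inflate 1 a b).
      rewrite mulr1 /q normrM normfV ler_pdivrMl ?normr_gt0// mulrC.
      exact: lip.
    rewrite notin_setE in nxB.
    have -> : q n x = 0.
      have F0 : F x = 0.
        apply/eqP; apply: contraT => /supp h; case: nxB => j; have /andP[] := h j.
        by rewrite !mxE => ? ?; apply/andP; split; lra.
      have F1 : F (x + e n *: unitv i) = 0 by apply/eqP; apply: contraT => /suppFs/nxB.
      by rewrite /q F0 F1 subrr mulr0.
    by rewrite normr0 mulr0.
have q0 : (fun n => \int[mu]_x (q n x)%:E)%E = (fun=> 0%E).
  apply/funext => n; rewrite -[LHS]fineK; first by rewrite [fine _]Iq.
  apply: integrable_fin_num => //; rewrite /q.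
  under eq_fun do rewrite EFinM; apply: integrableZl => //.
  exact: (integrableB measurableT (iFs n) iF).
rewrite q0 in cvgq.
by rewrite /Rintegral (cvg_unique _ cvgq (cvg_cst 0%E)).
Qed.

End Integration_by_parts.

Section Weak_derivatives.
Context {R : realType} {N : nat}.
Variable Omega : set 'rV[R]_N.
Hypothesis oO : open Omega.
Notation mu := (leb R N).
Notation sqi := (sqintegrable mu (Omega : set (space R N))).
Notation I := (ip mu (Omega : set (space R N))).
Implicit Types (w z g h phi psi : 'rV[R]_N -> R) (s : seq 'I_N) (i : 'I_N).

Let mO : measurable (Omega : set (space R N)) := open_space_measurable _ oO.

Lemma L2P w : L2 Omega w <-> sqi w.
Proof.
split=> [[mw woo]|sw]; first exact: (sqintegrable_Lnorm _ mw woo).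
split; first by have [] := sw.
by rewrite /Lp_norm (LnormE mO _ sw) ltry.
Qed.

Lemma L2_norm w : sqi w -> Lp_norm Omega 2 w = (Num.sqrt (I w w))%:E.
Proof. exact: (LnormE mO). Qed.

Lemma test_function_box phi : test_function Omega phi ->
  exists a b, forall x, phi x != 0 -> box (Some (a, b)) x.
Proof.
move=> [_ /compact_bounded/bounded_sub_box[a [b ab]] _]; exists a, b => x px.
by apply: ab; exact: subset_closure.
Qed.

Lemma pderiv_cat s1 s2 phi : pderiv (s1 ++ s2) phi = pderiv s1 (pderiv s2 phi).
Proof. by rewrite /pderiv foldr_cat. Qed.

Lemma test_function_derive i phi : test_function Omega phi ->
  test_function Omega ('D_(unitv i) phi).
Proof.
move=> [sphi cphi pO].
have sub : closure [set x | 'D_(unitv i) phi x != 0] `<=` closure [set x | phi x != 0].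
  rewrite [X in _ `<=` X](closure_id _).1; last exact: closed_closure.
  apply: closure_subset => x /=; apply: contraPP => nx.
  suff -> : 'D_(unitv i) phi x = 0 by move/eqP.
  rewrite -(derive_cst (0 : R) x (unitv i)); apply: near_eq_derive.
  have : open (~` closure [set x | phi x != 0]) by apply: closed_openC; exact: closed_closure.
  rewrite openE => /(_ x nx); apply: filterS => y ny.
  by apply/eqP; apply: contraT => py; exfalso; apply: ny; exact: subset_closure.
split; [|by apply: subclosed_compact cphi sub; exact: closed_closure|exact: subset_trans pO].
by move=> s; have := sphi (s ++ [:: i]); rewrite pderiv_cat.
Qed.

Lemma test_function_pderiv s phi : test_function Omega phi ->
  test_function Omega (pderiv s phi).
Proof. by move=> tphi; elim: s => [//|i s IH]; exact: test_function_derive. Qed.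

Lemma test_function_sqintegrable phi : test_function Omega phi -> sqi phi.
Proof.
move=> tphi; have [sphi _ _] := tphi; have [cphi _] := sphi [::].
have [a [b supp]] := test_function_box _ tphi.
have [M pM] := continuous_bounded_support _ _ _ cphi supp.
have mphi := smooth_measurable _ sphi.
split; first exact: (measurable_funS measurableT _ mphi).
have supp2 x : phi x ^+ 2 != 0 -> box (Some (a, b)) x.
  by rewrite sqrf_eq0 => /supp.
have M2 x : `|phi x ^+ 2| <= M ^+ 2.
  by rewrite normrX lerXn2r ?nnegrE// (le_trans _ (pM x)).
have mphi2 : measurable_fun setT ((fun x => phi x ^+ 2) : space R N -> R) by exact: measurable_funX.
exact: (integrableS measurableT mO _ (integrable_bounded_support _ _ _ _ mphi2 supp2 M2)).
Qed.

Lemma Rintegral_supported F : measurable_fun setT (F : space R N -> R) ->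
  (forall x, F x != 0 -> Omega x) -> \int[mu]_(x in Omega) F x = \int[mu]_x F x.
Proof.
move=> mF FO; rewrite Rintegral_mkcond; apply: eq_Rintegral => x _.
rewrite /patch; case: ifPn => //; rewrite notin_setE => nO.
by apply/esym/eqP; apply: contraT => /FO/nO.
Qed.

Lemma test_functionS phi x : test_function Omega phi -> phi x != 0 -> Omega x.
Proof. by move=> [_ _ pO] px; apply: pO; exact: subset_closure. Qed.

Lemma ip_derive i phi psi : test_function Omega phi -> test_function Omega psi ->
  I phi ('D_(unitv i) psi) = - I ('D_(unitv i) phi) psi.
Proof.
move=> tphi tpsi; have [sphi _ _] := tphi; have [spsi _ _] := tpsi.
have [cphi dphi] := sphi [::]; have [cpsi dpsi] := spsi [::].
have [cdphi _] := sphi [:: i]; have [cdpsi _] := spsi [:: i].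
have stphi := test_function_sqintegrable _ tphi.
have stpsi := test_function_sqintegrable _ tpsi.
have sdphi := test_function_sqintegrable _ (test_function_derive i _ tphi).
have sdpsi := test_function_sqintegrable _ (test_function_derive i _ tpsi).
pose F x := phi x * psi x.
have DFx x : 'D_(unitv i) F x = phi x * 'D_(unitv i) psi x + psi x * 'D_(unitv i) phi x.
  by apply: (@deriveM _ _ phi psi); [exact: dphi|exact: dpsi].
have DF := funext DFx.
have [a [b supp]] := test_function_box _ tphi.
have cDF : continuous ('D_(unitv i) F).
  rewrite DF => x; apply: (@continuousD R R^o _ (fun x => phi x * 'D_(unitv i) psi x)
      (fun x => psi x * 'D_(unitv i) phi x) x).
    by apply: (@continuousM R _ phi ('D_(unitv i) psi) x); [exact: cphi|exact: cdpsi].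
  by apply: (@continuousM R _ psi ('D_(unitv i) phi) x); [exact: cpsi|exact: cdphi].
have cF : continuous F by move=> x; apply: continuousM; [exact: cphi|exact: cpsi].
have F0 x : F x != 0 -> phi x != 0.
  by apply: contra_neq; rewrite /F => ->; rewrite mul0r.
have dF x : derivable F x (unitv i) by apply: (@derivableM _ _ phi psi); [exact: dphi|exact: dpsi].
have suppDF x : 'D_(unitv i) F x != 0 -> Omega x.
  rewrite DFx => h; apply: contrapT => nO; move/negP: h; apply.
  have -> : phi x = 0 by apply/eqP; apply: contraT => /(test_functionS _ _ tphi)/nO.
  have -> : psi x = 0 by apply/eqP; apply: contraT => /(test_functionS _ _ tpsi)/nO.
  by rewrite !mul0r addr0.
have mDF := continuous_space_measurable _ cDF.
have := Rintegral_derive_eq0 F a b i cF dF cDF (fun x Fx => supp x (F0 x Fx)).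
rewrite -(Rintegral_supported _ mDF suppDF).
rewrite DF RintegralD; [|exact: mO|exact: (sqintegrableM mO _ _ stphi sdpsi)|exact: (sqintegrableM mO _ _ stpsi sdphi)].
by move=> /eqP; rewrite addr_eq0 => /eqP; rewrite -/(ip _ _ _ _) => ->; rewrite ipC.
Qed.

(** Each integration by parts takes the outermost derivative off psi and applies it to phi first,
    ahead of those that follow; hence the reversal of s. *)
Lemma weak_derivative_test_function s phi : test_function Omega phi ->
  weak_derivative Omega s phi (pderiv (rev s) phi).
Proof.
move=> tphi; split.
  by apply/L2P/test_function_sqintegrable/test_function_pderiv.
elim: s phi tphi => [|i s IH] phi tphi psi tpsi; first by rewrite expr0 mul1r.
rewrite [LHS](ip_derive i phi (pderiv s psi) tphi (test_function_pderiv s _ tpsi)).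
rewrite rev_cons -cats1 pderiv_cat /= exprS mulN1r mulNr; congr (- _).
by apply: IH => //; exact: test_function_derive.
Qed.

Lemma weak_derivative_unique s w g h : weak_derivative Omega s w g ->
  weak_derivative Omega s w h -> {ae mu, forall x, Omega x -> g x = h x}.
Proof.
move=> [/L2P sg Hg] [/L2P sh Hh].
have sgh := sqintegrableB mO _ _ sg sh.
have := orthogonal_ae_eq0 Omega oO _ sgh.
move=> H; have : {ae mu, forall x, Omega x -> g x - h x = 0}.
  apply: H => phi tphi; have sphi := test_function_sqintegrable _ tphi.
  rewrite (ipBl mO) //; apply/eqP; rewrite subr_eq0; apply/eqP.
  have sgn0 : (-1) ^+ size s != 0 :> R by rewrite signr_eq0.
  by apply: (mulfI sgn0); rewrite -[LHS](Hg phi tphi) -[RHS](Hh phi tphi).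
by apply: ae_impl => x hx /hx /eqP; rewrite subr_eq0 => /eqP.
Qed.

(** When w has no such weak derivative, [wD] is the default 0, which is square integrable too. *)
Lemma sqintegrable_wD s w : sqi (wD Omega s w).
Proof.
rewrite /wD; case: xgetP => [g _ [/L2P //]|_]; exact: sqintegrable0.
Qed.

Lemma wD_weak_derivative s w g : weak_derivative Omega s w g ->
  weak_derivative Omega s w (wD Omega s w).
Proof. by move=> hg; apply: (@xgetPex _ (cst 0) (weak_derivative Omega s w)); exists g. Qed.

Lemma wD_unique s w g : weak_derivative Omega s w g ->
  {ae mu, forall x, Omega x -> wD Omega s w x = g x}.
Proof.
by move=> hg; exact: (weak_derivative_unique _ _ _ _ (wD_weak_derivative _ _ _ hg) hg).
Qed.

Lemma weak_derivativeB s w z g h : sqi w -> sqi z -> weak_derivative Omega s w g ->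
  weak_derivative Omega s z h ->
  weak_derivative Omega s (w - z) (fun x => g x - h x).
Proof.
move=> sw sz [/L2P sg Hg] [/L2P sh Hh]; split; first by apply/L2P; exact: (sqintegrableB mO).
move=> phi tphi; have sphi := test_function_sqintegrable _ tphi.
have spphi := test_function_sqintegrable _ (test_function_pderiv s _ tphi).
have E1 : inner Omega (w - z) (pderiv s phi) = I w (pderiv s phi) - I z (pderiv s phi).
  exact: (ipBl mO).
have E2 : inner Omega (fun x => g x - h x) phi = I g phi - I h phi by exact: (ipBl mO).
have Eg : I w (pderiv s phi) = (-1) ^+ size s * I g phi := Hg phi tphi.
have Eh : I z (pderiv s phi) = (-1) ^+ size s * I h phi := Hh phi tphi.
by rewrite E1 E2 Eg Eh mulrBr.
Qed.

Lemma weak_derivative_nil w : sqi w -> weak_derivative Omega [::] w w.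
Proof. by move=> sw; split; [exact/L2P|move=> phi tphi; rewrite expr0 mul1r]. Qed.

(** The equality holds everywhere: both choices are made from one and the same set of candidates. *)
Lemma eq_wD s w z : measurable_fun (Omega : set (space R N)) (w : space R N -> R) ->
  measurable_fun (Omega : set (space R N)) (z : space R N -> R) ->
  {ae mu, forall x, Omega x -> w x = z x} -> wD Omega s w = wD Omega s z.
Proof.
move=> mw mz wz; rewrite /wD; congr xget; apply/seteqP; split => g [Lg Hg];
    split=> // phi tphi; rewrite -Hg//; apply: (eq_ip_ae mO) => //.
- by have [] := test_function_sqintegrable _ (test_function_pderiv s _ tphi).
- by have [] := test_function_sqintegrable _ (test_function_pderiv s _ tphi).
- by apply: ae_impl wz => x h /h.
- by apply: aeW.
- by have [] := test_function_sqintegrable _ (test_function_pderiv s _ tphi).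
- by have [] := test_function_sqintegrable _ (test_function_pderiv s _ tphi).
- by apply: aeW.
Qed.

(** Only the sum of the second derivatives is tested. This determines g almost everywhere and is the
    form in which it enters Green's formula [ip_lap_W022]. *)
Definition weak_laplacian w g : Prop := sqi g /\ forall phi, test_function Omega phi ->
  I g phi = \sum_i I w (pderiv [:: i; i] phi).

Lemma weak_laplacian_unique w g h : weak_laplacian w g -> weak_laplacian w h ->
  {ae mu, forall x, Omega x -> g x = h x}.
Proof.
move=> [sg Hg] [sh Hh]; have sgh := sqintegrableB mO _ _ sg sh.
have H : {ae mu, forall x, Omega x -> g x - h x = 0}.
  apply: (orthogonal_ae_eq0 Omega oO _ sgh) => phi tphi.
  have sphi := test_function_sqintegrable _ tphi.
  by rewrite (ipBl mO) // Hg// Hh// subrr.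
by apply: ae_impl H => x hx /hx /eqP; rewrite subr_eq0 => /eqP.
Qed.

Lemma weak_laplacianB w z g h : sqi w -> sqi z -> weak_laplacian w g ->
  weak_laplacian z h -> weak_laplacian (w - z) (fun x => g x - h x).
Proof.
move=> sw sz [sg Hg] [sh Hh]; split; first exact: (sqintegrableB mO).
move=> phi tphi; have sphi := test_function_sqintegrable _ tphi.
rewrite (ipBl mO)// Hg// Hh// -sumrB; apply: eq_bigr => i _; apply/esym/(ipBl mO) => //.
exact: test_function_sqintegrable _ (test_function_pderiv [:: i; i] _ tphi).
Qed.

Lemma lapE w : lap Omega w = fun x => \sum_i wD Omega [:: i; i] w x.
Proof. by apply/funext => x; rewrite /lap fct_sumE. Qed.

Lemma sqintegrable_lap w : sqi (lap Omega w).
Proof. by rewrite lapE; apply: (sqintegrable_sum mO) => i; exact: sqintegrable_wD. Qed.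

Lemma lap_weak_laplacian w : (forall i, exists g, weak_derivative Omega [:: i; i] w g) ->
  weak_laplacian w (lap Omega w).
Proof.
move=> wd; split; first exact: sqintegrable_lap.
move=> phi tphi; have sphi := test_function_sqintegrable _ tphi.
rewrite lapE ipC (ip_sumr mO _ _ _ _ sphi (fun i => sqintegrable_wD _ _)).
apply: eq_bigr => i _; have [g hg] := wd i; have [_ h] := wD_weak_derivative _ _ _ hg.
have E : I w (pderiv [:: i; i] phi) = (-1) ^+ 2 * I (wD Omega [:: i; i] w) phi := h phi tphi.
by rewrite E sqrrN expr1n mul1r ipC.
Qed.

Lemma Sobolev_weak_derivative k w s : Sobolev Omega k w -> (size s <= k)%N ->
  weak_derivative Omega s w (wD Omega s w).
Proof. by move=> [_ h] /h[g hg]; exact: wD_weak_derivative hg. Qed.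

(** A second form of Lap^2 w for w in W^{4,2}. Taking [lap] twice differentiates a chosen function
    again, whereas here each summand is one weak derivative of w, controlled by the norm of
    W^{4,2}. *)
Definition bilap w : 'rV[R]_N -> R :=
  fun x => \sum_j \sum_i wD Omega [:: i; i; j; j] w x.

Lemma weak_laplacian_bilap z : Sobolev Omega 4 z ->
  weak_laplacian (lap Omega z) (lap Omega (lap Omega z)) /\
  {ae mu, forall x, Omega x -> lap Omega (lap Omega z) x = bilap z x}.
Proof.
move=> Sz.
(* Since D_jj phi is again a test function, testing Lap z against it moves all four derivatives onto
   phi, in the order i, i, j, j. *)
have wdj j : weak_derivative Omega [:: j; j] (lap Omega z)
    (fun x => \sum_i wD Omega [:: i; i; j; j] z x).
  have s4 : sqi (fun x => \sum_i wD Omega [:: i; i; j; j] z x).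
    by apply: (sqintegrable_sum mO) => i; exact: sqintegrable_wD.
  split; first exact/L2P.
  move=> phi tphi; have tjj := test_function_pderiv [:: j; j] _ tphi.
  have sphi := test_function_sqintegrable _ tphi.
  have wl : weak_laplacian z (lap Omega z).
    apply: lap_weak_laplacian => i; exists (wD Omega [:: i; i] z).
    exact: (Sobolev_weak_derivative 4).
  have [_ /(_ _ tjj) E] := wl.
  transitivity (I (lap Omega z) (pderiv [:: j; j] phi)); first by [].
  rewrite E /= sqrrN expr1n mul1r.
  transitivity (I (fun x => \sum_i wD Omega [:: i; i; j; j] z x) phi); last by [].
  rewrite [RHS]ipC (ip_sumr mO _ _ _ _ sphi (fun i => sqintegrable_wD _ _)).
  apply: eq_bigr => i _; rewrite [RHS]ipC.
  have [_ /(_ _ tphi)] : weak_derivative Omega [:: i; i; j; j] z (wD Omega [:: i; i; j; j] z).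
    exact: (Sobolev_weak_derivative 4).
  by rewrite /= -signr_odd expr0 mul1r.
have wl2 : weak_laplacian (lap Omega z) (lap Omega (lap Omega z)).
  by apply: lap_weak_laplacian => j; eexists; exact: wdj.
split=> //; apply: weak_laplacian_unique wl2 _; split.
  by apply: (sqintegrable_sum mO) => j; case: (wdj j) => /L2P.
move=> phi tphi; have sphi := test_function_sqintegrable _ tphi.
rewrite ipC (ip_sumr mO _ _ _ _ sphi (fun j => (L2P _).1 (wdj j).1)).
apply: eq_bigr => j _; rewrite ipC; have [_ /(_ _ tphi)] := wdj j.
by rewrite /= sqrrN expr1n mul1r => E; rewrite -[LHS]E.
Qed.

End Weak_derivatives.

Section Sobolev_spaces.
Context {R : realType} {N : nat}.
Variable Omega : set 'rV[R]_N.
Hypothesis oO : open Omega.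
Notation mu := (leb R N).
Notation sqi := (sqintegrable mu (Omega : set (space R N))).
Notation I := (ip mu (Omega : set (space R N))).
Implicit Types (w z g h phi psi : 'rV[R]_N -> R) (s : seq 'I_N) (i : 'I_N).

Let mO : measurable (Omega : set (space R N)) := open_space_measurable _ oO.
Let swD s w : sqi (wD Omega s w) := sqintegrable_wD Omega oO s w.
Let slap w : sqi (lap Omega w) := sqintegrable_lap Omega oO w.

Definition sobolev_sq k w : R :=
  \sum_(j < k.+1) \sum_(s : j.-tuple 'I_N) I (wD Omega s w) (wD Omega s w).

Lemma Sobolev_normE k w : Sobolev_norm Omega k w = (Num.sqrt (sobolev_sq k w))%:E.
Proof.
rewrite /Sobolev_norm /sobolev_sq.
have E (j : 'I_k.+1) : (\sum_(s : j.-tuple 'I_N) Lp_norm Omega 2 (wD Omega s w) ^+ 2)%E =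
    (\sum_(s : j.-tuple 'I_N) I (wD Omega s w) (wD Omega s w))%:E.
  rewrite -sumEFin; apply: eq_bigr => s _.
  rewrite (L2_norm Omega oO _ (swD s w)) -EFin_expe sqr_sqrtr//; exact: ip_ge0.
under eq_bigr do rewrite E.
rewrite sumEFin poweR_EFin powR12_sqrt//.
by apply: sumr_ge0 => j _; apply: sumr_ge0 => s _; exact: ip_ge0.
Qed.

Lemma sobolev_sq_ge0 k w : 0 <= sobolev_sq k w.
Proof. by apply: sumr_ge0 => j _; apply: sumr_ge0 => s _; exact: ip_ge0. Qed.

Lemma ip_wD_le k w s : (size s <= k)%N ->
  I (wD Omega s w) (wD Omega s w) <= sobolev_sq k w.
Proof.
rewrite -ltnS => sk; rewrite /sobolev_sq (bigD1 (Ordinal sk))//= (bigD1 (in_tuple s))//=.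
rewrite -addrA lerDl addr_ge0//; first by apply: sumr_ge0 => t _; exact: ip_ge0.
by apply: sumr_ge0 => j _; apply: sumr_ge0 => t _; exact: ip_ge0.
Qed.

Lemma W022_normE w : W022_norm Omega w = (Num.sqrt (I (lap Omega w) (lap Omega w)))%:E.
Proof. exact: (L2_norm Omega oO _ (slap w)). Qed.

Lemma energyE w z : energy Omega w z =
  I (lap Omega w) (lap Omega w) + I (lap Omega z) (lap Omega z).
Proof.
have E v : fine (W022_norm Omega v) ^+ 2 = I (lap Omega v) (lap Omega v).
  by rewrite W022_normE; exact: (sqr_sqrtr (ip_ge0 _)).
by rewrite /energy !E.
Qed.

Lemma cvg_ip (a : 'rV[R]_N -> R) (b : nat -> 'rV[R]_N -> R) h :
  sqi a -> (forall n, sqi (b n)) -> sqi h ->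
  I (fun x => a x - b n x) (fun x => a x - b n x) @[n --> \oo] --> (0 : R) ->
  I (b n) h @[n --> \oo] --> I a h.
Proof.
move=> sa sb sh c0.
have cs n : `|I a h - I (b n) h| <=
    Num.sqrt (I (fun x => a x - b n x) (fun x => a x - b n x)) * Num.sqrt (I h h).
  rewrite -(ipBl mO _ _ _ sh sa (sb n)) -sqrtrM; last exact: ip_ge0.
  rewrite -sqrtr_sqr ler_sqrt.
    exact: (ip_CauchySchwarz mO _ _ (sqintegrableB mO _ _ sa (sb n)) sh).
  by rewrite mulr_ge0//; exact: ip_ge0.
apply/cvgrPdist_le => e e0.
have c1 : Num.sqrt (I (fun x => a x - b n x) (fun x => a x - b n x)) * Num.sqrt (I h h)
    @[n --> \oo] --> (0 : R).
  rewrite -[X in _ --> X](mul0r (Num.sqrt (I h h))); apply: cvgM; last exact: cvg_cst.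
  rewrite -[X in _ --> X]sqrtr0; apply: (continuous_cvg _ _ c0); exact: sqrt_continuous.
near=> n; apply: le_trans (cs n) _.
by near: n; exact: (cvgr_le 0 c1).
Unshelve. all: by end_near. Qed.

Lemma wD_nil w : sqi w -> {ae mu, forall x, Omega x -> wD Omega [::] w x = w x}.
Proof. by move=> sw; apply: (wD_unique Omega oO); exact: weak_derivative_nil. Qed.

(** Green's formula without boundary terms. It is the definition of the weak Laplacian of z when w
    is a test function, and both sides pass to the limit along the test functions that approximate w
    in W^{2,2}. *)
Lemma ip_lap_W022 w z h : W022 Omega w -> weak_laplacian Omega z h -> sqi z ->
  I (lap Omega w) z = I w h.
Proof.
move=> [[/(L2P Omega oO) sw Sw] [phi [tphi cphi]]] [sh Hh] sz.
have sphi n := test_function_sqintegrable Omega oO _ (tphi n).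
have c2 : sobolev_sq 2 (w - phi n) @[n --> \oo] --> (0 : R).
  have c3 : Num.sqrt (sobolev_sq 2 (w - phi n)) @[n --> \oo] --> (0 : R).
    move: cphi; under eq_fun do rewrite Sobolev_normE; exact: fine_cvg.
  have -> : (fun n => sobolev_sq 2 (w - phi n)) = (fun n =>
      Num.sqrt (sobolev_sq 2 (w - phi n)) * Num.sqrt (sobolev_sq 2 (w - phi n))).
    by apply/funext => n; rewrite -expr2 sqr_sqrtr// sobolev_sq_ge0.
  by rewrite -[X in _ --> X](mulr0 (0 : R)); exact: cvgM.
have wd s n : (size s <= 2)%N -> {ae mu, forall x, Omega x ->
    wD Omega s (w - phi n) x = wD Omega s w x - pderiv (rev s) (phi n) x}.
  move=> s2; apply: (wD_unique Omega oO).
  have [g hg] := Sw s s2.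
  apply: (weak_derivativeB Omega oO) => //; first exact: wD_weak_derivative hg.
  exact: weak_derivative_test_function.
have sp s n := test_function_sqintegrable Omega oO _ (test_function_pderiv Omega s _ (tphi n)).
(* Each derivative of order at most 2 converges in L^2, its error being one of the terms of the
   Sobolev norm. *)
have cv s (y : 'rV[R]_N -> R) : (size s <= 2)%N -> sqi y ->
    I (pderiv (rev s) (phi n)) y @[n --> \oo] --> I (wD Omega s w) y.
  move=> s2 sy; apply: cvg_ip => //.
  apply: (@squeeze_cvgr _ _ _ _ (fun=> 0) (fun n => sobolev_sq 2 (w - phi n))) => //.
    apply: nearW => n; apply/andP; split; first exact: ip_ge0.
    rewrite (_ : ip _ _ _ _ = I (wD Omega s (w - phi n)) (wD Omega s (w - phi n))).
      exact: ip_wD_le.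
    have [m1 _] := swD s (w - phi n).
    have [m2 _] := sqintegrableB mO _ _ (swD s w) (sp (rev s) n).
    have h' : {ae mu, forall x, Omega x -> wD Omega s w x - pderiv (rev s) (phi n) x =
        wD Omega s (w - phi n) x}.
      by apply: ae_impl (wd s n s2) => x hx /hx.
    exact: (eq_ip_ae mO _ _ _ _ m2 m1 m2 m1 h' h').
  exact: cvg_cst.
have c1 := cv [::] h isT sh.
have E n : I (phi n) h = \sum_i I (pderiv (rev [:: i; i]) (phi n)) z.
  by rewrite ipC (Hh _ (tphi n)); apply: eq_bigr => i _; rewrite ipC.
have L : I (lap Omega w) z = \sum_i I (wD Omega [:: i; i] w) z.
  rewrite lapE ipC (ip_sumr mO _ _ _ _ sz (fun i => swD _ _)).
  by apply: eq_bigr => i _; rewrite ipC.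
have c3 : I (phi n) h @[n --> \oo] --> \sum_i I (wD Omega [:: i; i] w) z.
  under eq_fun do rewrite E.
  by apply: cvg_sumr => i; exact: cv.
rewrite L -(cvg_unique _ c1 c3)//=.
have [m1 _] := swD [::] w; have [m2 _] := sw; have [m3 _] := sh.
have e1 := wD_nil _ sw.
have e2 : {ae mu, forall x, Omega x -> h x = h x} by apply: aeW.
exact: (eq_ip_ae mO _ _ _ _ m1 m2 m3 m3 e1 e2).
Qed.

(** [lap] is built from choices, so lap (w - z) and lap w - lap z agree only almost everywhere, by
    uniqueness of the weak Laplacian. *)
Lemma ip_lapB w z : Sobolev Omega 2 w -> Sobolev Omega 2 z ->
  I (lap Omega (w - z)) (lap Omega (w - z)) =
  I (fun x => lap Omega w x - lap Omega z x) (fun x => lap Omega w x - lap Omega z x).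
Proof.
move=> Sw Sz; have [/(L2P Omega oO) sw _] := Sw; have [/(L2P Omega oO) sz _] := Sz.
have wdw i := Sobolev_weak_derivative Omega 2 w [:: i; i] Sw isT.
have wdz i := Sobolev_weak_derivative Omega 2 z [:: i; i] Sz isT.
have lw := lap_weak_laplacian Omega oO w (fun i => ex_intro _ _ (wdw i)).
have lz := lap_weak_laplacian Omega oO z (fun i => ex_intro _ _ (wdz i)).
have lwz := lap_weak_laplacian Omega oO (w - z) (fun i =>
   ex_intro _ _ (weak_derivativeB Omega oO [:: i; i] _ _ _ _ sw sz (wdw i) (wdz i))).
have e := weak_laplacian_unique Omega oO _ _ _ lwz (weak_laplacianB Omega oO _ _ _ _ sw sz lw lz).
have [m1 _] := slap (w - z); have [m2 _] := sqintegrableB mO _ _ (slap w) (slap z).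
exact: (eq_ip_ae mO _ _ _ _ m1 m2 m1 m2 e e).
Qed.

Lemma sqintegrable_bilap z : sqi (bilap Omega z).
Proof.
by apply: (sqintegrable_sum mO) => j; apply: (sqintegrable_sum mO) => i; exact: swD.
Qed.

Lemma bilap_le : exists2 C : R, 0 <= C & forall z,
  I (bilap Omega z) (bilap Omega z) <= C * sobolev_sq 4 z.
Proof.
have [C C0 hC] := ip_sum_le (mu := mu) mO _ (index_enum 'I_N).
exists (C * C) => [|z]; first exact: mulr_ge0.
rewrite -mulrA; have hC' := hC; apply: hC'.
- by move=> j; apply: (sqintegrable_sum mO) => i; exact: swD.
- move=> j; apply: hC; [by move=> i; exact: swD| |exact: sobolev_sq_ge0].
  by move=> i; exact: ip_wD_le.
- by rewrite mulr_ge0// sobolev_sq_ge0.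
Qed.

Lemma weak_derivative_sum m (c : 'I_m -> R) (g : 'I_m -> 'rV[R]_N -> R) s :
  (forall k, sqi (g k)) ->
  (forall k, weak_derivative Omega s (g k) (wD Omega s (g k))) ->
  weak_derivative Omega s (\sum_(k < m) c k *: g k)
    (fun x => \sum_(k < m) c k * wD Omega s (g k) x).
Proof.
move=> sg wg.
have s1 k : sqi (fun x => c k * wD Omega s (g k) x) by apply: (sqintegrableZ mO); exact: swD.
have s2 k : sqi (fun x => c k * g k x) by apply: (sqintegrableZ mO).
split; first by apply/(L2P Omega oO); exact: (sqintegrable_sum mO).
move=> phi tphi; have sphi := test_function_sqintegrable Omega oO _ tphi.
have sp := test_function_sqintegrable Omega oO _ (test_function_pderiv Omega s _ tphi).
transitivity (I (fun x => \sum_(k < m) c k * g k x) (pderiv s phi)).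
  by apply: eq_Rintegral => x _; rewrite fct_sumE.
transitivity ((-1) ^+ size s * I (fun x => \sum_(k < m) c k * wD Omega s (g k) x) phi); last by [].
rewrite ipC (ip_sumr mO _ _ _ _ sp s2) [in RHS]ipC (ip_sumr mO _ _ _ _ sphi s1) mulr_sumr.
apply: eq_bigr => k _; rewrite (ipZr mO)// (ipZr mO)// mulrCA; congr (_ * _).
have [_ /(_ _ tphi) E] := wg k.
by rewrite [LHS]ipC [X in _ * X]ipC; exact: E.
Qed.

(** This is the linearity of [bilap] on the differences between a simple function of time and u, the
    form that [L2_time_map] requires. *)
Lemma ip_bilap_sumB m (c : 'I_m -> R) (g : 'I_m -> 'rV[R]_N -> R) z :
  (forall k, Sobolev Omega 4 (g k)) -> Sobolev Omega 4 z ->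
  I (fun x => \sum_(k < m) c k * bilap Omega (g k) x - bilap Omega z x)
    (fun x => \sum_(k < m) c k * bilap Omega (g k) x - bilap Omega z x) =
  I (bilap Omega (\sum_(k < m) c k *: g k - z)) (bilap Omega (\sum_(k < m) c k *: g k - z)).
Proof.
move=> Sg Sz; have [/(L2P Omega oO) sz _] := Sz.
have sg k : sqi (g k) by have [/(L2P Omega oO)] := Sg k.
have sS : sqi (\sum_(k < m) c k *: g k).
  rewrite (_ : \sum_(k < m) c k *: g k = fun x => \sum_(k < m) c k * g k x).
    by apply: (sqintegrable_sum mO) => k; exact: (sqintegrableZ mO).
  by apply/funext => x; rewrite fct_sumE.
have wd s : (size s <= 4)%N -> {ae mu, forall x, Omega x ->
    wD Omega s (\sum_(k < m) c k *: g k - z) x =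
    \sum_(k < m) c k * wD Omega s (g k) x - wD Omega s z x}.
  move=> s4; apply: (wD_unique Omega oO).
  apply: (weak_derivativeB Omega oO) => //.
    by apply: weak_derivative_sum => // k; exact: (Sobolev_weak_derivative Omega 4).
  exact: (Sobolev_weak_derivative Omega 4).
have all : {ae mu, forall x, Omega x -> forall ij : 'I_N * 'I_N,
    wD Omega [:: ij.2; ij.2; ij.1; ij.1] (\sum_(k < m) c k *: g k - z) x =
    \sum_(k < m) c k * wD Omega [:: ij.2; ij.2; ij.1; ij.1] (g k) x
      - wD Omega [:: ij.2; ij.2; ij.1; ij.1] z x}.
  (* The pairs of indices are numbered by [pickle], so that [ae_foralln] gives one null set for all
     of them. *)
  have h n : {ae mu, forall x, Omega x -> forall ij : 'I_N * 'I_N, pickle ij = n ->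
      wD Omega [:: ij.2; ij.2; ij.1; ij.1] (\sum_(k < m) c k *: g k - z) x =
      \sum_(k < m) c k * wD Omega [:: ij.2; ij.2; ij.1; ij.1] (g k) x
        - wD Omega [:: ij.2; ij.2; ij.1; ij.1] z x}.
    have [[ij ijn]|no] := pselect (exists ij : 'I_N * 'I_N, pickle ij = n).
      apply: ae_impl (wd [:: ij.2; ij.2; ij.1; ij.1] isT) => x hx Ox ij' e.
      by rewrite (pcan_inj pickleK (etrans e (esym ijn))); exact: hx.
    by apply: aeW => x _ ij e; exfalso; apply: no; exists ij.
  by apply: ae_impl (ae_foralln h) => x hx Ox ij; exact: (hx _ Ox ij erefl).
have s1 : sqi (fun x => \sum_(k < m) c k * bilap Omega (g k) x - bilap Omega z x).
  apply: (sqintegrableB mO); last exact: sqintegrable_bilap.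
  by apply: (sqintegrable_sum mO) => k; apply: (sqintegrableZ mO); exact: sqintegrable_bilap.
have s2 := sqintegrable_bilap (\sum_(k < m) c k *: g k - z).
have e : {ae mu, forall x, Omega x ->
    \sum_(k < m) c k * bilap Omega (g k) x - bilap Omega z x =
    bilap Omega (\sum_(k < m) c k *: g k - z) x}.
  apply: ae_impl all => x hx Ox; rewrite /bilap.
  under [RHS]eq_bigr do under eq_bigr do rewrite (hx Ox (_, _)).
  rewrite [RHS](eq_bigr (fun j => \sum_i \sum_(k < m) c k * wD Omega [:: i; i; j; j] (g k) x
      - \sum_i wD Omega [:: i; i; j; j] z x)); last by move=> j _; rewrite sumrB.
  rewrite sumrB; congr (_ - _).
  under eq_bigr do rewrite mulr_sumr.
  rewrite exchange_big/=; apply: eq_bigr => j _.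
  under eq_bigr do rewrite mulr_sumr.
  by rewrite exchange_big.
have [m1 _] := s1; have [m2 _] := s2.
exact: (eq_ip_ae mO _ _ _ _ m1 m2 m1 m2 e e).
Qed.

End Sobolev_spaces.

(** * Functions of time *)

Section Integral_without_measurability.
Context {d} {T : measurableType d} {R : realType} (mu : {measure set T -> \bar R}).
Local Open Scope ereal_scope.
Import HBNNSimple.

(* The integrals below are suprema over the simple functions below the
   integrands, which need not be measurable. *)
Lemma ge0_ae_le_integral (D : set T) (f g : T -> \bar R) : measurable D ->
  (forall x, D x -> 0 <= f x) -> (forall x, D x -> 0 <= g x) ->
  {ae mu, forall x, D x -> f x <= g x} ->
  \int[mu]_(x in D) f x <= \int[mu]_(x in D) g x.
Proof.
move=> mD f0 g0 [Z [mZ Z0 sZ]].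
rewrite !ge0_integralE//; apply: ge_ereal_sup => _ [h hf <-].
(* Deleting the null set Z keeps the integral of h and puts it below g everywhere, so that it
   competes in the supremum for g. *)
pose h' := mul_nnsfun h (indic_nnsfun R (measurableC mZ)).
have -> : sintegral mu h = sintegral mu h'.
  rewrite -!integralT_nnsfun; apply: ge0_ae_eq_integral => //.
  - by apply/measurable_EFinP.
  - by apply/measurable_EFinP.
  - by move=> x _; rewrite lee_fin.
  - by move=> x _; rewrite lee_fin.
  exists Z; split => // x /= /not_implyP[_ hx]; apply: contrapT => nZ; apply: hx.
  suff : (h x)%:E = (h x * \1_(~` Z) x)%R%:E by [].
  by rewrite indicE mem_set// mulr1.
apply: ereal_sup_ubound; exists h' => // x.
change ((h x * \1_(~` Z) x)%R%:E <= (g \_ D) x); rewrite indicE.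
have [xZ|nZ] := pselect (Z x).
  rewrite memNset; last by move=> /(_ xZ).
  by rewrite mulr0 /patch; case: ifPn => // /set_mem/g0.
rewrite mem_set// mulr1; apply: le_trans (hf x) _.
rewrite /patch; case: ifPn => // /set_mem Dx.
have : [set x | D x -> f x <= g x] x.
  by apply: contrapT => h1; apply: nZ; apply: sZ.
exact.
Qed.

Lemma ae_eq_integral_nonmeasurable (D : set T) (f g : T -> \bar R) : measurable D ->
  {ae mu, forall x, D x -> f x = g x} ->
  \int[mu]_(x in D) f x = \int[mu]_(x in D) g x.
Proof.
move=> mD fg; rewrite integralE [RHS]integralE.
have le u v : {ae mu, forall x, D x -> u x = v x} ->
    \int[mu]_(x in D) u^\+ x <= \int[mu]_(x in D) v^\+ x /\
    \int[mu]_(x in D) u^\- x <= \int[mu]_(x in D) v^\- x.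
  move=> uv; split; apply: ge0_ae_le_integral => //; apply: ae_impl uv => x h Dx.
    by rewrite !funeposE h.
  by rewrite !funenegE h.
have [p1 n1] := le _ _ fg.
have gf : {ae mu, forall x, D x -> g x = f x} by apply: ae_impl fg => x h Dx; rewrite h.
have [p2 n2] := le _ _ gf.
by congr (_ - _); apply/eqP; rewrite eq_le ?p1 ?p2 ?n1 ?n2.
Qed.

(** The limit superior of the e_n is measurable everywhere and equals e wherever the sequence
    converges to e. *)
Lemma ae_cvg_measurable_repr (D : set T) (e_ : nat -> T -> R) (e : T -> R) :
  (forall n, measurable_fun setT (e_ n)) ->
  {ae mu, forall x, D x -> e_ n x @[n --> \oo] --> e x} ->
  exists2 g : T -> R, measurable_fun setT g & {ae mu, forall x, D x -> e x = g x}.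
Proof.
move=> me ce; exists (fun x => fine (limn_esup (fun n => (e_ n x)%:E))).
  apply: (measurableT_comp (fine_measurable measurableT)) => /=.
  apply: (@measurable_fun_limn_esup _ _ _ setT (fun n x => (e_ n x)%:E)) => n.
  exact/measurable_EFinP.
apply: ae_impl ce => x cx Dx.
have : (e_ n x)%:E @[n --> \oo] --> (e x)%:E by apply: cvg_EFin; [exact: nearW|exact: cx].
by move=> /cvg_limn_einf_sup[_ ->].
Qed.

End Integral_without_measurability.

Section Strongly_measurable_functions.
Context {R : realType} {N : nat}.
Variable Omega : set 'rV[R]_N.
Hypothesis oO : open Omega.
Notation mu := (leb R N).
Notation sqi := (sqintegrable mu (Omega : set (space R N))).
Notation I := (ip mu (Omega : set (space R N))).
Notation leb1 := (@lebesgue_measure R).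
Implicit Types (w g h psi : 'rV[R]_N -> R) (W : R -> 'rV[R]_N -> R).

Let mO : measurable (Omega : set (space R N)) := open_space_measurable _ oO.

Variable T : R.

(** Strong measurability in L^2(Omega) with the simple functions displayed as sums, so that inner
    products with them are finite sums of indicators of time with constant coefficients. *)
Definition strongly_approximable W : Prop :=
  exists m : nat -> nat, exists A : forall n, 'I_(m n) -> set R,
  exists g : forall n, 'I_(m n) -> 'rV[R]_N -> R,
    [/\ forall n k, measurable (A n k), forall n k, sqi (g n k)
      & {ae leb1, forall t, t \in `]0, T[ -> sqi (W t) /\
          I (fun x => \sum_(k < m n) \1_(A n k) t * g n k x - W t x)
            (fun x => \sum_(k < m n) \1_(A n k) t * g n k x - W t x)
            @[n --> \oo] --> (0 : R)}].

Lemma ipB_sqr w (z : 'rV[R]_N -> R) : sqi w -> sqi z ->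
  I (fun x => w x - z x) (fun x => w x - z x) = I w w - 2 * I w z + I z z.
Proof.
move=> sw sz; have := ip_sqrB mO 1 w z sw sz.
under eq_fun do rewrite mul1r.
by rewrite expr1n mulr1 mul1r.
Qed.

Lemma strongly_approximable_ip W psi : strongly_approximable W -> sqi psi ->
  exists2 e : R -> R, measurable_fun setT e &
    {ae leb1, forall t, t \in `]0, T[ -> I (W t) psi = e t}.
Proof.
move=> [m [A [g [mA sg cA]]]] spsi.
apply: (@ae_cvg_measurable_repr _ _ _ leb1 `]0, T[
   (fun n t => I (fun x => \sum_(k < m n) \1_(A n k) t * g n k x) psi)).
  move=> n.
  rewrite (_ : (fun t => _) = fun t => \sum_(k < m n) \1_(A n k) t * I (g n k) psi).
    apply: measurable_sum => k; apply: measurable_funM; last exact: measurable_cst.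
    by apply: measurable_indic; exact: mA.
  apply/funext => t; rewrite ipC.
  rewrite (ip_sumr mO _ _ _ _ spsi (fun k => sqintegrableZ mO (\1_(A n k) t) _ (sg n k))).
  by apply: eq_bigr => k _; rewrite (ipZr mO _ _ _ spsi (sg n k)) ipC.
apply: ae_impl cA => t ct tT; have [sW cW] := ct tT.
have ss n : sqi (fun x => \sum_(k < m n) \1_(A n k) t * g n k x).
  by apply: (sqintegrable_sum mO) => k; exact: (sqintegrableZ mO).
apply: (cvg_ip Omega oO) => //.
rewrite (_ : (fun n => _) = fun n => I (fun x => \sum_(k < m n) \1_(A n k) t * g n k x - W t x)
            (fun x => \sum_(k < m n) \1_(A n k) t * g n k x - W t x))//.
by apply/funext => n; rewrite ipB_sqr// ipB_sqr// ipC; ring.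
Qed.

Lemma strongly_approximable_ip_self W : strongly_approximable W ->
  exists2 e : R -> R, measurable_fun setT e &
    {ae leb1, forall t, t \in `]0, T[ -> I (W t) (W t) = e t}.
Proof.
move=> [m [A [g [mA sg cA]]]].
pose s n t x := \sum_(k < m n) \1_(A n k) t * g n k x.
have ss n t : sqi (s n t).
  by apply: (sqintegrable_sum mO) => k; exact: (sqintegrableZ mO).
apply: (@ae_cvg_measurable_repr _ _ _ leb1 `]0, T[ (fun n t => I (s n t) (s n t))).
  move=> n.
  rewrite (_ : (fun t => _) = fun t => \sum_(k < m n) \1_(A n k) t *
      \sum_(l < m n) \1_(A n l) t * I (g n k) (g n l)).
    apply: measurable_sum => k; apply: measurable_funM; first by apply: measurable_indic; exact: mA.
    apply: measurable_sum => l; apply: measurable_funM; last exact: measurable_cst.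
    by apply: measurable_indic; exact: mA.
  apply/funext => t; rewrite {2}/s.
  rewrite (ip_sumr mO _ _ _ _ (ss n t) (fun k => sqintegrableZ mO (\1_(A n k) t) _ (sg n k))).
  apply: eq_bigr => k _; rewrite (ipZr mO _ _ _ (ss n t) (sg n k)); congr (_ * _).
  rewrite ipC /s.
  rewrite (ip_sumr mO _ _ _ _ (sg n k) (fun l => sqintegrableZ mO (\1_(A n l) t) _ (sg n l))).
  by apply: eq_bigr => l _; rewrite (ipZr mO _ _ _ (sg n k) (sg n l)).
apply: ae_impl cA => t ct tT; have [sW cW] := ct tT.
have c1 : I (s n t) (W t) @[n --> \oo] --> I (W t) (W t).
  apply: (cvg_ip Omega oO) => //.
  rewrite (_ : (fun n => _) = fun n => I (fun x => s n t x - W t x) (fun x => s n t x - W t x))//.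
  by apply/funext => n; rewrite ipB_sqr// ipB_sqr// ipC; ring.
rewrite (_ : (fun n => _) = fun n => (I (fun x => s n t x - W t x) (fun x => s n t x - W t x)
   + 2 * I (s n t) (W t)) - I (W t) (W t)).
  rewrite [X in _ --> X](_ : _ = 0 + 2 * I (W t) (W t) - I (W t) (W t)); last by ring.
  by apply: cvgB; [apply: cvgD => //; apply: cvgM => //|]; exact: cvg_cst.
by apply/funext => n; rewrite ipB_sqr//; ring.
Qed.

(** Essential separability of the range of W, with a dense sequence taken among the values of W at
    times of G. The simple approximants have countably many values; for each of them and each
    precision, tau selects a time at which W is that close to it. The default 0 occurs only for
    codes that no time satisfies. *)
Lemma strongly_approximable_separable W (G : set R) : strongly_approximable W ->
  {ae leb1, forall t, t \in `]0, T[ -> G t} -> 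
  exists tau : nat -> R, {ae leb1, forall t, t \in `]0, T[ ->
    forall e, 0 < e -> exists2 j, G (tau j) /\ sqi (W (tau j)) &
      I (fun x => W t x - W (tau j) x) (fun x => W t x - W (tau j) x) <= e}.
Proof.
move=> [m [A [g [mA sg cA]]]] aeG.
(* A value of the n-th simple function is coded by the bits that tell which of the sets A n k
   contain t. *)
pose psi (z : nat * seq bool) (x : 'rV[R]_N) : R :=
  \sum_(k < m z.1) (nth false z.2 k)%:R * g z.1 k x.
have spsi (z : nat * seq bool) : sqi (psi z).
  by apply: (sqintegrable_sum mO) => k; exact: (sqintegrableZ mO).
pose P (z : nat * seq bool * nat) t := [/\ G t, sqi (W t) &
  I (fun x => psi z.1 x - W t x) (fun x => psi z.1 x - W t x) <= z.2.+1%:R^-1].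
pose tau j := if unpickle j is Some z then xget 0 [set t | P z t] else 0.
exists tau; apply: ae_impl2 cA aeG => t ct Gt tT e e0.
have [sW cW] := ct tT; have {}Gt := Gt tT.
(* Two values within squared distance 1/(k + 1) of a common point are within squared distance 4/(k +
   1) of each other, by the parallelogram law. *)
pose k := Num.truncn (4 / e).
have ke : 4 * k.+1%:R^-1 < e.
  by rewrite ltr_pdivrMr// -ltr_pdivrMl// mulrC; exact: Num.Theory.truncnS_gt.
have k0 : 0 < k.+1%:R^-1 :> R by rewrite invr_gt0 ltr0n.
have [n _ hn] := cvgr_le 0 cW _ k0.
have {}hn := hn n (leqnn n).
pose bs := [seq (t \in A n k) | k <- enum 'I_(m n)].
have psiE : psi (n, bs) = fun x => \sum_(k < m n) \1_(A n k) t * g n k x.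
  apply/funext => x; apply: eq_bigr => i _; congr (_ * _).
  rewrite indicE /bs (nth_map i) ?size_enum_ord//=.
  by rewrite nth_ord_enum.
have Pt : P ((n, bs), k) t.
  split=> //; rewrite (_ : ip _ _ _ _ = I (fun x => \sum_(k < m n) \1_(A n k) t * g n k x - W t x)
            (fun x => \sum_(k < m n) \1_(A n k) t * g n k x - W t x))//.
  by apply: eq_Rintegral => x _; rewrite psiE.
exists (pickle ((n, bs), k)); rewrite /tau pickleK.
  by have [] := xgetPex 0 (ex_intro _ t Pt).
have [_ sW' h2] := xgetPex 0 (ex_intro _ t Pt).
have [_ _ h1] := Pt.
set t' := xget _ _ in sW' h2 *.
have s1 := sqintegrableB mO _ _ (spsi (n, bs)) sW.
have s2 := sqintegrableB mO _ _ (spsi (n, bs)) sW'.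
rewrite (_ : ip _ _ _ _ = I (fun x => (psi (n, bs) x - W t' x) - (psi (n, bs) x - W t x))
   (fun x => (psi (n, bs) x - W t' x) - (psi (n, bs) x - W t x))); last first.
  by apply: eq_Rintegral => x _; congr (_ * _); ring.
have := ip_ge0 (mu := mu) (D := Omega) (fun x => (psi (n, bs) x - W t' x) + (psi (n, bs) x - W t x)).
rewrite (ip_sqrD mO _ _ s2 s1) (ipB_sqr _ _ s2 s1).
move: h1 h2 => /= h1 h2; move: h1 h2 ke k0.
by set a := ip _ _ _ _; set b := ip _ _ _ _; set c := ip _ _ _ _; set r := k.+1%:R^-1; lra.
Qed.

End Strongly_measurable_functions.

Section Bochner_square_integrable.
Context {R : realType} {N : nat}.
Variable Omega : set 'rV[R]_N.
Hypothesis oO : open Omega.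
Notation mu := (leb R N).
Notation sqi := (sqintegrable mu (Omega : set (space R N))).
Notation I := (ip mu (Omega : set (space R N))).
Notation leb1 := (@lebesgue_measure R).
Implicit Types (w z h psi : 'rV[R]_N -> R).

Let mO : measurable (Omega : set (space R N)) := open_space_measurable _ oO.

Variable T : R.

(** The squared norm of W t is a Borel function of t only up to a null set; alpha is such a Borel
    representative, carried along for the integrals in time. *)
Definition bochner_L2 (W : R -> 'rV[R]_N -> R) : Prop :=
  strongly_approximable Omega T W /\ exists alpha : R -> R,
    [/\ measurable_fun setT alpha, forall t, 0 <= alpha t,
        leb1.-integrable setT (EFin \o alpha)
      & {ae leb1, forall t, t \in `]0, T[ -> I (W t) (W t) = alpha t}].

(** A bounded map L from X to L^2(Omega) preserves Bochner square integrability; nu is the square of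
    the norm of X. Linearity and boundedness are asked together, for linear combinations minus z,
    because [bilap] is linear only almost everywhere. The uses are the identity of L^2 and [bilap]
    on W^{4,2}. *)
Lemma L2_time_map (X : set ('rV[R]_N -> R)) (nrm : ('rV[R]_N -> R) -> \bar R)
    (L : ('rV[R]_N -> R) -> 'rV[R]_N -> R) (nu : ('rV[R]_N -> R) -> R) (C : R)
    (u : R -> 'rV[R]_N -> R) : 0 <= C -> (forall w, X w -> sqi (L w)) ->
  (forall w, 0 <= nu w) ->
  (forall w, X w -> nrm w = (Num.sqrt (nu w))%:E /\ I (L w) (L w) <= C * nu w) ->
  (forall m (c : 'I_m -> R) (g : 'I_m -> 'rV[R]_N -> R) z, (forall k, X (g k)) -> X z ->
    nrm (\sum_(k < m) c k *: g k - z) = (Num.sqrt (nu (\sum_(k < m) c k *: g k - z)))%:E /\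
    I (fun x => \sum_(k < m) c k * L (g k) x - L z x)
      (fun x => \sum_(k < m) c k * L (g k) x - L z x) <=
    C * nu (\sum_(k < m) c k *: g k - z)) ->
  L2_time T X nrm u -> bochner_L2 (fun t => L (u t)).
Proof.
move=> C0 XL nu0 nrmE nrmBE [Xu [s [simple_s cs]] unorm].
pose V := {m : nat & (('I_m -> set R) * ('I_m -> 'rV[R]_N -> R))%type}.
pose P n (p : V) := [/\ forall k, measurable ((projT2 p).1 k), forall k, X ((projT2 p).2 k) &
      forall t, s n t = \sum_(k < projT1 p) \1_((projT2 p).1 k) t *: (projT2 p).2 k].
have /choice[F FP] : forall n, exists p, P n p.
  by move=> n; have [m [A [g [h1 h2 h3]]]] := simple_s n; exists (existT _ m (A, g)).
have sa : strongly_approximable Omega T (fun t => L (u t)).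
  exists (fun n => projT1 (F n)), (fun n => (projT2 (F n)).1), (fun n k => L ((projT2 (F n)).2 k)).
  split; [by move=> n k; have [] := FP n|by move=> n k; apply: XL; have [] := FP n|].
  apply: ae_impl2 Xu cs => t Xt ct tT; have {}Xt := Xt tT; have {}ct := ct tT.
  split; first exact: XL.
  have gX n k : X ((projT2 (F n)).2 k) by have [] := FP n.
  have E n : s n t - u t = \sum_(k < projT1 (F n)) \1_((projT2 (F n)).1 k) t *: (projT2 (F n)).2 k - u t.
    by have [_ _ ->] := FP n.
  have cnu : nu (s n t - u t) @[n --> \oo] --> (0 : R).
    have c3 : Num.sqrt (nu (s n t - u t)) @[n --> \oo] --> (0 : R).
      have ct' : (Num.sqrt (nu (s n t - u t)))%:E @[n --> \oo] --> 0%E.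
        rewrite (_ : (fun n => _) = fun n => nrm (s n t - u t))//.
        apply/funext => n; rewrite E.
        by have [-> _] := nrmBE _ (fun k => \1_((projT2 (F n)).1 k) t) _ _ (gX n) Xt.
      exact: (fine_cvg ct').
    have -> : (fun n => nu (s n t - u t)) = (fun n =>
        Num.sqrt (nu (s n t - u t)) * Num.sqrt (nu (s n t - u t))).
      by apply/funext => n; rewrite -expr2 sqr_sqrtr.
    by rewrite -[X in _ --> X](mulr0 (0 : R)); exact: cvgM.
  have cCnu : C * nu (s n t - u t) @[n --> \oo] --> (0 : R).
    by rewrite -[X in _ --> X](mulr0 C); apply: cvgM => //; exact: cvg_cst.
  apply: (@squeeze_cvgr _ _ _ _ (fun=> 0) (fun n => C * nu (s n t - u t))) => //; last exact: cvg_cst.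
  apply: nearW => n; apply/andP; split; first exact: ip_ge0.
  rewrite E.
  by have [] := nrmBE _ (fun k => \1_((projT2 (F n)).1 k) t) _ _ (gX n) Xt.
split=> //.
have [e me ee] := strongly_approximable_ip_self _ oO _ _ sa.
(* The measurable e is arbitrary on a null set and outside ]0, T[; it is truncated to be nonnegative
   and integrable on the whole line. *)
pose alpha t := Num.max 0 (e t) * \1_(`]0, T[) t.
have malpha : measurable_fun setT alpha.
  apply: measurable_funM; last exact: measurable_indic.
  by apply: measurable_maxr => //; exact: measurable_cst.
have alpha0 t : 0 <= alpha t by rewrite mulr_ge0// le_max lexx.
have alphaE : {ae leb1, forall t, t \in `]0, T[ -> I (L (u t)) (L (u t)) = alpha t}.
  apply: ae_impl ee => t et tT; rewrite /alpha indicE mem_set// mulr1 -et//.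
  by apply/esym/max_idPr; exact: ip_ge0.
exists alpha; split=> //.
apply/integrableP; split; first exact/measurable_EFinP.
under eq_integral do rewrite /= ger0_norm//.
have mJ : measurable (`]0, T[%classic : set R) by exact: measurable_itv.
have -> : (\int[leb1]_t (alpha t)%:E = \int[leb1]_(t in `]0%R, T[) (alpha t)%:E)%E.
  rewrite [RHS]integral_mkcond; apply: eq_integral => t _.
  rewrite /patch; case: ifPn => // tJ; rewrite /alpha indicE.
  by rewrite (negbTE tJ) mulr0.
(* Division by C + 1, as C may be 0. *)
have C1 : 0 < C + 1 by rewrite ltr_wpDl.
have -> : (\int[leb1]_(t in `]0%R, T[) (alpha t)%:E =
    (C + 1)%:E * \int[leb1]_(t in `]0%R, T[) ((C + 1)^-1 * alpha t)%:E)%E.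
  under [in RHS]eq_integral do rewrite EFinM.
  rewrite ge0_integralZl//.
  - by rewrite muleA -EFinM divff ?gt_eqF// mul1e.
  - by apply/measurable_EFinP; apply: (measurable_funS measurableT).
  - by move=> t _; rewrite lee_fin.
  - by rewrite lee_fin invr_ge0 ltW.
rewrite lte_mul_pinfty// ?lee_fin ?(ltW C1)//.
apply: le_lt_trans unorm; apply: ge0_ae_le_integral => //.
- by move=> t _; rewrite lee_fin mulr_ge0// invr_ge0 ltW.
- by move=> t _; rewrite sqre_ge0.
apply: ae_impl2 Xu alphaE => t Xt at_ tT; have [E1 E2] := nrmE _ (Xt tT).
rewrite E1 -EFin_expe sqr_sqrtr// lee_fin ler_pdivrMl// -at_//.
by rewrite (le_trans E2)// ler_wpM2r// lerDl.
Qed.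

End Bochner_square_integrable.

(** * From bounds on left difference quotients to integral inequalities *)

Section Real_analysis.
Context {R : realType}.
Notation leb1 := (@lebesgue_measure R).
Implicit Types (F f y : R -> R) (a b t : R).

Lemma is_derive_continuous F t (l : R) : is_derive t (1 : R) F l -> {for t, continuous F}.
Proof. by move=> [d _]; apply: differentiable_continuous; apply/derivable1_diffP. Qed.

Lemma Rintegral_derivative F f a b : a < b ->
  (forall t, t \in `[a, b] -> is_derive t (1 : R) F (f t)) ->
  {within `[a, b], continuous f} -> \int[leb1]_(t in `[a, b]) f t = F b - F a.
Proof.
move=> ab dF cf; rewrite /Rintegral (continuous_FTC2 ab cf (F := F))//.
- have mem t : t \in `]a, b[ -> t \in `[a, b].
    by rewrite !in_itv/= => /andP[h1 h2]; rewrite !ltW.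
  split.
  + by move=> t /mem/dF[].
  + apply: cvg_at_right_filter; apply: (is_derive_continuous _ _ (f a)); apply: dF.
    by rewrite in_itv/= lexx ltW.
  + apply: cvg_at_left_filter; apply: (is_derive_continuous _ _ (f b)); apply: dF.
    by rewrite in_itv/= lexx ltW.
- move=> t; rewrite in_itv/= => /andP[h1 h2]; rewrite derive1E.
  by have [] := dF t; rewrite // in_itv/= !ltW.
Qed.

Lemma cvg_left_quotient F t (l : R) : is_derive t (1 : R) F l ->
  n.+1%:R * (F t - F (t - n.+1%:R^-1)) @[n --> \oo] --> l.
Proof.
move=> [dF dl].
have cl : (fun h => h^-1 *: ((F \o shift t) (h *: (1 : R)) - F t)) @ (0 : R)^' --> l.
  have := dF; rewrite /derivable => /cvg_ex[l' cl'].
  have -> // : l = l' by rewrite -dl /derive; exact: cvg_lim cl'.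
pose e n : R := - n.+1%:R^-1.
have e0 n : e n != 0 by rewrite oppr_eq0 invr_neq0// pnatr_eq0.
have ce : e n @[n --> \oo] --> (0 : R)^'.
  have ceh : e n @[n --> \oo] --> (0 : R).
    by rewrite -[X in _ --> X]oppr0; apply: cvgN; exact: cvg_harmonic.
  move=> A hA; have hn : \forall n \near \oo, (e n != 0 -> A (e n)) := ceh _ hA.
  suff : \forall n \near \oo, A (e n) by [].
  by apply: filterS hn => n; apply; exact: e0.
have := cvg_comp _ _ ce cl; apply: cvg_trans; apply: near_eq_cvg.
apply: nearW => n /=; rewrite /e [_ *: (1 : R)]mulr1 invrN invrK [_ *: _]mulNr.
by rewrite -mulrN opprB addrC [- _ + t]addrC addrC.
Qed.

Section Average.
Variables (y : R -> R) (l r a b : R).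
Hypotheses (la : l < a) (ab : a < b) (br : b < r).
Hypothesis cy : forall t, t \in `]l, r[ -> {for t, continuous y}.

Lemma continuous_within_sub c e : l < c -> e < r -> {within `[c, e], continuous y}.
Proof.
move=> lc er; apply: continuous_in_subspaceT => t; rewrite inE/= in_itv/= => /andP[h1 h2].
by apply: cy; rewrite in_itv/= (lt_le_trans lc h1) (le_lt_trans h2 er).
Qed.

Lemma continuous_difference h t : 0 < h -> h < a - l -> a <= t -> t <= b ->
  {for t, continuous (fun t => y t - y (t - h))}.
Proof.
move: (la) (ab) (br) => la' ab' br' h0 hal at_ tb.
have t1 : t \in `]l, r[ by rewrite in_itv/=; apply/andP; split; lra.
have t2 : t - h \in `]l, r[ by rewrite in_itv/=; apply/andP; split; lra.
apply: continuousB; first exact: cy.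
apply: (@continuous_comp _ _ _ (fun t : R => t - h) y); last exact: cy.
by apply: continuousB; [exact: cvg_id|exact: cst_continuous].
Qed.

(** The primitive is taken on a larger interval so that it is differentiable at a and b themselves,
    and at t - h for small h. *)
Lemma exists_antiderivative : exists F c e, [/\ l < c, c < a, b < e, e < r &
  forall t, t \in `]c, e[ -> is_derive t (1 : R) F (y t)].
Proof.
move: (la) (ab) (br) => la' ab' br'.
pose c := (l + a) / 2; pose e := (b + r) / 2.
have lc : l < c by rewrite /c; lra.
have er : e < r by rewrite /e; lra.
exists (fun t => \int[leb1]_(u in `[c, t]) y u), c, e; split=> //.
- by rewrite /c; lra.
- by rewrite /e; lra.
move=> t; rewrite in_itv/= => /andP[ct te].
have iy : leb1.-integrable `[c, e] (EFin \o y).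
  apply: continuous_compact_integrable; first exact: segment_compact.
  exact: continuous_within_sub.
have tlr : t \in `]l, r[ by rewrite in_itv/= (lt_trans lc ct) (lt_trans te er).
have [d1 d2] := continuous_FTC1_closed te iy ct (cy t tlr).
by apply: (DeriveDef d1); rewrite -derive1E; exact: d2.
Qed.

(** With F' = y, the integral of y t - y (t - h) over [a, b] is (F b - F (b - h)) - (F a - F (a -
    h)). Divided by h, it tends to y b - y a although y is merely continuous. *)
Lemma cvg_average_difference :
  n.+1%:R * \int[leb1]_(t in `[a, b]) (y t - y (t - n.+1%:R^-1)) @[n --> \oo] --> y b - y a.
Proof.
move: (la) (ab) (br) => la' ab' br'.
have [F [c [e [lc ca be er dF]]]] := exists_antiderivative.
have ac : a \in `]c, e[ by rewrite in_itv/=; apply/andP; split; lra.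
have bc : b \in `]c, e[ by rewrite in_itv/=; apply/andP; split; lra.
have cv : n.+1%:R * (F b - F (b - n.+1%:R^-1)) - n.+1%:R * (F a - F (a - n.+1%:R^-1))
    @[n --> \oo] --> y b - y a.
  by apply: cvgB; apply: cvg_left_quotient; exact: dF.
apply: cvg_trans cv; apply: near_eq_cvg; near=> n.
have hn : n.+1%:R^-1 < a - c :> R.
  near: n; apply: (cvgr_lt 0 (@cvg_harmonic R)); lra.
have h0 : 0 < n.+1%:R^-1 :> R by rewrite invr_gt0 ltr0n.
rewrite -[LHS]mulrBr; congr (_ * _).
move: (n.+1%:R^-1) hn h0 => h hn h0.
pose Fh t := F t - F (t - h); pose yh t := y t - y (t - h).
have dFh t : t \in `[a, b] -> is_derive t (1 : R) Fh (yh t).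
  rewrite in_itv/= => /andP[at_ tb].
  apply: is_deriveB; first by apply: dF; rewrite in_itv/=; apply/andP; split; lra.
  have d1 : is_derive (t - h) (1 : R) F (y (t - h)).
    by apply: dF; rewrite in_itv/=; apply/andP; split; lra.
  have d2 : is_derive t (1 : R) (fun t : R => t - h) 1.
    by have := is_deriveB (is_derive_id t (1 : R)) (is_derive_cst h t (1 : R)); rewrite subr0.
  by have := @is_derive1_comp R F (fun t : R => t - h) t _ _ d1 d2; rewrite mulr1.
have cyh : {within `[a, b], continuous yh}.
  apply: continuous_in_subspaceT => t; rewrite inE/= in_itv/= => /andP[at_ tb].
  by apply: continuous_difference => //; lra.
rewrite [RHS](Rintegral_derivative Fh yh a b ab dFh cyh).
Unshelve. all: by end_near. Qed.

(* Dominated convergence applies to the maximum of the difference quotient and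
   beta, which tends to beta almost everywhere. *)
Lemma integral_upper_derivative (alpha beta : R -> R) :
  measurable_fun `[a, b] alpha -> measurable_fun `[a, b] beta ->
  leb1.-integrable `[a, b] (EFin \o alpha) -> leb1.-integrable `[a, b] (EFin \o beta) ->
  {ae leb1, forall t, t \in `[a, b] -> forall s, l < s < t -> y t - y s <= (t - s) * alpha t} ->
  {ae leb1, forall t, t \in `[a, b] -> forall e : R, 0 < e ->
    \forall n \near \oo, n.+1%:R * (y t - y (t - n.+1%:R^-1)) <= beta t + e} ->
  y b - y a <= \int[leb1]_(t in `[a, b]) beta t.
Proof.
move: (la) (ab) (br) => la' ab' br' malpha mbeta ialpha ibeta Hs Hd.
have mab : measurable (`[a, b]%classic : set R) by exact: measurable_itv.
have [n0 hn0] : exists n0 : nat, forall n, (n0 <= n)%N -> n.+1%:R^-1 < a - l.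
  have : 0 < a - l by lra.
  by move/(cvgr_lt 0 (@cvg_harmonic R)) => [n0 _ h]; exists n0.
(* The shift by n0 keeps t - 1/(k n) inside ]l, r[ for every t in [a, b] and every n. *)
pose k n := (n + n0)%N.+1.
have hk n : 0 < ((k n)%:R^-1 : R) < a - l by rewrite invr_gt0 ltr0n hn0// leq_addl.
pose q n t := (k n)%:R * (y t - y (t - (k n)%:R^-1)).
pose m n t := Num.max (q n t) (beta t).
have cq n : {within `[a, b], continuous (q n)}.
  apply: continuous_in_subspaceT => t; rewrite inE/= in_itv/= => /andP[at_ tb].
  have /andP[h1 h2] := hk n.
  apply: (@continuousM R R (cst (k n)%:R) (fun t => y t - y (t - (k n)%:R^-1)) t).
    exact: cst_continuous.
  exact: continuous_difference.
have mq n : measurable_fun `[a, b] (q n).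
  by apply: subspace_continuous_measurable_fun; [exact: mab|exact: cq].
have iq n : leb1.-integrable `[a, b] (EFin \o q n).
  by apply: continuous_compact_integrable; [exact: segment_compact|exact: cq].
have mm n : measurable_fun `[a, b] (m n) by exact: measurable_maxr.
have qalpha : {ae leb1, forall t, t \in `[a, b] -> forall n, q n t <= alpha t}.
  apply: ae_impl Hs => t ht tab n; have /andP[h1 h2] := hk n.
  have := ht tab (t - (k n)%:R^-1); move: tab; rewrite in_itv/= => /andP[at_ tb].
  rewrite /q => hh; rewrite -ler_pdivlMl ?ltr0n//.
  apply: le_trans (hh _) _; first by apply/andP; split; lra.
  by rewrite le_eqVlt; apply/orP; left; apply/eqP; ring.
have mle : {ae leb1, forall t n, t \in `[a, b] -> `|m n t| <= `|alpha t| + `|beta t|}.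
  apply: ae_impl qalpha => t ht n tab; have := ht tab n.
  rewrite /m; have := ler_norm (alpha t); have := ler_norm (beta t).
  have := ler_norm (- beta t); rewrite normrN; have := normr_ge0 (alpha t); have := normr_ge0 (beta t).
  by case: (leP (q n t) (beta t)) => h *; rewrite ler_norml; apply/andP; split; lra.
have mcvg : {ae leb1, forall t, t \in `[a, b] -> m n t @[n --> \oo] --> beta t}.
  apply: ae_impl Hd => t ht tab; apply/cvgrPdist_le => e e0.
  have := ht tab e e0 => -[n1 _ hn1]; near=> n.
  have /hn1 /= hq : (n1 <= n + n0)%N.
    by rewrite (leq_trans _ (leq_addr _ _))//; near: n; exact: nbhs_infty_ge.
  have m1 : beta t <= m n t by rewrite /m le_max lexx orbT.
  have m2 : m n t <= beta t + e by rewrite /m ge_max; apply/andP; split; [exact: hq|lra].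
  by rewrite distrC ger0_norm; lra.
have iab : leb1.-integrable `[a, b] (fun t => (`|alpha t| + `|beta t|)%:E).
  have H := @integrableD _ _ _ leb1 _ mab _ _ (integrable_abse ialpha) (integrable_abse ibeta).
  by apply: eq_integrable H.
have mle' : {ae leb1, forall t n, `[a, b]%classic t ->
    (`|(m n t)%:E| <= (`|alpha t| + `|beta t|)%:E)%E}.
  by apply: ae_impl mle => t ht n tab; rewrite lee_fin; exact: ht.
have mcvg' : {ae leb1, forall t, `[a, b]%classic t -> (m n t)%:E @[n --> \oo] --> (beta t)%:E}.
  by apply: ae_impl mcvg => t ht tab; apply: cvg_EFin; [exact: nearW|exact: ht].
have mmE n : measurable_fun `[a, b] (fun t => (m n t)%:E) by exact/measurable_EFinP.
have mbE : measurable_fun `[a, b] (fun t => (beta t)%:E) by exact/measurable_EFinP.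
have [_ _ cm] := @dominated_convergence _ _ _ leb1 _ mab _ _ _ mmE mbE mcvg' iab mle'.
have im n : leb1.-integrable `[a, b] (EFin \o m n).
  have iqb := @integrableD _ _ _ leb1 _ mab _ _ (integrable_abse (iq n)) (integrable_abse ibeta).
  apply: (@le_integrable _ _ _ leb1 _ mab _ _ (mmE n) _ iqb).
  move=> t _; rewrite /= lee_fin [leRHS]ger0_norm ?addr_ge0//.
  rewrite /m; have qn := normr_ge0 (q n t); have bn := normr_ge0 (beta t).
  by rewrite maxEle; case: ifP => _; rewrite ?lerDl ?lerDr.
have cm' : \int[leb1]_(t in `[a, b]) m n t @[n --> \oo] --> \int[leb1]_(t in `[a, b]) beta t.
  apply: fine_cvg; rewrite fineK; last exact: integrable_fin_num.
  exact: cm.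
have cq' : \int[leb1]_(t in `[a, b]) q n t @[n --> \oo] --> y b - y a.
  have := cvg_average_difference; rewrite -(cvg_shiftn n0); apply: cvg_trans.
  apply: near_eq_cvg; apply: nearW => n /=.
  rewrite -RintegralZl//; apply: continuous_compact_integrable; first exact: segment_compact.
  apply: continuous_in_subspaceT => t; rewrite inE/= in_itv/= => /andP[at_ tb].
  by have /andP[h1 h2] := hk n; exact: continuous_difference.
rewrite -(cvg_lim (@Rhausdorff R) cq') -(cvg_lim (@Rhausdorff R) cm').
apply: ler_lim; [by apply/cvg_ex; eexists; exact: cq'|by apply/cvg_ex; eexists; exact: cm'|].
apply: nearW => n; apply: le_Rintegral => // t _.
by rewrite /m le_max lexx.
Unshelve. all: by end_near. Qed.

End Average.
End Real_analysis.

(** * Primitives of weak time derivatives *)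

Section Smooth_step.
Context {R : realType}.
Notation leb1 := (@lebesgue_measure R).
Implicit Types (x t : R).

Definition theta x : R := rho 0 x / (rho 0 x + rho 0 (1 - x)).

Lemma rho0_gt0 x : 0 < x -> 0 < rho 0 x.
Proof. by move=> x0; rewrite /rho x0 expr0 mul1r expR_gt0. Qed.

Lemma rho0_le0 x : x <= 0 -> rho 0 x = 0.
Proof. by move=> x0; rewrite /rho ltNge x0. Qed.

Lemma theta_den_gt0 x : 0 < rho 0 x + rho 0 (1 - x).
Proof.
have /andP[r1 _] := rho0_itv x; have /andP[r2 _] := rho0_itv (1 - x).
have [x0|x0] := ltP 0 x; first by rewrite ltr_pwDl// rho0_gt0.
by rewrite ltr_wpDl// rho0_gt0// subr_gt0 (le_lt_trans x0).
Qed.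

Lemma smooth1_theta : smooth1 theta.
Proof.
apply: smooth1M; first exact: smooth1_rho.
apply: smooth1V; first by move=> x; rewrite gt_eqF// theta_den_gt0.
apply: smooth1D; first exact: smooth1_rho.
rewrite (_ : (fun x => rho 0 (1 - x)) = fun x => rho 0 ((-1) * x + 1)).
  by apply: smooth1_affine; exact: smooth1_rho.
by apply/funext => x; rewrite mulN1r addrC.
Qed.

Lemma theta_le0 x : x <= 0 -> theta x = 0.
Proof. by move=> x0; rewrite /theta rho0_le0// mul0r. Qed.

Lemma theta_ge1 x : 1 <= x -> theta x = 1.
Proof.
move=> x1; rewrite /theta (rho0_le0 (1 - x)) ?subr_le0// addr0 divff// gt_eqF// rho0_gt0//.
exact: lt_le_trans x1.
Qed.

Lemma theta_itv x : 0 <= theta x <= 1.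
Proof.
have d0 := theta_den_gt0 x; have /andP[r1 _] := rho0_itv x; have /andP[r2 _] := rho0_itv (1 - x).
by rewrite /theta divr_ge0 ?(ltW d0)//= ler_pdivrMr// mul1r lerDl.
Qed.

Lemma theta_derivative : exists g : R -> R, exists M : R, [/\ continuous g,
  forall x, is_derive x (1 : R) theta (g x), forall x, `|g x| <= M
  & forall x, x < 0 \/ 1 < x -> g x = 0].
Proof.
have [g sg dg] := smooth1_is_derive _ smooth1_theta.
have cg := smooth1_continuous _ sg.
have g0 x : x < 0 \/ 1 < x -> g x = 0.
  have [_ dgx] := dg x; rewrite -dgx => -[x0|x1].
    rewrite -(derive_cst (0 : R) x (1 : R)); apply: near_eq_derive.
    near=> y; apply: theta_le0; apply: ltW; near: y; exact: lt_nbhsl.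
  rewrite -(derive_cst (1 : R) x (1 : R)); apply: near_eq_derive.
  near=> y; apply: theta_ge1; apply: ltW; near: y; exact: lt_nbhsr.
have : compact (g @` `[0, 1]).
  by apply: continuous_compact; [exact: continuous_subspaceT|exact: segment_compact].
move=> /compact_bounded[M [_ hM]]; exists g, (`|M| + 1); split=> // x.
have [x01|] := boolP (x \in `[0, 1]).
  by apply: hM; [rewrite (le_lt_trans (ler_norm M))// ltrDl|exists x].
rewrite in_itv/= negb_and -!ltNge => /orP x01.
by rewrite g0// normr0 addr_ge0.
Unshelve. all: by end_near. Qed.

Definition step n a x : R := theta (n.+1%:R * x + - (n.+1%:R * a)).

Lemma smooth1_step n a : smooth1 (step n a).
Proof. exact: smooth1_affine smooth1_theta. Qed.

Lemma step_eq0 n a x : x <= a -> step n a x = 0.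
Proof. by move=> xa; rewrite /step theta_le0// subr_le0 ler_pM2l. Qed.

Lemma step_eq1 n a x : a + n.+1%:R^-1 <= x -> step n a x = 1.
Proof.
move=> xa; rewrite /step theta_ge1// -mulrBr -ler_pdivrMl ?ltr0n// mulr1.
by rewrite lerBrDl.
Qed.

Lemma step_itv n a x : 0 <= step n a x <= 1.
Proof. exact: theta_itv. Qed.

(** The difference is written with a factor -1 to match the constructors of [smooth1]. *)
Definition window n a b x : R := step n a x + (-1) * step n b x.

Lemma smooth1_window n a b : smooth1 (window n a b).
Proof.
apply: smooth1D; first exact: smooth1_step.
by apply: smooth1M; [exact: smooth1_cst|exact: smooth1_step].
Qed.

Lemma window_neq0 n a b x : a < b -> window n a b x != 0 -> a <= x <= b + n.+1%:R^-1.
Proof.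
move=> ab w0; apply/andP; split.
  rewrite leNgt; apply: contraNN w0 => xa; apply/eqP.
  by rewrite /window (step_eq0 n a) ?(step_eq0 n b) ?(ltW xa) ?(ltW (lt_trans xa ab))// mulr0 addr0.
rewrite leNgt; apply: contraNN w0 => bx; apply/eqP.
rewrite /window (step_eq1 n a) ?(step_eq1 n b) ?(ltW bx)// ?mulr1 ?subrr//.
by rewrite ltW// (lt_trans _ bx)// ltrD2r.
Qed.

Lemma time_test_function_window T n a b : 0 < a -> a < b -> b + n.+1%:R^-1 < T ->
  time_test_function T (window n a b).
Proof.
move=> a0 ab bT.
have sub : closure [set t | window n a b t != 0] `<=` `[a, b + n.+1%:R^-1].
  rewrite [X in _ `<=` X](closure_id _).1; last exact: itv_closed.
  by apply: closure_subset => x; rewrite /= in_itv/=; exact: window_neq0.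
split.
- move=> m t; have [g _ dg] := smooth1_is_derive _ (smooth1_derive1n _ m (smooth1_window n a b)).
  by have [] := dg t.
- by apply: subclosed_compact sub; [exact: closed_closure|exact: segment_compact].
- apply: subset_trans sub _ => x; rewrite /= !in_itv/= => /andP[h1 h2].
  by rewrite (lt_le_trans a0 h1) (le_lt_trans h2 bT).
Qed.

Lemma cvg_window a b x : a < b -> window n a b x @[n --> \oo] --> (\1_(`]a, b]) x : R).
Proof.
move=> ab; apply: cvg_near_cst.
have near1 (c : R) : c < x -> \forall n \near \oo, step n c x = 1.
  move=> cx; have : 0 < x - c by rewrite subr_gt0.
  move=> /(cvgr_lt 0 (@cvg_harmonic R)); apply: filterS => n; rewrite /= => h.
  by apply: step_eq1; rewrite -lerBrDl ltW.
have [xa|ax] := leP x a.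
  apply: nearW => n; rewrite /window !step_eq0 ?(le_trans xa (ltW ab))// mulr0 addr0.
  by rewrite indicE memNset//= in_itv/= ltNge xa.
have [xb|bx] := leP x b.
  apply: filterS (near1 a ax) => n h.
  rewrite /window h step_eq0// mulr0 addr0 indicE mem_set//=.
  by rewrite in_itv/= ax xb.
apply: filterS2 (near1 a ax) (near1 b bx) => n h1 h2.
rewrite /window h1 h2 mulr1 subrr indicE memNset//= in_itv/= ax/=.
by rewrite leNgt bx.
Qed.

End Smooth_step.

Section Weak_time_derivative.
Context {R : realType}.
Notation leb1 := (@lebesgue_measure R).
Implicit Types (f c d : R -> R) (a b t T : R).

Lemma restrict_supported (D E : set R) f : D `<=` E ->
  (forall t, E t -> ~ D t -> f t = 0) -> f \_ E = f \_ D.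
Proof.
move=> DE f0; apply/funext => t; rewrite /patch.
case: ifPn => tE; case: ifPn => tD //.
  by apply: f0; [exact: set_mem|rewrite notin_setE in tD].
by rewrite (mem_set (DE _ (set_mem tD))) in tE.
Qed.

Lemma integrable_supported (D E : set R) f : measurable D -> measurable E -> D `<=` E ->
  (forall t, E t -> ~ D t -> f t = 0) -> leb1.-integrable D (EFin \o f) ->
  leb1.-integrable E (EFin \o f).
Proof.
move=> mD mE DE f0 iD.
have [iD' _] := @integrable_mkcond _ _ _ leb1 D (EFin \o f) mD.
have [_] := @integrable_mkcond _ _ _ leb1 E (EFin \o f) mE; apply.
by move: (iD' iD); rewrite !restrict_EFin (restrict_supported D E).
Qed.

Lemma Rintegral_supported_in (D E : set R) f : D `<=` E ->
  (forall t, E t -> ~ D t -> f t = 0) ->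
  \int[leb1]_(t in E) f t = \int[leb1]_(t in D) f t.
Proof.
by move=> DE f0; rewrite Rintegral_mkcond [RHS]Rintegral_mkcond (restrict_supported D E).
Qed.

Lemma Rintegral_bound f a b (M : R) : a < b -> {within `[a, b], continuous f} ->
  (forall t, t \in `[a, b] -> `|f t| <= M) ->
  `|\int[leb1]_(t in `[a, b]) f t| <= M * (b - a).
Proof.
move=> ab cf fM.
have mab : measurable (`[a, b]%classic : set R) by exact: measurable_itv.
have intf : leb1.-integrable `[a, b] (EFin \o f).
  by apply: continuous_compact_integrable; [exact: segment_compact|exact: cf].
have h1 : `|\int[leb1]_(t in `[a, b]) f t| <= \int[leb1]_(t in `[a, b]) `|f t|.
  exact: le_normr_Rintegral.
have imM : leb1.-integrable `[a, b] (EFin \o cst M).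
  apply: continuous_compact_integrable; first exact: segment_compact.
  by apply: continuous_subspaceT => x; exact: cst_continuous.
have h2 : \int[leb1]_(t in `[a, b]) `|f t| <= \int[leb1]_(t in `[a, b]) (cst M t).
  have in1 : leb1.-integrable `[a, b] (EFin \o (fun t => `|f t|)) by exact: integrable_norm.
  by apply: le_Rintegral => // t tab; exact: fM.
apply: le_trans h1 (le_trans h2 _).
have -> : \int[leb1]_(t in `[a, b]) (cst M t) = M * fine (leb1 `[a, b]).
  exact: Rintegral_cst.
by rewrite lebesgue_measure_itv/= lte_fin ab.
Qed.

Section Approximate_identity.
Variables (g : R -> R) (M : R).
Hypotheses (cg : continuous g) (gM : forall x, `|g x| <= M)
  (dg : forall x, is_derive x (1 : R) theta (g x))
  (g0 : forall x, x < 0 \/ 1 < x -> g x = 0).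

Definition dstep n a t : R := g (n.+1%:R * t + - (n.+1%:R * a)) * n.+1%:R.

Lemma dstep_continuous n a : continuous (dstep n a).
Proof.
move=> t; apply: (@continuousM R R (fun t => g (n.+1%:R * t + - (n.+1%:R * a))) (cst n.+1%:R) t); last exact: cst_continuous.
apply: (@continuous_comp _ _ _ (fun t : R => n.+1%:R * t + - (n.+1%:R * a)) g); last exact: cg.
apply: (@continuousD R R^o R (fun t => n.+1%:R * t) (cst (- (n.+1%:R * a))) t); last exact: cst_continuous.
by apply: (@continuousM R R (cst n.+1%:R) id t); [exact: cst_continuous|exact: cvg_id].
Qed.

Lemma is_derive_step n a t : is_derive t (1 : R) (step n a) (dstep n a t).
Proof.
apply: (@is_derive1_comp R theta (fun t => n.+1%:R * t + - (n.+1%:R * a))).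
have := is_deriveD (is_deriveZ n.+1%:R (is_derive_id t (1 : R)))
  (is_derive_cst (- (n.+1%:R * a)) t (1 : R)).
by rewrite addr0 [_ *: (1 : R)]mulr1.
Qed.

Lemma dstep_eq0 n a t : ~ (t \in `[a, a + n.+1%:R^-1]) -> dstep n a t = 0.
Proof.
move=> /negP; rewrite in_itv/= negb_and -!ltNge /dstep -mulrBr => /orP[ta|at_]; rewrite g0 ?mul0r//.
  by left; rewrite pmulr_rlt0 ?ltr0n// subr_lt0.
by right; rewrite -ltr_pdivrMl ?ltr0n// mulr1 ltrBrDl.
Qed.

Lemma dstep_le n a t : `|dstep n a t| <= M * n.+1%:R.
Proof. by rewrite normrM (ger0_norm (ler0n _ _)) ler_wpM2r. Qed.

(** The kernel [dstep] has integral 1, support in [a, a + 1/(n+1)] and absolute value at most M (n +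
    1). Its sign is not controlled, so the error is bounded by M times the oscillation of c on the
    support. *)
Lemma cvg_approximate_identity T c a : 0 < a -> a < T ->
  (forall t, t \in `]0, T[ -> {for t, continuous c}) ->
  \int[leb1]_(t in `]0, T[) (dstep n a t * c t) @[n --> \oo] --> c a.
Proof.
move=> a0 aT cc.
have M0 : 0 <= M := le_trans (normr_ge0 _) (gM 0).
apply/cvgrPdist_le => e e0.
have aJ : a \in `]0, T[ by rewrite in_itv/= a0 aT.
have /cvgrPdist_le/(_ (e / (M + 1))) := cc a aJ.
have eM : 0 < e / (M + 1) by rewrite divr_gt0// ltr_wpDl.
move=> /(_ eM); rewrite -nbhs_ballE => -[r /= r0 hr].
have r1 : 0 < Num.min r (T - a) by rewrite lt_min r0 subr_gt0.
move: (r1) => /(cvgr_lt 0 (@cvg_harmonic R)); apply: filterS => n /=; rewrite lt_min => /andP[hr1 hT].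
set b := a + n.+1%:R^-1.
have h0 : 0 < n.+1%:R^-1 :> R by rewrite invr_gt0 ltr0n.
have ab : a < b by rewrite ltrDl.
have abJ : `[a, b]%classic `<=` (`]0, T[%classic : set R).
  move=> t; rewrite /= !in_itv/= => /andP[h1 h2]; rewrite /b in h2.
  have hT' : n.+1%:R^-1 < T - a := hT.
  apply/andP; split; first exact: lt_le_trans h1.
  by apply: le_lt_trans h2 _; rewrite -ltrBrDl.
have cab : {within `[a, b], continuous c}.
  by apply: continuous_in_subspaceT => t; rewrite inE => /abJ; exact: cc.
have cd : {within `[a, b], continuous (dstep n a)}.
  by apply: continuous_subspaceT => t; exact: dstep_continuous.
have I1 : \int[leb1]_(t in `[a, b]) dstep n a t = 1.
  rewrite (Rintegral_derivative (step n a) (dstep n a) a b ab (fun t _ => is_derive_step n a t) cd).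
  by rewrite step_eq1// step_eq0// subr0.
have mab : measurable (`[a, b]%classic : set R) by exact: measurable_itv.
have icont f : {within `[a, b], continuous f} -> leb1.-integrable `[a, b] (EFin \o f).
  by move=> cf; apply: continuous_compact_integrable; [exact: segment_compact|exact: cf].
rewrite (Rintegral_supported_in `[a, b] _ _ abJ); last first.
  by move=> t _ /dstep_eq0 ->; rewrite mul0r.
have cdc : {within `[a, b], continuous (fun t => dstep n a t * c t)}.
  by move=> t; apply: (@continuousM R (subspace `[a, b]) (dstep n a) c t); [exact: cd|exact: cab].
have cda : {within `[a, b], continuous (fun t => c a * dstep n a t)}.
  by move=> t; apply: (@continuousM R (subspace `[a, b]) (fun=> c a) (dstep n a) t); [exact: cst_continuous|exact: cd].
have -> : c a - \int[leb1]_(t in `[a, b]) (dstep n a t * c t) =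
    \int[leb1]_(t in `[a, b]) (c a * dstep n a t - dstep n a t * c t).
  have i1 : leb1.-integrable `[a, b] (EFin \o (fun t => c a * dstep n a t)) by exact: icont.
  have i2 : leb1.-integrable `[a, b] (EFin \o (fun t => dstep n a t * c t)) by exact: icont.
  have -> : \int[leb1]_(t in `[a, b]) (c a * dstep n a t - dstep n a t * c t) =
     \int[leb1]_(t in `[a, b]) (c a * dstep n a t) - \int[leb1]_(t in `[a, b]) (dstep n a t * c t).
    exact: RintegralB.
  have -> : \int[leb1]_(t in `[a, b]) (c a * dstep n a t) = c a * \int[leb1]_(t in `[a, b]) dstep n a t.
    by apply: RintegralZl => //; exact: icont.
  by rewrite I1 mulr1.
have cdd : {within `[a, b], continuous (fun t => c a * dstep n a t - dstep n a t * c t)}.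
  by move=> t; apply: (@continuousB R R^o (subspace `[a, b]) (fun t => c a * dstep n a t) (fun t => dstep n a t * c t) t); [exact: cda|exact: cdc].
apply: le_trans (Rintegral_bound _ a b (M * n.+1%:R * (e / (M + 1))) ab cdd _) _.
  move=> t tab; rewrite (_ : _ - _ = dstep n a t * (c a - c t)); last by ring.
  rewrite normrM ler_pM// ?dstep_le//; apply: hr => /=.
  move: tab; rewrite in_itv/= /b => /andP[h1 h2].
  have h3 : n.+1%:R^-1 < r := hr1.
  rewrite /ball/= distrC ger0_norm ?subr_ge0//.
  by apply: le_lt_trans h3; rewrite lerBlDl.
rewrite /b addrAC subrr add0r.
have n0 : n.+1%:R != 0 :> R by rewrite pnatr_eq0.
have -> : M * n.+1%:R * (e / (M + 1)) / n.+1%:R = e * (M / (M + 1)).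
  have M1 : M + 1 != 0 by rewrite gt_eqF// ltr_wpDl.
  by move: (n.+1%:R : R) n0 => k k0; field; rewrite k0 M1.
by rewrite ger_pMr// ler_pdivrMr ?ltr_wpDl// mul1r lerDl.
Qed.

End Approximate_identity.

(** The test functions are windows: they tend to the indicator of ]a, b], while their derivatives
    are approximate identities at a minus those at b. *)
Lemma weak_time_derivative_primitive T c d a b : 0 < a -> a < b -> b < T ->
  (forall t, t \in `]0, T[ -> {for t, continuous c}) ->
  measurable_fun setT d -> leb1.-integrable setT (EFin \o d) ->
  (forall eta, time_test_function T eta ->
    \int[leb1]_(t in `]0, T[) (eta^`()%classic t * c t) =
    - \int[leb1]_(t in `]0, T[) (eta t * d t)) ->
  c b - c a = \int[leb1]_(t in `]a, b]) d t.
Proof.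
move=> a0 ab bT cc md intd H.
have [g [M [cg dg gM g0]]] := @theta_derivative R.
have mJ : measurable (`]0, T[%classic : set R) by exact: measurable_itv.
have idJ : leb1.-integrable `]0, T[ (EFin \o d) by apply: (integrableS measurableT).
have aT := lt_trans ab bT; have b0 := lt_trans a0 ab.
have L : \int[leb1]_(t in `]0, T[) ((window n a b)^`()%classic t * c t) @[n --> \oo] --> c a - c b.
  have cv := cvgB (cvg_approximate_identity g M cg gM dg g0 T c a a0 aT cc)
     (cvg_approximate_identity g M cg gM dg g0 T c b b0 bT cc).
  have {}cv : \int[leb1]_(t in `]0, T[) (dstep g n a t * c t)
      - \int[leb1]_(t in `]0, T[) (dstep g n b t * c t) @[n --> \oo] --> c a - c b by apply: cv.
  apply: cvg_trans cv; apply: near_eq_cvg.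
  have r1 : 0 < T - b by rewrite subr_gt0.
  move: (r1) => /(cvgr_lt 0 (@cvg_harmonic R)); apply: filterS => n /= hT.
  have ii e : 0 < e -> e <= b -> leb1.-integrable `]0, T[ (EFin \o (fun t => dstep g n e t * c t)).
    move=> e0 eb; have h0 : 0 < n.+1%:R^-1 :> R by rewrite invr_gt0 ltr0n.
    have sub : `[e, e + n.+1%:R^-1]%classic `<=` (`]0, T[%classic : set R).
      move=> t; rewrite /= !in_itv/= => /andP[h1 h2].
      have hT' : n.+1%:R^-1 < T - b := hT.
      apply/andP; split; first exact: lt_le_trans h1.
      by apply: le_lt_trans h2 _; rewrite addrC; apply: lt_le_trans (ltr_leD hT' eb) _; rewrite subrK.
    apply: (integrable_supported _ _ _ _ mJ sub); first exact: measurable_itv.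
      by move=> t _ /(dstep_eq0 g g0) ->; rewrite mul0r.
    apply: continuous_compact_integrable; first exact: segment_compact.
    apply: continuous_in_subspaceT => t; rewrite inE => /sub /= tJ.
    by apply: (@continuousM R R (dstep g n e) c t); [exact: dstep_continuous|exact: cc].
  have i1 := ii a a0 (ltW ab); have i2 := ii b b0 (lexx b).
  have <- : \int[leb1]_(t in `]0, T[) (dstep g n a t * c t - dstep g n b t * c t) =
     \int[leb1]_(t in `]0, T[) (dstep g n a t * c t) - \int[leb1]_(t in `]0, T[) (dstep g n b t * c t).
    exact: RintegralB.
  apply: eq_Rintegral => t _; rewrite -mulrBl; congr (_ * _).
  rewrite derive1E.
  have dw := is_deriveD (is_derive_step g dg n a t)
    (is_deriveZ (-1) (is_derive_step g dg n b t)).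
  by have [_ ->] := dw; rewrite [_ *: _]mulN1r.
have Rr : (fun n => - \int[leb1]_(t in `]0, T[) (window n a b t * d t)) @ \oo -->
    - \int[leb1]_(t in `]a, b]) d t.
  apply: cvgN.
  have mw n : measurable_fun `]0, T[ (window n a b).
    apply: (measurable_funS measurableT) => //; apply: continuous_measurable_fun.
    exact: smooth1_continuous (smooth1_window n a b).
  have mwd n : measurable_fun `]0, T[ (fun t => (window n a b t * d t)%:E).
    apply/measurable_EFinP; apply: measurable_funM; first exact: mw.
    exact: (measurable_funS measurableT).
  have wle n t : (`|(window n a b t * d t)%:E| <= (2 * `|d t|)%:E)%E.
    rewrite lee_fin normrM ler_wpM2r// /window.
    have /andP[? ?] := step_itv n a t; have /andP[? ?] := step_itv n b t.
    by rewrite ler_norml; apply/andP; split; lra.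
  have i2 : leb1.-integrable `]0, T[ (fun t => (2 * `|d t|)%:E).
    rewrite (_ : (fun t => _) = fun t => (2%:E * `|(d t)%:E|)%E); last by apply/funext.
    by apply: integrableZl => //; exact: integrable_abse.
  have cvd t : (window n a b t * d t)%:E @[n --> \oo] --> (\1_(`]a, b]) t * d t)%:E.
    by apply: cvg_EFin; [exact: nearW|apply: cvgM; [exact: cvg_window|exact: cvg_cst]].
  have := @dominated_cvg _ _ _ leb1 _ mJ _ _ (fun t => (2 * `|d t|)%:E) mwd (fun t _ => cvd t) (fun t _ => isT) i2 (fun n t _ => wle n t).
  have E : \int[leb1]_(t in `]0, T[) (\1_(`]a, b]) t * d t) = \int[leb1]_(t in `]a, b]) d t.
    rewrite (Rintegral_supported_in (`]a, b]%classic : set R)).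
    - by apply: eq_Rintegral => t tab; rewrite indicE tab mul1r.
    - move=> t; rewrite /= !in_itv/= => /andP[h1 h2]; apply/andP; split; lra.
    - by move=> t _ nt; rewrite indicE memNset// mul0r.
  move=> cvI; rewrite -E; apply: fine_cvg; rewrite fineK; first exact: cvI.
  apply: integrable_fin_num => //.
  apply: (@le_integrable _ _ _ leb1 _ mJ _ (EFin \o d)) => //.
    apply/measurable_EFinP; apply: measurable_funM; first exact: measurable_indic.
    exact: (measurable_funS measurableT).
  by move=> t _; rewrite lee_fin normrM indicE; case: (_ \in _); rewrite ?normr1 ?normr0 ?mul1r ?mul0r.
have r1 : 0 < T - b by rewrite subr_gt0.
have eqn : \forall n \near \oo, \int[leb1]_(t in `]0, T[) ((window n a b)^`()%classic t * c t) =
    - \int[leb1]_(t in `]0, T[) (window n a b t * d t).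
  move: (r1) => /(cvgr_lt 0 (@cvg_harmonic R)); apply: filterS => n /= hT.
  by apply: H; apply: time_test_function_window => //; rewrite -ltrBrDl.
have L' : (fun n => - \int[leb1]_(t in `]0, T[) (window n a b t * d t)) @ \oo --> c a - c b.
  by apply: cvg_trans L; apply: near_eq_cvg; apply: filterS eqn => n ->.
have E : - (\int[leb1]_(t in `]a, b]) d t) = c a - c b by exact: cvg_unique Rr L'.
by rewrite -[RHS]opprK E opprB.
Qed.

End Weak_time_derivative.

Section Lebesgue_points.
Context {R : realType}.
Notation leb1 := (@lebesgue_measure R).
Implicit Types (d e : R -> R) (a b t : R).

Lemma le_Rintegral_ae (D : set R) d e : measurable D ->
  leb1.-integrable D (EFin \o d) -> leb1.-integrable D (EFin \o e) ->
  {ae leb1, forall t, D t -> d t <= e t} ->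
  \int[leb1]_(t in D) d t <= \int[leb1]_(t in D) e t.
Proof.
move=> mD intd inte de; rewrite -subr_ge0.
have <- : \int[leb1]_(t in D) (e t - d t) =
    \int[leb1]_(t in D) e t - \int[leb1]_(t in D) d t by exact: RintegralB.
have -> : \int[leb1]_(t in D) (e t - d t) = \int[leb1]_(t in D) `|e t - d t|.
  congr fine; apply: ae_eq_integral_nonmeasurable => //.
  by apply: ae_impl de => t h Dt; rewrite ger0_norm// subr_ge0 h.
exact: Rintegral_ge0.
Qed.

Lemma ae_cvg_left_average d : leb1.-integrable setT (EFin \o d) ->
  {ae leb1, forall t,
    n.+1%:R * \int[leb1]_(s in `]t - n.+1%:R^-1, t]) d s @[n --> \oo] --> d t}.
Proof.
move=> intd.
have idy y : leb1.-integrable `]-oo, y] (EFin \o d) by exact: (integrableS measurableT).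
have ld : locally_integrable [set: R] d by apply: open_integrable_locally => //; exact: openT.
apply: ae_impl (FTC1Ny idy ld) => t [dF Ft].
have dt : is_derive t (1 : R) (fun x => \int[leb1]_(s in `]-oo, x]) d s) (d t).
  exact: (DeriveDef dF (etrans (esym (derive1E _ _)) Ft)).
have := cvg_left_quotient _ _ _ dt; apply: cvg_trans; apply: near_eq_cvg.
apply: nearW => n /=; congr (_ * _); rewrite Rintegral_itvB//.
by rewrite bnd_simp lerBlDl lerDr invr_ge0.
Qed.

End Lebesgue_points.

Section Energy.
Context {R : realType} {N : nat}.
Variable Omega : set 'rV[R]_N.
Hypothesis oO : open Omega.
Notation mu := (leb R N).
Notation sqi := (sqintegrable mu (Omega : set (space R N))).
Notation I := (ip mu (Omega : set (space R N))).
Notation leb1 := (@lebesgue_measure R).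
Implicit Types (w z h psi : 'rV[R]_N -> R).

Let mO : measurable (Omega : set (space R N)) := open_space_measurable _ oO.

Variable T : R.

Lemma bochner_L2_sqintegrable W : bochner_L2 Omega T W ->
  {ae leb1, forall t, t \in `]0, T[ -> sqi (W t)}.
Proof.
move=> [[m [A [g [_ _ cA]]]] _].
by apply: ae_impl cA => t ct tT; have [] := ct tT.
Qed.

Lemma bochner_L2_ip W psi : bochner_L2 Omega T W -> sqi psi ->
  exists d : R -> R, [/\ measurable_fun setT d, leb1.-integrable setT (EFin \o d)
    & {ae leb1, forall t, t \in `]0, T[ -> I (W t) psi = d t}].
Proof.
move=> bW spsi; have [sW [alpha [malpha alpha0 ialpha alphaE]]] := bW.
have [e me eE] := strongly_approximable_ip _ oO _ _ _ sW spsi.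
have mJ : measurable (`]0, T[%classic : set R) by exact: measurable_itv.
pose d t := e t * \1_(`]0, T[) t.
have md : measurable_fun setT d.
  by apply: measurable_funM => //; exact: measurable_indic.
have dE : {ae leb1, forall t, t \in `]0, T[ -> I (W t) psi = d t}.
  by apply: ae_impl eE => t et tT; rewrite /d indicE mem_set// mulr1 -et.
exists d; split=> //.
pose c := I psi psi.
have ib : leb1.-integrable `]0, T[ (fun t => (alpha t + c)%:E).
  have i1 : leb1.-integrable `]0, T[ (EFin \o alpha) by apply: (integrableS measurableT).
  have i2 : leb1.-integrable `]0, T[ (EFin \o cst c).
    apply: (@integrableS _ _ _ leb1 `[0, T]); [exact: measurable_itv|exact: mJ|exact: subset_itv_oo_cc|].
    apply: continuous_compact_integrable; first exact: segment_compact.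
    by apply: continuous_subspaceT => x; exact: cst_continuous.
  exact: (@integrableD _ _ _ leb1 _ mJ _ _ i1 i2).
apply/integrableP; split; first exact/measurable_EFinP.
have -> : (\int[leb1]_t `|(EFin \o d) t| = \int[leb1]_(t in `]0%R, T[) `|(EFin \o d) t|)%E.
  rewrite [RHS]integral_mkcond; apply: eq_integral => t _.
  rewrite /patch; case: ifPn => // tJ; rewrite /= /d indicE (negbTE tJ) mulr0 normr0.
  by [].
have /integrableP[_] := ib; apply: le_lt_trans.
apply: ge0_ae_le_integral => //.
apply: ae_impl3 (bochner_L2_sqintegrable _ bW) alphaE dE => t st at_ dt tT.
(* Young's inequality for both W t and - W t bounds the absolute value of the product by alpha t +
   ||psi||^2, integrable on the bounded interval. *)
rewrite /= lee_fin -dt// -at_//; have {}st := st tT.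
have h1 := ip_Young mO _ _ st spsi.
have h2 := ip_Young mO _ _ (sqintegrableZ mO (-1) _ st) spsi.
have sNt := sqintegrableZ mO (-1) _ st.
rewrite (ipZl mO _ _ _ st spsi) (ipZl mO _ _ _ st sNt) (ipZr mO _ _ _ st st) in h2.
have a0 : 0 <= I (W t) (W t) by exact: ip_ge0. have c0 : 0 <= c by exact: ip_ge0.
move: (I (W t) (W t)) (I (W t) psi) a0 h1 h2 c0; rewrite -/c => A b a0 h1 h2 c0.
rewrite (ger0_norm (addr_ge0 a0 c0)) ler_norml; apply/andP; split; lra.
Qed.

(** For a fixed psi, the weak derivative of u in time becomes that of the scalar function (u t,
    psi); d is a Borel representative of (ut t, psi). *)
Lemma W12_primitive (u ut : R -> 'rV[R]_N -> R) psi : bochner_L2 Omega T ut -> sqi psi ->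
  (forall t, t \in `]0, T[ -> {for t, continuous (fun s => I (u s) psi)}) ->
  (forall eta phi, time_test_function T eta -> L2 Omega phi ->
    \int[leb1]_(t in `]0, T[) (eta^`()%classic t * inner Omega (u t) phi) =
    - \int[leb1]_(t in `]0, T[) (eta t * inner Omega (ut t) phi)) ->
  exists d : R -> R, [/\ measurable_fun setT d, leb1.-integrable setT (EFin \o d),
    {ae leb1, forall t, t \in `]0, T[ -> I (ut t) psi = d t}
    & forall a b, 0 < a -> a < b -> b < T ->
      I (u b) psi - I (u a) psi = \int[leb1]_(t in `]a, b]) d t].
Proof.
move=> but spsi cu H; have [d [md intd dE]] := bochner_L2_ip _ _ but spsi.
exists d; split=> // a b a0 ab bT.
apply: (weak_time_derivative_primitive T (fun s => I (u s) psi) d a b a0 ab bT cu md intd).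
move=> eta teta.
have E := H eta psi teta ((L2P Omega oO psi).2 spsi).
transitivity (- \int[leb1]_(t in `]0, T[) (eta t * inner Omega (ut t) psi)); first exact: E.
congr (- _); congr fine; apply: ae_eq_integral_nonmeasurable; first exact: measurable_itv.
by apply: ae_impl dE => t dt tT; rewrite -dt.
Qed.

End Energy.

(** * The energy inequality *)

Section Energy_inequality.
Context {R : realType} {N : nat}.
Variable Omega : set 'rV[R]_N.
Hypothesis oO : open Omega.
Notation mu := (leb R N).
Notation sqi := (sqintegrable mu (Omega : set (space R N))).
Notation I := (ip mu (Omega : set (space R N))).
Notation leb1 := (@lebesgue_measure R).
Implicit Types (psi : 'rV[R]_N -> R).

Let mO : measurable (Omega : set (space R N)) := open_space_measurable _ oO.

Lemma ip_weighted_Young (f g : 'rV[R]_N -> R) K : 0 < K -> sqi f -> sqi g ->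
  2 * I f g <= K * I g g + K^-1 * I f f.
Proof.
move=> K0 sf sg.
have h : 0 <= I f f - 2 * K * I f g + K ^+ 2 * I g g.
  by rewrite -(ip_sqrB mO K _ _ sf sg); exact: ip_ge0.
rewrite -(ler_pM2l K0) mulrDr mulrA (mulrA K K^-1) divff ?gt_eqF// mul1r.
move: h; move: (I f f) (I f g) (I g g) => A b c; nra.
Qed.

Variable T : R.
(** Below, x stands for ||Lap u||^2 and w for Lap^2 u, gamma and alpha for Borel representatives of
    ||ut||^2 and ||w||^2, G for the bound of 2 (ut, w), and [good] for the times of ]0, T[ at which
    u is in W^{4,2}. *)
Variables (u w ut : R -> 'rV[R]_N -> R) (x G alpha gamma : R -> R) (good : set R).
Hypotheses (bw : bochner_L2 Omega T w) (but : bochner_L2 Omega T ut).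
Hypotheses (cx : forall t, t \in `]0, T[ -> {for t, continuous x})
  (aeg : {ae leb1, forall t, t \in `]0, T[ -> good t})
  (gw : forall t, good t -> sqi (w t))
  (gx : forall t s, good t -> t \in `]0, T[ -> s \in `]0, T[ ->
    x t - x s <= 2 * (I (u t) (w t) - I (u s) (w t)))
  (gc : forall s, good s -> forall t, t \in `]0, T[ ->
    {for t, continuous (fun r => I (u r) (w s))})
  (weak : forall eta phi, time_test_function T eta -> L2 Omega phi ->
    \int[leb1]_(t in `]0, T[) (eta^`()%classic t * inner Omega (u t) phi) =
    - \int[leb1]_(t in `]0, T[) (eta t * inner Omega (ut t) phi)).
Hypotheses (igamma : leb1.-integrable setT (EFin \o gamma))
  (gammaE : {ae leb1, forall t, t \in `]0, T[ -> I (ut t) (ut t) = gamma t}).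

(* The increment of x is at most 2 (u t - u s, w t) = 2 int_s^t (ut, w t), and
   the part (ut, w t - psi) of the integrand is absorbed by Young's inequality. *)
Lemma energy_increment psi d K s t : good t -> 0 < s -> s < t -> t < T -> sqi psi ->
  leb1.-integrable setT (EFin \o d) ->
  {ae leb1, forall r, r \in `]0, T[ -> I (ut r) psi = d r} -> 0 < K ->
  x t - x s <= 2 * \int[leb1]_(r in `]s, t]) d r + K^-1 * \int[leb1]_(r in `]s, t]) gamma r
    + K * I (fun y => w t y - psi y) (fun y => w t y - psi y) * (t - s).
Proof.
move: (bw) (but) (cx) (weak) (igamma) (gammaE) => bw' but' cx' weak' ig gE.
move=> gt_ s0 st tT spsi intd dE K0.
have swt := gw _ gt_.
have [d' [md' id' dE' D']] := W12_primitive Omega oO T u ut (w t) but' swt (gc _ gt_) weak'.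
have tJ : t \in `]0, T[ by rewrite in_itv/= tT (lt_trans s0 st).
have sJ : s \in `]0, T[ by rewrite in_itv/= s0 (lt_trans st tT).
apply: le_trans (gx _ _ gt_ tJ sJ) _; rewrite (D' s t s0 st tT).
have swp := sqintegrableB mO _ _ swt spsi.
pose m := I (fun y => w t y - psi y) (fun y => w t y - psi y).
rewrite -/m.
have mE : measurable (`]s, t]%classic : set R) by exact: measurable_itv.
have i1 : leb1.-integrable `]s, t] (EFin \o d) by apply: (integrableS measurableT).
have i2 : leb1.-integrable `]s, t] (EFin \o gamma) by apply: (integrableS measurableT).
have i3 : leb1.-integrable `]s, t] (EFin \o d') by apply: (integrableS measurableT).
have i0 (c : R) : leb1.-integrable `]s, t] (EFin \o cst c).
  apply: (@integrableS _ _ _ leb1 `[s, t]); [exact: measurable_itv|exact: mE|exact: subset_itv_oc_cc|].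
  apply: continuous_compact_integrable; first exact: segment_compact.
  by apply: continuous_subspaceT => z; exact: cst_continuous.
have iZ c f : leb1.-integrable `]s, t] (EFin \o f) -> leb1.-integrable `]s, t] (EFin \o (fun r => c * f r)).
  by move=> intf; have := @integrableZl _ _ _ leb1 _ mE c _ intf.
have EZ (c : R) f : leb1.-integrable `]s, t] (EFin \o f) ->
    \int[leb1]_(r in `]s, t]) (c * f r) = c * \int[leb1]_(r in `]s, t]) f r.
  by move=> intf; exact: RintegralZl.
have iD f g : leb1.-integrable `]s, t] (EFin \o f) -> leb1.-integrable `]s, t] (EFin \o g) ->
    leb1.-integrable `]s, t] (EFin \o (fun r => f r + g r)).
  by move=> intf intg; have := @integrableD _ _ _ leb1 _ mE _ _ intf intg.
have ED f g : leb1.-integrable `]s, t] (EFin \o f) -> leb1.-integrable `]s, t] (EFin \o g) ->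
    \int[leb1]_(r in `]s, t]) (f r + g r) =
    \int[leb1]_(r in `]s, t]) f r + \int[leb1]_(r in `]s, t]) g r.
  by move=> intf intg; exact: RintegralD.
have -> : K * m * (t - s) = \int[leb1]_(r in `]s, t]) (cst (K * m) r).
  have -> : \int[leb1]_(r in `]s, t]) (cst (K * m) r) = K * m * fine (leb1 `]s, t]).
    exact: Rintegral_cst.
  by rewrite lebesgue_measure_itv/= lte_fin st.
rewrite -(EZ 2 d' i3) -(EZ 2 d i1) -(EZ K^-1 gamma i2).
rewrite -(ED _ _ (iZ 2 d i1) (iZ K^-1 gamma i2)).
rewrite -(ED _ _ (iD _ _ (iZ 2 d i1) (iZ K^-1 gamma i2)) (i0 (K * m))).
apply: le_Rintegral_ae.
- exact: mE.
- exact: (iZ _ _ i3).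
- exact: (iD _ _ (iD _ _ (iZ 2 d i1) (iZ K^-1 gamma i2)) (i0 (K * m))).
have sut := bochner_L2_sqintegrable Omega T ut but'.
have gsut : {ae leb1, forall r, r \in `]0, T[ -> I (ut r) (ut r) = gamma r /\ sqi (ut r)}.
  by apply: ae_impl2 gE sut => r h1 h2 rJ; split; [exact: h1|exact: h2].
apply: ae_impl3 dE' dE gsut.
move=> r h1 h2 h3 rE.
have rJ : r \in `]0, T[.
  by move: rE; rewrite /= !in_itv/= => /andP[sr rt]; rewrite (lt_trans s0 sr) (le_lt_trans rt tT).
have [gr sr] := h3 rJ; rewrite -(h1 rJ) -(h2 rJ) -gr /=.
have Y := ip_weighted_Young _ _ K K0 sr swp.
rewrite (ipBr mO _ _ _ sr swt spsi) in Y; rewrite -/m in Y.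
by move: Y; move: (I (ut r) (w t)) (I (ut r) psi) (I (ut r) (ut r)) => A1 A2 A3 Y; lra.
Qed.

Hypotheses (malpha : measurable_fun setT alpha)
  (ialpha : leb1.-integrable setT (EFin \o alpha))
  (alphaE : {ae leb1, forall t, t \in `]0, T[ -> I (w t) (w t) = alpha t}).

(* The Lebesgue points of (ut, w t) depend on the function w t, which varies with
   t; hence the approximation of w t by a countable family w (tau j). *)
Lemma energy_limit : 
  {ae leb1, forall t, t \in `]0, T[ -> 2 * I (ut t) (w t) <= G t} ->
  {ae leb1, forall t, t \in `]0, T[ -> forall e : R, 0 < e -> \forall n \near \oo,
    n.+1%:R * (x t - x (t - n.+1%:R^-1)
      - \int[leb1]_(s in `]t - n.+1%:R^-1, t]) gamma s) <= G t - gamma t + e}.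
Proof.
move: (bw) (but) (igamma) (gammaE) (aeg) => bw' but' ig gE aeg' hG.
have [sw _] := bw'.
have [tau tauP] := strongly_approximable_separable Omega oO T w setT sw (aeW _ (fun _ _ => Logic.I)).
have /choice[d dP] : forall j, exists d : R -> R, leb1.-integrable setT (EFin \o d) /\
    (sqi (w (tau j)) -> {ae leb1, forall t, t \in `]0, T[ -> I (ut t) (w (tau j)) = d t}).
  move=> j; have [sj|nsj] := pselect (sqi (w (tau j))).
    by have [d [_ h1 h2]] := bochner_L2_ip Omega oO T ut _ but' sj; exists d.
  by exists (fun=> 0); split=> //; exact: integrable0.
have aed : {ae leb1, forall t, forall j, t \in `]0, T[ -> sqi (w (tau j)) -> I (ut t) (w (tau j)) = d j t}.
  apply: ae_foralln => j; have [sj|nsj] := pselect (sqi (w (tau j))).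
    by have [_ h] := dP j; apply: ae_impl (h sj) => t h1 h2 h3; exact: h1.
  by apply: aeW.
have aea : {ae leb1, forall t, forall j,
    n.+1%:R * \int[leb1]_(s in `]t - n.+1%:R^-1, t]) d j s @[n --> \oo] --> d j t}.
  by apply: ae_foralln => j; apply: ae_cvg_left_average; have [] := dP j.
have aeda : {ae leb1, forall t, t \in `]0, T[ -> [/\ good t, sqi (ut t), I (ut t) (ut t) = gamma t
    & 2 * I (ut t) (w t) <= G t]}.
  have sut := bochner_L2_sqintegrable Omega T ut but'.
  have h12 : {ae leb1, forall t, t \in `]0, T[ -> good t /\ sqi (ut t)}.
    by apply: ae_impl2 aeg' sut => t h1 h2 tJ; split; [exact: h1|exact: h2].
  apply: ae_impl3 h12 gE hG => t h1 h2 h3 tJ; have [h4 h5] := h1 tJ.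
  by split; [exact: h4|exact: h5|exact: h2|exact: h3].
have aec := ae_cvg_left_average _ ig.
have ae_and (P Q : R -> Prop) : {ae leb1, forall t, P t} -> {ae leb1, forall t, Q t} ->
    {ae leb1, forall t, P t /\ Q t}.
  by move=> hP hQ; apply: ae_impl2 hP hQ => t h1 h2; exact: (conj h1 h2).
apply: ae_impl2 (ae_and _ _ (ae_and _ _ tauP aed) aea) (ae_and _ _ aec aeda).
move=> t [[h1 h2] h3] [cg h] tJ e e0.
have [gt_ sut gammat Gt] := h tJ.
have g0 : 0 <= gamma t by rewrite -gammat; exact: ip_ge0.
(* K is so large that K^-1 * gamma t <= e / 6, the + 1 covering gamma t = 0; w (tau j) is then taken
   so close to w t that K * m <= e / 6. *)
pose K := 6 * (gamma t + 1) / e.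
have K0 : 0 < K by rewrite /K divr_gt0// mulr_gt0// ltr_wpDl.
have eta0 : 0 < e / (6 * K) by rewrite divr_gt0// mulr_gt0.
have [j [_ sj] mj] := h1 tJ _ eta0.
set m := I _ _ in mj.
have m0 : 0 <= m by exact: ip_ge0.
have swt := gw _ gt_.
have swj := sqintegrableB mO _ _ swt sj.
have dj := h2 j tJ sj.
have Y : 2 * d j t <= 2 * I (ut t) (w t) + K * m + K^-1 * gamma t.
  have Y := ip_weighted_Young _ _ K K0 (sqintegrableZ mO (-1) _ sut) swj.
  rewrite (ipZl mO _ _ _ sut swj) (ipBr mO _ _ _ sut swt sj) dj -/m in Y.
  rewrite (ipZl mO _ _ _ sut (sqintegrableZ mO (-1) _ sut)) (ipZr mO _ _ _ sut sut) gammat in Y.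
  rewrite !mulN1r opprK in Y.
  by move: Y; move: (I (ut t) (w t)) (K * m) (K^-1 * gamma t) => A1 A2 A3 Y; lra.
have Km : K * m <= e / 6.
  apply: le_trans (ler_wpM2l (ltW K0) mj) _.
  rewrite le_eqVlt; apply/orP; left; apply/eqP; field.
  by rewrite gt_eqF.
have Kg : K^-1 * gamma t <= e / 6.
  rewrite /K invf_div mulrAC ler_pdivrMr; last by rewrite mulr_gt0// ltr_wpDl.
  rewrite mulrA -[e / 6 * 6]mulrA mulVf ?mulr1// ler_pM2l//; lra.
(* This is the bound of [energy_increment] times n + 1, minus the average of gamma; hence the
   coefficient K^-1 - 1. *)
pose z n := 2 * (n.+1%:R * \int[leb1]_(s in `]t - n.+1%:R^-1, t]) d j s)
  + (K^-1 - 1) * (n.+1%:R * \int[leb1]_(s in `]t - n.+1%:R^-1, t]) gamma s) + K * m.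
have cz : z n @[n --> \oo] --> 2 * d j t + (K^-1 - 1) * gamma t + K * m.
  apply: cvgD; last exact: cvg_cst.
  by apply: cvgD; apply: cvgM; [exact: cvg_cst|exact: h3|exact: cvg_cst|exact: cg].
(* K * m and K^-1 * gamma t each occur twice, once in z and once in Y; the total error is at most 4
   e / 6. *)
have lz : 2 * d j t + (K^-1 - 1) * gamma t + K * m < G t - gamma t + e.
  move: Y Km Kg Gt g0; rewrite mulrBl mul1r.
  by move: (K^-1 * gamma t) (K * m) (I (ut t) (w t)) (d j t) => A1 A2 A3 A4 *; lra.
have ht : \forall n \near \oo, n.+1%:R^-1 < t.
  have t0 : 0 < t by move: tJ; rewrite in_itv/= => /andP[].
  exact: (cvgr_lt 0 (@cvg_harmonic R) t t0).
have hz : \forall n \near \oo, z n < G t - gamma t + e.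
  by move: cz => /(cvgr_lt _); apply; exact: lz.
apply: (@filterS2 _ \oo eventually_filter _ _ _ _ ht hz) => n tn hzn.
apply: le_trans (ltW hzn).
have n0 : 0 < n.+1%:R^-1 :> R by rewrite invr_gt0 ltr0n.
have [s0 st tT] : [/\ 0 < t - n.+1%:R^-1, t - n.+1%:R^-1 < t & t < T].
  by move: tJ; rewrite in_itv/= => /andP[_ ?]; split=> //; [rewrite subr_gt0|rewrite ltrBlDr ltrDl].
have [ij dj'] := dP j.
have Z := energy_increment _ (d j) K _ t gt_ s0 st tT sj ij (dj' sj) K0.
rewrite -/m in Z.
have k0 : 0 < n.+1%:R :> R by rewrite ltr0n.
have E : n.+1%:R * (K * m * (t - (t - n.+1%:R^-1))) = K * m.
  by move: k0; move: (n.+1%:R : R) => k k0; field; rewrite gt_eqF.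
have := ler_wpM2l (ltW k0) Z; rewrite [leRHS]mulrDr E /z.
move: (n.+1%:R : R) (\int[_]_(_ in _) gamma _) (\int[_]_(_ in _) d j _) (x _ - x _) => k C1 C2 C3.
by move: (K * m) K^-1 => C4 C5 h'; lra.
Qed.

(** [integral_upper_derivative] is applied to x - P, P being the primitive of gamma, with majorant
    alpha and limit G - gamma; the subtracted integral of gamma is restored at the end. *)
Lemma energy_inequality a b : 0 < a -> a < b -> b < T ->
  measurable_fun `[a, b] G -> leb1.-integrable `[a, b] (EFin \o G) ->
  {ae leb1, forall t, t \in `]0, T[ -> 2 * I (ut t) (w t) <= G t} ->
  x b - x a <= \int[leb1]_(t in `[a, b]) G t.
Proof.
move: (bw) (but) (cx) (igamma) (malpha) (ialpha) (alphaE) (aeg) => bw' but' cx' ig ma ia aE aeg'.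
move=> a0 ab bT mG iG hG.
have T0 : 0 < T := lt_trans (lt_trans a0 ab) bT.
pose P t := \int[leb1]_(s in `[0, t]) gamma s.
have mab : measurable (`[a, b]%classic : set R) by exact: measurable_itv.
have mJ (t : R) : measurable (`[0, t]%classic : set R) by exact: measurable_itv.
have igJ t : leb1.-integrable `[0, t] (EFin \o gamma).
  by apply: (integrableS measurableT).
have PE s t : 0 <= s -> s <= t -> P t - P s = \int[leb1]_(r in `]s, t]) gamma r.
  by move=> s0 st; apply: Rintegral_itvB; [exact: igJ|rewrite bnd_simp|rewrite bnd_simp].
have cP t : t \in `]0, T[ -> {for t, continuous P}.
  have /(continuous_within_itvP _ T0)[h _ _] := parameterized_integral_continuous (ltW T0) (igJ T).
  exact: h.
have iga : leb1.-integrable `[a, b] (EFin \o gamma).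
  by apply: (integrableS measurableT).
have mg : measurable_fun `[a, b] gamma by have /measurable_int/measurable_EFinP := iga.
have -> : \int[leb1]_(t in `[a, b]) G t =
    \int[leb1]_(t in `[a, b]) (G t - gamma t) + (P b - P a).
  have -> : \int[leb1]_(t in `[a, b]) (G t - gamma t) =
      \int[leb1]_(t in `[a, b]) G t - \int[leb1]_(t in `[a, b]) gamma t by exact: RintegralB.
  rewrite PE ?(ltW a0) ?(ltW ab)// Rintegral_itv_obnd_cbnd ?subrK//.
  by apply: (integrableS measurableT).
rewrite -lerBlDr (_ : _ - _ - _ = (x b - P b) - (x a - P a)); last first.
  by rewrite !opprB !addrA; move: (x b) (P a) (P b) (x a) => *; ring.
have inJ t : t \in `[a, b] -> t \in `]0, T[.
  by rewrite !in_itv/= => /andP[h1 h2]; rewrite (lt_le_trans a0 h1) (le_lt_trans h2 bT).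
apply: (integral_upper_derivative (fun t => x t - P t) 0 T a b a0 ab bT _ alpha (fun t => G t - gamma t)).
- by move=> t tJ; apply: (@continuousB R R^o R x P t); [exact: cx'|exact: cP].
- exact: (measurable_funS measurableT).
- exact: measurable_funB.
- by apply: (integrableS measurableT).
- by have := @integrableB _ _ _ leb1 _ mab _ _ iG iga.
- apply: ae_impl2 aeg' aE => t gt_ at_ /inJ tJ s /andP[s0 st].
  have {}gt_ := gt_ tJ; have swt := gw _ gt_.
  have tT : t < T by move: tJ; rewrite in_itv/= => /andP[].
  have i0 : leb1.-integrable setT (EFin \o (fun=> 0 : R)) by exact: integrable0.
  have I0 : {ae leb1, forall r, r \in `]0, T[ -> I (ut r) (fun=> 0) = 0}.
    by apply: aeW => r _; exact: ip0r.
  (* With psi = 0 and K = 1 the increment bound is the integral of gamma plus (t - s) ||w t||^2: the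
     majorant of the quotients of x - P. *)
  have := energy_increment _ _ 1 s t gt_ s0 st tT sqintegrable0 i0 I0 ltr01.
  have -> : \int[leb1]_(r in `]s, t]) (fun=> 0 : R) r = 0 by rewrite /Rintegral integral0.
  rewrite -(PE s t (ltW s0) (ltW st)).
  have -> : (fun y => w t y - 0) = w t by apply/funext => y; rewrite subr0.
  rewrite (at_ tJ) invr1 mulr0 add0r !mul1r.
  by move: (x t) (x s) (P t) (P s) (alpha t * (t - s)) (mulrC (t - s) (alpha t)) => A1 A2 A3 A4 A5 ->; lra.
- apply: ae_impl (energy_limit hG) => t h /inJ tJ e e0.
  have t0 : 0 < t by move: tJ; rewrite in_itv/= => /andP[].
  have ht : \forall n \near \oo, n.+1%:R^-1 < t.
    exact: (cvgr_lt 0 (@cvg_harmonic R) t t0).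
  have hh := h tJ e e0.
  apply: (@filterS2 _ \oo eventually_filter _ _ _ _ ht hh) => n tn hn; move: hn.
  rewrite -PE ?subr_ge0 ?(ltW tn)//; last by rewrite lerBlDr lerDl invr_ge0.
  rewrite (_ : x t - x _ - _ = x t - P t - (x (t - n.+1%:R^-1) - P (t - n.+1%:R^-1)))//.
  by move: (x t) (x _) (P t) (P _) => *; ring.
Qed.

End Energy_inequality.

(** * Consequences of the regularity class of a solution *)

Section Time_regularity.
Context {R : realType} {N : nat}.
Variable Omega : set 'rV[R]_N.
Hypothesis oO : open Omega.
Notation mu := (leb R N).
Notation sqi := (sqintegrable mu (Omega : set (space R N))).
Notation I := (ip mu (Omega : set (space R N))).
Implicit Types (psi : 'rV[R]_N -> R) (u F : R -> 'rV[R]_N -> R) (T : R).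

Let mO : measurable (Omega : set (space R N)) := open_space_measurable _ oO.

Lemma L2_time_bochner T F : L2_time T (L2 Omega) (Lp_norm Omega 2) F -> bochner_L2 Omega T F.
Proof.
apply: (L2_time_map Omega oO T (L2 Omega) (Lp_norm Omega 2) (fun w => w) (fun w => I w w) 1) => //.
- by move=> w /(L2P Omega oO).
- by move=> w; exact: ip_ge0.
- by move=> w /(L2P Omega oO) sw; split; [exact: (L2_norm Omega oO _ sw)|rewrite mul1r].
move=> m c g z gX /(L2P Omega oO) sz.
have sg k : sqi (g k) by apply/(L2P Omega oO).
have E : (\sum_(k < m) c k *: g k - z) = fun x => \sum_(k < m) c k * g k x - z x.
  by apply/funext => x; rewrite /= fctE/= fct_sumE.
have s1 : sqi (fun x => \sum_(k < m) c k * g k x - z x).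
  apply: (sqintegrableB mO _ _ _ sz); apply: (sqintegrable_sum mO) => k.
  exact: (sqintegrableZ mO _ _ (sg k)).
by rewrite E; split; [exact: (L2_norm Omega oO _ s1)|rewrite mul1r].
Qed.

Lemma L2_time_bilap T u : L2_time T (Sobolev Omega 4) (Sobolev_norm Omega 4) u ->
  bochner_L2 Omega T (fun t => bilap Omega (u t)).
Proof.
have [C C0 hC] := bilap_le Omega oO.
apply: (L2_time_map Omega oO T (Sobolev Omega 4) (Sobolev_norm Omega 4) (bilap Omega)
  (sobolev_sq Omega 4) C u C0).
- by move=> w _; exact: (sqintegrable_bilap Omega oO).
- by move=> w; exact: sobolev_sq_ge0.
- by move=> w _; split; [exact: (Sobolev_normE Omega oO)|exact: hC].
move=> m c g z gX Xz; split; first exact: (Sobolev_normE Omega oO).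
by rewrite (ip_bilap_sumB Omega oO _ _ _ _ gX Xz); exact: hC.
Qed.

Section C_time.
Variables (T : R) (u : R -> 'rV[R]_N -> R).
Hypothesis cu : C_time T (W022 Omega) (W022_norm Omega) u.

Lemma C_time_lap t0 : t0 \in `[0, T] ->
  Num.sqrt (I (fun x => lap Omega (u t) x - lap Omega (u t0) x)
              (fun x => lap Omega (u t) x - lap Omega (u t0) x))
    @[t --> within `[0, T] (nbhs t0)] --> (0 : R).
Proof.
move=> t0T; have [Wu /(_ _ t0T) c0] := cu.
have c1 : Num.sqrt (I (lap Omega (u t - u t0)) (lap Omega (u t - u t0)))
    @[t --> within `[0, T] (nbhs t0)] --> (0 : R).
  move: c0; under eq_fun do rewrite (W022_normE Omega oO); exact: fine_cvg.
apply: cvg_trans c1; apply: near_eq_cvg.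
apply: filterS (withinT `[0, T] (nbhs_filter t0)) => t tT.
by congr Num.sqrt; apply: (ip_lapB Omega oO); [have [] := Wu t tT|have [] := Wu t0 t0T].
Qed.

Lemma C_time_ip psi : sqi psi -> {within `[0, T], continuous (fun t => I (lap Omega (u t)) psi)}.
Proof.
move=> sp; apply/subspace_continuousP => t0 t0T.
have c0 := C_time_lap t0 t0T.
pose n t := Num.sqrt (I (fun x => lap Omega (u t) x - lap Omega (u t0) x)
              (fun x => lap Omega (u t) x - lap Omega (u t0) x)).
pose a := Num.sqrt (I psi psi).
apply: (@squeeze_cvgr _ _ _ _ (fun t => I (lap Omega (u t0)) psi - n t * a)
   (fun t => I (lap Omega (u t0)) psi + n t * a)).
- apply: nearW => t; rewrite -ler_distl.
  have sl s := sqintegrable_lap Omega oO (u s).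
  rewrite -(ipBl mO _ _ _ sp (sl t) (sl t0)) /n /a -sqrtrM; last exact: ip_ge0.
  rewrite -sqrtr_sqr ler_sqrt; first exact: (ip_CauchySchwarz mO _ _ (sqintegrableB mO _ _ (sl t) (sl t0)) sp).
  by rewrite mulr_ge0//; exact: ip_ge0.
- rewrite -[X in _ --> X]subr0 -[X in _ - X](mul0r a).
  by apply: cvgB; [exact: cvg_cst|apply: cvgM; [exact: c0|exact: cvg_cst]].
- rewrite -[X in _ --> X]addr0 -[X in _ + X](mul0r a).
  by apply: cvgD; [exact: cvg_cst|apply: cvgM; [exact: c0|exact: cvg_cst]].
Qed.

Lemma C_time_ip_lap :
  {within `[0, T], continuous (fun t => I (lap Omega (u t)) (lap Omega (u t)))}.
Proof.
apply/subspace_continuousP => t0 t0T.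
have sl s := sqintegrable_lap Omega oO (u s).
have c0 := C_time_lap t0 t0T.
have /subspace_continuousP/(_ _ t0T) c1 := C_time_ip _ (sl t0).
pose n t := Num.sqrt (I (fun x => lap Omega (u t) x - lap Omega (u t0) x)
              (fun x => lap Omega (u t) x - lap Omega (u t0) x)).
set l := I (lap Omega (u t0)) (lap Omega (u t0)).
(* Continuity of the squared norm from ||a||^2 = ||a - b||^2 + 2 (a, b) - ||b||^2. *)
have main l' : l' = 0 * 0 + 2 * l - l -> n t * n t + 2 * I (lap Omega (u t)) (lap Omega (u t0)) - l
    @[t --> within `[0, T] (nbhs t0)] --> l'.
  move=> ->; apply: cvgB; last exact: cvg_cst.
  by apply: cvgD; apply: cvgM; [exact: c0|exact: c0|exact: cvg_cst|exact: c1].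
have E : l = 0 * 0 + 2 * l - l by move: (l) => k; ring.
apply: cvg_trans (main l E); apply: near_eq_cvg; apply: nearW => t.
rewrite -expr2 /n sqr_sqrtr; last exact: ip_ge0.
rewrite (ipB_sqr Omega oO _ _ (sl t) (sl t0)) -/l.
by rewrite /from_subspace; move: (I (lap Omega (u t)) (lap Omega (u t))) (I (lap Omega (u t)) (lap Omega (u t0))) (l) => A1 A2 A3; ring.
Qed.

End C_time.

End Time_regularity.

Section Equation_energy.
Context {R : realType} {N : nat}.
Variable Omega : set 'rV[R]_N.
Hypothesis oO : open Omega.
Notation mu := (leb R N).
Notation sqi := (sqintegrable mu (Omega : set (space R N))).
Notation I := (ip mu (Omega : set (space R N))).
Notation leb1 := (@lebesgue_measure R).

Let mO : measurable (Omega : set (space R N)) := open_space_measurable _ oO.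

(** Green's formula with Lap z in the place of z. It is used at two different times: u s is in
    W_0^{2,2} for every s, while u t is in W^{4,2} for almost every t. *)
Lemma ip_bilap w z : W022 Omega w -> Sobolev Omega 4 z ->
  I w (bilap Omega z) = I (lap Omega w) (lap Omega z).
Proof.
move=> Ww Sz; have [wl aeE] := weak_laplacian_bilap Omega oO z Sz.
have [[/(L2P Omega oO) [mw _] _] _] := Ww.
rewrite (ip_lap_W022 Omega oO _ _ _ Ww wl (sqintegrable_lap Omega oO z)).
have [ml _] := sqintegrable_lap Omega oO (lap Omega z).
have [mb _] := sqintegrable_bilap Omega oO z.
apply: (eq_ip_ae mO _ _ _ _ mw mw mb ml); first by apply: aeW.
by apply: ae_impl aeE => x h Ox; rewrite h.
Qed.

Lemma solves_energy_inequality (tstar : R) (delta h k : R -> R) (F u : R -> 'rV[R]_N -> R)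
    (u0 : 'rV[R]_N -> R) (e1 e2 g : R -> R) (B a b : R) :
  solves Omega tstar delta h k F u0 u ->
  (forall t, t \in `]0, tstar[ -> [/\ 0 < h t, 0 < k t, 0 < e1 t & 0 < e2 t]) ->
  (forall t, t \in `]0, tstar[ -> h t / e2 t + k t / e1 t = 2 * delta t) ->
  (forall t, t \in `]0, tstar[ -> h t * e2 t <= B) ->
  {ae leb1, forall t, t \in `]0, tstar[ -> sqi (F t) -> k t * e1 t * I (F t) (F t) <= g t} ->
  (forall t, t \in `]0, tstar[ -> {for t, continuous g}) ->
  0 < a -> a < b -> b < tstar ->
  I (lap Omega (u b)) (lap Omega (u b)) - I (lap Omega (u a)) (lap Omega (u a)) <=
  \int[leb1]_(t in `[a, b]) (B * I (lap Omega (u t)) (lap Omega (u t)) + g t).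
Proof.
move=> [ut [reg eqn _]] pos edelta hB hF cg a0 ab bs.
(* The regularity of u is given on [0, T] for T < tstar only; this T keeps b inside ]0, T[. *)
pose T := (b + tstar) / 2.
have bT : b < T by rewrite /T; lra.
have Ts : T < tstar by rewrite /T; lra.
have T0 : 0 < T by exact: lt_trans (lt_trans a0 ab) bT.
have [cu bu [_ but weak] bF] := reg T (introT andP (conj T0 Ts)).
have {}but := L2_time_bochner Omega oO _ _ but.
have {}bF := L2_time_bochner Omega oO _ _ bF.
have bw := L2_time_bilap Omega oO _ _ bu.
have [aeu _ _] := bu.
have [_ [alpha [malpha _ ialpha alphaE]]] := bw.
have [_ [gamma [mgamma _ igamma gammaE]]] := but.
pose x t := I (lap Omega (u t)) (lap Omega (u t)).
pose w t := bilap Omega (u t).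
pose good t := (t \in `]0, T[) /\ Sobolev Omega 4 (u t).
have [Wu _] := cu.
have JT t : t \in `]0, T[ -> t \in `[0, T].
  by rewrite !in_itv/= => /andP[? ?]; rewrite !ltW.
have Js t : t \in `]0, T[ -> t \in `]0, tstar[.
  by rewrite !in_itv/= => /andP[-> tT]; exact: lt_trans tT Ts.
have sl t := sqintegrable_lap Omega oO (u t).
have sw t : sqi (w t) := sqintegrable_bilap Omega oO (u t).
have uw s t : s \in `]0, T[ -> good t -> I (u s) (w t) = I (lap Omega (u s)) (lap Omega (u t)).
  by move=> sJ [_ St]; exact: (ip_bilap _ _ (Wu _ (JT _ sJ)) St).
have cx t : t \in `]0, T[ -> {for t, continuous x}.
  have /(continuous_within_itvP _ T0)[cx _ _] := C_time_ip_lap Omega oO _ _ cu.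
  exact: cx.
have aeg : {ae leb1, forall t, t \in `]0, T[ -> good t}.
  by apply: ae_impl aeu => t ut_ tJ; split; [exact: tJ|exact: ut_].
have gx t s : good t -> t \in `]0, T[ -> s \in `]0, T[ ->
    x t - x s <= 2 * (I (u t) (w t) - I (u s) (w t)).
  move=> gt_ tJ sJ; rewrite (uw t t tJ gt_) (uw s t sJ gt_).
  (* Convexity of the squared norm: 2 (Lap u s, Lap u t) <= x s + x t. *)
  have := ip_Young mO _ _ (sl s) (sl t); rewrite /x.
  by move: (I _ _) (I _ _) (I _ _) => A1 A2 A3 *; lra.
have gc s : good s -> forall t, t \in `]0, T[ -> {for t, continuous (fun r => I (u r) (w s))}.
  move=> gs t tJ.
  have /(continuous_within_itvP _ T0)[/(_ t tJ) ct _ _] := C_time_ip Omega oO _ _ cu _ (sl s).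
  rewrite /prop_for /continuous_at (uw t s tJ gs).
  apply: cvg_trans ct; apply: near_eq_cvg; have := near_in_itvoo tJ.
  by apply: filterS => r rJ; rewrite (uw r s rJ gs).
pose G t := B * x t + g t.
have cG : {within `[a, b], continuous G}.
  apply: continuous_in_subspaceT => t; rewrite inE/= in_itv/= => /andP[h1 h2].
  have tJ : t \in `]0, T[ by rewrite in_itv/= (lt_le_trans a0 h1) (le_lt_trans h2 bT).
  apply: (@continuousD R R^o R (fun t => B * x t) g t); last exact: cg (Js _ tJ).
  by apply: (@continuousM R R (cst B) x t); [exact: cst_continuous|exact: cx].
have iG : leb1.-integrable `[a, b] (EFin \o G).
  by apply: continuous_compact_integrable; [exact: segment_compact|exact: cG].
have mG : measurable_fun `[a, b] G by have /measurable_int/measurable_EFinP := iG.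
apply: (energy_inequality Omega oO T u w ut x G alpha gamma good bw but cx aeg (fun t _ => sw t)
  gx gc weak igamma gammaE malpha ialpha alphaE a b a0 ab bT mG iG).
have sut := bochner_L2_sqintegrable Omega T ut but.
have sF := bochner_L2_sqintegrable Omega T F bF.
have aeFu : {ae leb1, forall t, t \in `]0, T[ -> sqi (ut t) /\ sqi (F t)}.
  by apply: ae_impl2 sut sF => t h1 h2 tJ; split; [exact: h1|exact: h2].
have aegF : {ae leb1, forall t, t \in `]0, T[ -> [/\ good t, sqi (ut t), sqi (F t)
    & k t * e1 t * I (F t) (F t) <= g t]}.
  apply: ae_impl3 aeg aeFu hF => t h1 h2 h3 tJ; have [h4 h5] := h2 tJ.
  by split; [exact: h1|exact: h4|exact: h5|exact: h3 (Js _ tJ) h5].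
apply: ae_impl2 eqn aegF => t E H tJ.
have [gt_ sutt sFt Fg] := H tJ; have {}E := E (Js _ tJ).
have [h0 k0 e10 e20] := pos t (Js _ tJ); have ed := edelta t (Js _ tJ); have hBt := hB t (Js _ tJ).
have [_ St] := gt_; have [_ aeE] := weak_laplacian_bilap Omega oO (u t) St.
have skF := sqintegrableZ mO (k t) _ sFt; have shl := sqintegrableZ mO (h t) _ (sl t).
have sdw := sqintegrableZ mO (delta t) _ (sw t).
have s1 := sqintegrableD mO _ _ skF shl; have s2 := sqintegrableB mO _ _ s1 sdw.
(* The equation, with the iterated Laplacian replaced by [bilap]. *)
have -> : I (ut t) (w t) = I (fun y => k t * F t y + h t * lap Omega (u t) y - delta t * w t y) (w t).
  have [m1 _] := sutt; have [m2 _] := sw t; have [m3 _] := s2.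
  apply: (eq_ip_ae mO _ _ _ _ m1 m3 m2 m2); last by apply: aeW.
  apply: ae_impl2 E aeE => y Ey wy Oy; have := Ey Oy; rewrite (wy Oy) -/(w t y).
  by move: (ut t y) (k t * F t y) (delta t * w t y) (h t * _) => A1 A2 A3 A4 *; lra.
rewrite (ipBl mO _ _ _ (sw t) s1 sdw) (ipDl mO _ _ _ (sw t) skF shl).
rewrite (ipZl mO _ _ _ sFt (sw t)) (ipZl mO _ _ _ (sl t) (sw t)) (ipZl mO _ _ _ (sw t) (sw t)).
(* The weights are such that the terms k / e1 ||w||^2 and h / e2 ||w||^2 cancel 2 delta ||w||^2
   exactly, leaving k e1 ||F||^2 and h e2 x. *)
have Y1 := ip_weighted_Young Omega oO _ _ (e1 t) e10 (sw t) sFt.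
have Y2 := ip_weighted_Young Omega oO _ _ (e2 t) e20 (sw t) (sl t).
rewrite ipC in Y1; rewrite ipC in Y2.
have Z1 := ler_wpM2l (ltW k0) Y1; have Z2 := ler_wpM2l (ltW h0) Y2.
have x0 : 0 <= x t by exact: ip_ge0.
have Z3 := ler_wpM2r x0 hBt.
rewrite /G; rewrite -/(x t) in Z2.
move: Z1 Z2 Z3 Fg ed.
move: (I (F t) (w t)) (I (lap Omega (u t)) (w t)) (I (w t) (w t)) (I (F t) (F t)) (x t) => A1 A2 A3 A4 A5.
move=> Z1 Z2 Z3 Fg ed.
have ed' : h t / e2 t * A3 + k t / e1 t * A3 = 2 * delta t * A3 by rewrite -mulrDl ed.
have ed2 : k t * ((e1 t)^-1 * A3) = k t / e1 t * A3 by rewrite mulrA.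
have ed3 : h t * ((e2 t)^-1 * A3) = h t / e2 t * A3 by rewrite mulrA.
rewrite mulrDr ed2 !mulrA in Z1; rewrite mulrDr ed3 !mulrA in Z2.
move: ed' Z1 Z2 Z3 Fg.
move: (h t / e2 t * A3) (k t / e1 t * A3) (k t * e1 t * A4) (h t * e2 t * A5) => C1 C2 C3 C4.
lra.
Qed.

End Equation_energy.

(** * Differential inequalities and the blow-up time *)

Section Power_source.
Context {R : realType} {N : nat}.
Variable Omega : set 'rV[R]_N.
Hypothesis oO : open Omega.
Notation mu := (leb R N).
Notation sqi := (sqintegrable mu (Omega : set (space R N))).
Notation I := (ip mu (Omega : set (space R N))).

Let mO : measurable (Omega : set (space R N)) := open_space_measurable _ oO.

(** The integral of f(v)^2 is at most that of |v|^(2p), which is the 2p-th power of the norm bounded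
    by the Sobolev inequality. *)
Lemma ip_power_source_le (v : 'rV[R]_N -> R) (f : R -> R) (p S : R) : 0 < p -> 0 <= S ->
  nonneg_ae Omega v -> (forall s, 0 <= s -> 0 <= f s <= s `^ p) -> sqi (fun x => f (v x)) ->
  (Lp_norm Omega (2 * p) v <= S%:E * W022_norm Omega v)%E ->
  I (fun x => f (v x)) (fun x => f (v x)) <=
  S `^ (2 * p) * I (lap Omega v) (lap Omega v) `^ p.
Proof.
move=> p0 S0 v0 hf sf; rewrite (W022_normE Omega oO) -EFinM.
set y := I (lap Omega v) (lap Omega v).
have y0 : 0 <= y by exact: ip_ge0.
have p20 : 2 * p != 0 by rewrite gt_eqF// mulr_gt0.
rewrite /Lp_norm unlock /Lnorm.
set X := (\int[mu]_x _)%E => hX.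
have X0 : (0 <= X)%E by apply: integral_ge0 => x _; exact: poweR_ge0.
have XS : (X <= (S `^ (2 * p) * y `^ p)%:E)%E.
  have -> : X = ((X `^ (2 * p)^-1) `^ (2 * p))%E by rewrite -poweRrM mulVf// poweRe1.
  have -> : (S `^ (2 * p) * y `^ p)%:E = ((S * Num.sqrt y)%:E `^ (2 * p))%E.
    rewrite poweR_EFin powRM ?sqrtr_ge0// -(powR12_sqrt y0) -powRrM mulrA mulVf ?mul1r//.
  apply: gt0_ler_poweR => //.
  - by rewrite mulr_ge0// ltW.
  - by rewrite in_itv/= poweR_ge0 leey.
  - by rewrite in_itv/= leey andbT lee_fin mulr_ge0// sqrtr_ge0.
rewrite -lee_fin; apply: le_trans XS.
have sff : mu.-integrable Omega (fun x => (f (v x) * f (v x))%:E) := sqintegrableM mO _ _ sf sf.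
have -> : (I (fun x => f (v x)) (fun x => f (v x)))%:E =
    (\int[mu]_(x in (Omega : set (space R N))) (f (v x) * f (v x))%:E)%E.
  by rewrite /ip /Rintegral fineK//; exact: integrable_fin_num.
have -> : X = (\int[mu]_(x in (Omega : set (space R N))) (`|v x| `^ (2 * p))%:E)%E.
  rewrite /X [RHS]integral_mkcond; apply: eq_integral => x _ /=.
  by rewrite /patch; case: ifPn => _//; rewrite normr0 powR0.
apply: ge0_ae_le_integral; first exact: mO.
- by move=> x _; rewrite lee_fin -expr2 sqr_ge0.
- by move=> x _; rewrite lee_fin powR_ge0.
apply: ae_impl v0 => x h Ox; have vx := h Ox; have /andP[f0 fp] := hf _ vx.
rewrite lee_fin (ger0_norm vx) (mulrC 2 p) powRrM powR_mulrn ?powR_ge0// expr2.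
exact: ler_pM.
Qed.

End Power_source.

Section Real_powers.
Context {R : realType}.
Implicit Types (x y p t : R).

(** Where y is positive the power is differentiable; at a zero of y it is squeezed between 0 and y,
    since a^p <= a for 0 <= a <= 1. *)
Lemma continuous_powR_comp (y : R -> R) p t : 1 <= p -> (forall s, 0 <= y s) ->
  {for t, continuous y} -> {for t, continuous (fun s => y s `^ p)}.
Proof.
move=> p1 y0 cy; have p0 : 0 < p := lt_le_trans ltr01 p1.
have := y0 t; rewrite le_eqVlt => /predU1P[yt|yt]; last first.
  apply: (@continuous_comp _ _ _ y (fun a => a `^ p)); first exact: cy.
  apply: differentiable_continuous; apply/derivable1_diffP; apply: derivable_powR.
  by rewrite in_itv/= yt.
rewrite /prop_for /continuous_at -yt powR0 ?gt_eqF//.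
have cy0 : y s @[s --> t] --> (0 : R) by rewrite [X in _ --> X]yt; exact: cy.
apply: (@squeeze_cvgr _ _ _ _ (fun=> 0) y); [|exact: cvg_cst|exact: cy0].
have ltr : \forall s \near t, y s < 1 by move: cy0 => /(cvgr_lt 0)/(_ 1 ltr01).
apply: filterS ltr => s s1; rewrite powR_ge0/=.
have := y0 s; rewrite le_eqVlt => /predU1P[<-|ys]; first by rewrite powR0// gt_eqF.
by apply: ge1r_powR p1; rewrite ys ltW.
Qed.

(** Source of the factor P0^(q-p) in A: it raises the exponent q to p, since P0 <= Phi = x + y gives
    P0^(p-q) x^q <= x Phi^(p-1). Likewise y^p <= y Phi^(p-1), and the two bounds add up to Phi^p. *)
Lemma powR_sum_le x y p q (K1 K2 A P0 : R) : 1 < q -> q <= p -> 0 <= x -> 0 <= y ->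
  0 < P0 -> P0 <= x + y -> K2 * P0 `^ (q - p) <= A -> K1 <= A -> 0 <= A ->
  K2 * x `^ q + K1 * y `^ p <= A * (x + y) `^ p.
Proof.
move=> q1 qp x0 y0 P00 Pxy hK2 hK1 A0.
set Phi := x + y; have Phi0 : 0 < Phi := lt_le_trans P00 Pxy.
have p1 : 1 < p := lt_le_trans q1 qp.
have xP : x <= Phi by rewrite lerDl.
have yP : y <= Phi by rewrite lerDr.
have mono a (r : R) : 0 <= a -> a <= Phi -> 0 <= r -> a `^ r <= Phi `^ r.
  by move=> a0 aP r0; apply: ge0_ler_powR => //; rewrite nnegrE// ltW.
have hx : K2 * x `^ q <= A * (x * Phi `^ (p - 1)).
  have -> : K2 * x `^ q = (K2 * P0 `^ (q - p)) * (P0 `^ (p - q) * x `^ q).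
    rewrite mulrA -(mulrA K2) -powRD; last by rewrite (gt_eqF P00) implybT.
    by rewrite (_ : q - p + (p - q) = 0) ?powRr0 ?mulr1//; ring.
  apply: le_trans (ler_wpM2r _ hK2) _; first by rewrite mulr_ge0// powR_ge0.
  apply: ler_wpM2l => //; rewrite -(mulr_powRB1 x0 (lt_trans ltr01 q1)) mulrCA.
  apply: ler_wpM2l => //.
  have -> : p - 1 = (p - q) + (q - 1) by ring.
  rewrite (@powRD _ Phi (p - q) (q - 1)); last by rewrite (gt_eqF Phi0) implybT.
  apply: ler_pM; rewrite ?powR_ge0//; last by apply: mono; rewrite // subr_ge0 ltW.
  by apply: ge0_ler_powR; rewrite ?nnegrE ?subr_ge0 ?(ltW P00) ?(ltW Phi0).
have hy : K1 * y `^ p <= A * (y * Phi `^ (p - 1)).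
  apply: le_trans (ler_wpM2r (powR_ge0 _ _) hK1) _.
  rewrite -(mulr_powRB1 y0 (lt_trans ltr01 p1)); apply: ler_wpM2l => //; apply: ler_wpM2l => //.
  by apply: mono; rewrite // subr_ge0 ltW.
apply: le_trans (lerD hx hy) _.
by rewrite -mulrDr -mulrDl -/Phi mulr_powRB1 ?(ltW Phi0)// (lt_trans ltr01 p1).
Qed.

Lemma powR_sum_lt x y p : 1 < p -> 0 < x -> 0 < y -> x `^ p + y `^ p < (x + y) `^ p.
Proof.
move=> p1 x0 y0; have p0 := lt_trans ltr01 p1; have s0 := addr_gt0 x0 y0.
rewrite -(mulr_powRB1 (ltW x0) p0) -(mulr_powRB1 (ltW y0) p0) -(mulr_powRB1 (ltW s0) p0).
have pm : 0 < p - 1 by rewrite subr_gt0.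
rewrite mulrDl; apply: ltrD; rewrite ltr_pM2l//; apply: gt0_ltr_powR => //;
  by rewrite ?nnegrE ?(ltW x0) ?(ltW y0) ?(ltW s0) ?ltrDl ?ltrDr.
Qed.

End Real_powers.

Section Superlinear_growth.
Context {R : realType}.
Notation leb1 := (@lebesgue_measure R).
Implicit Types (Phi : R -> R) (B C p s r t l u : R).

(* With Psi(t) = Phi(s) + int_s^t (B Phi + C Phi^p) >= Phi(t), the function
   exp(B (p - 1) t) (Psi^(1-p) + C/B) is nondecreasing. *)
Lemma superlinear_growth Phi B C p l u s r : l < s -> s < r -> r < u -> 0 < B -> 0 <= C -> 1 < p ->
  (forall t, 0 <= Phi t) -> (forall t, t \in `]l, u[ -> {for t, continuous Phi}) ->
  (forall t, t \in `[s, r] -> 0 < Phi t) ->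
  (forall t, s < t <= r ->
    Phi t - Phi s <= \int[leb1]_(v in `[s, t]) (B * Phi v + C * Phi v `^ p)) ->
  Phi s `^ (1 - p) + C / B <= expR (B * (p - 1) * (r - s)) * (Phi r `^ (1 - p) + C / B).
Proof.
move=> ls sr ru B0 C0 p1 Phi0 cPhi Phi_gt0 hPhi.
pose f t := B * Phi t + C * Phi t `^ p.
have cf t : t \in `]l, u[ -> {for t, continuous f}.
  move=> tJ; apply: (@continuousD R R^o R (fun t => B * Phi t) (fun t => C * Phi t `^ p) t).
    by apply: (@continuousM R R (cst B) Phi t); [exact: cst_continuous|exact: cPhi].
  apply: (@continuousM R R (cst C) (fun t => Phi t `^ p) t); first exact: cst_continuous.
  by apply: continuous_powR_comp; [exact: ltW|exact: Phi0|exact: cPhi].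
have srJ t : t \in `[s, r] -> t \in `]l, u[.
  by rewrite !in_itv/= => /andP[h1 h2]; rewrite (lt_le_trans ls h1) (le_lt_trans h2 ru).
have cfsr : {within `[s, r], continuous f}.
  by apply: continuous_in_subspaceT => t; rewrite inE/= => /srJ; exact: cf.
have isr : leb1.-integrable `[s, r] (EFin \o f).
  by apply: continuous_compact_integrable; [exact: segment_compact|exact: cfsr].
pose Psi t := Phi s + \int[leb1]_(v in `[s, t]) f v.
have Psis : Psi s = Phi s by rewrite /Psi set_itv1 Rintegral_set1 addr0.
have PhiPsi t : t \in `[s, r] -> Phi t <= Psi t.
  rewrite in_itv/= => /andP[]; rewrite le_eqVlt => /predU1P[<- _|st tr]; first by rewrite Psis.
  by rewrite -lerBlDl; apply: hPhi; rewrite st.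
have Psi_gt0 t : t \in `[s, r] -> 0 < Psi t.
  by move=> tJ; apply: lt_le_trans (PhiPsi t tJ); exact: Phi_gt0.
have cPsi : {within `[s, r], continuous Psi}.
  move=> t; apply: (@continuousD R R^o (subspace `[s, r]) (cst (Phi s)) (fun t => \int[leb1]_(v in `[s, t]) f v) t).
    exact: cst_continuous.
  exact: (parameterized_integral_continuous (ltW sr) isr).
have dPsi t : t \in `]s, r[ -> is_derive t (1 : R) Psi (f t).
  move=> tJ; have tJ' : t \in `]l, u[ by apply: srJ; move: tJ; rewrite !in_itv/= => /andP[? ?]; rewrite !ltW.
  move: tJ; rewrite in_itv/= => /andP[st tr].
  have [d1 d2] := continuous_FTC1_closed tr isr st (cf t tJ').
  have dF : is_derive t (1 : R) (fun x => \int[leb1]_(v in `[s, x]) f v) (f t).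
    exact: (DeriveDef d1 (etrans (esym (derive1E _ _)) d2)).
  by have := is_deriveD (is_derive_cst (Phi s) t (1 : R)) dF; rewrite add0r.
(* Psi^(1-p), in a form to which the chain rule for [expR] and [ln] applies. *)
pose V t := expR ((1 - p) * ln (Psi t)).
pose W t := expR (B * (p - 1) * t).
pose Z t := W t * (V t + C / B).
have cZ : {within `[s, r], continuous Z}.
  apply/subspace_continuousP => t tJ.
  have /subspace_continuousP/(_ t tJ) c1 := cPsi.
  have c2 : ln (Psi v) @[v --> within `[s, r] (nbhs t)] --> ln (Psi t).
    exact: (cvg_comp _ _ c1 (continuous_ln (Psi_gt0 t tJ))).
  have c3 : V v @[v --> within `[s, r] (nbhs t)] --> V t.
    have c2' : (1 - p) * ln (Psi v) @[v --> within `[s, r] (nbhs t)] --> (1 - p) * ln (Psi t).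
      by apply: cvgM; [exact: cvg_cst|exact: c2].
    exact: (cvg_comp _ _ c2' (@continuous_expR R ((1 - p) * ln (Psi t)))).
  have c4 : W v @[v --> within `[s, r] (nbhs t)] --> W t.
    have c4' : B * (p - 1) * v @[v --> within `[s, r] (nbhs t)] --> B * (p - 1) * t.
      by apply: cvgM; [exact: cvg_cst|exact: cvg_within].
    exact: (cvg_comp _ _ c4' (@continuous_expR R (B * (p - 1) * t))).
  by apply: cvgM; [exact: c4|apply: cvgD; [exact: c3|exact: cvg_cst]].
have dZ t : t \in `]s, r[ -> is_derive t (1 : R) Z
    (W t * (V t * ((1 - p) * ((Psi t)^-1 * f t))) + W t * (B * (p - 1)) * (V t + C / B)).
  move=> tJ; have tJ' : t \in `[s, r] by move: tJ; rewrite !in_itv/= => /andP[? ?]; rewrite !ltW.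
  have d1 := is_derive1_comp (is_derive1_ln (Psi_gt0 t tJ')) (dPsi t tJ).
  have d2 := is_derive1_comp (is_derive_expR _) (is_deriveZ (1 - p) d1).
  have d3 := is_derive1_comp (is_derive_expR _) (is_deriveZ (B * (p - 1)) (is_derive_id t (1 : R))).
  have := is_deriveM d3 (is_deriveD d2 (is_derive_cst (C / B) t (1 : R))).
  rewrite addr0 => d4; apply: (is_derive_eq d4).
  have scE (a b : R) : a *: (b : R^o) = a * b by [].
  rewrite !scE /W /V /= -[X in _ + X * _ = _]/(expR ((1 - p) * ln (Psi t)) + C / B) !scE.
  by move: (expR (B * (p - 1) * t)) (expR ((1 - p) * ln (Psi t))) (C / B) => *; ring.
have dZ0 t : t \in `]s, r[ -> 0 <= Z^`()%classic t.
  move=> tJ; rewrite derive1E; have [_ ->] := dZ t tJ.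
  have tJ' : t \in `[s, r] by move: tJ; rewrite !in_itv/= => /andP[? ?]; rewrite !ltW.
  have P0 := Psi_gt0 t tJ'; have PP := PhiPsi t tJ'.
  have V0 : 0 < V t by exact: expR_gt0.
  have W0 : 0 < W t by exact: expR_gt0.
  (* Psi' = f t is bounded by the same expression in Psi because Phi <= Psi; Psi, unlike Phi, is
     known to be differentiable. *)
  have fP : f t <= B * Psi t + C * Psi t `^ p.
    apply: lerD; apply: ler_wpM2l; [exact: ltW|exact: PP|exact: C0|].
    by apply: ge0_ler_powR; rewrite ?nnegrE ?(ltW P0)// ltW// (lt_trans ltr01).
  have E : V t * ((Psi t)^-1 * Psi t `^ p) = 1.
    rewrite -{1}(lnK P0) -expRN /powR (gt_eqF P0) -!expRD.
    by rewrite (_ : _ + _ = 0) ?expR0//; move: (ln _) => *; ring.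
  have fV : V t * ((Psi t)^-1 * f t) <= V t * B + C.
    have i0 : 0 < (Psi t)^-1 by rewrite invr_gt0.
    have h := ler_wpM2l (ltW (mulr_gt0 V0 i0)) fP.
    rewrite mulrA; apply: le_trans h _; rewrite mulrDr.
    have -> : V t / Psi t * (B * Psi t) = V t * B by field; rewrite gt_eqF.
    by rewrite mulrCA -mulrA E mulr1.
  rewrite (_ : _ + _ = W t * (p - 1) * (B * V t + C - V t * ((Psi t)^-1 * f t))); last first.
    by field; rewrite ?gt_eqF.
  apply: mulr_ge0; first by rewrite mulr_ge0 ?(ltW W0)// subr_ge0 ltW.
  by rewrite subr_ge0 (mulrC B).
have sJ : s \in `[s, r] by rewrite in_itv/= lexx ltW.
have rJ : r \in `[s, r] by rewrite in_itv/= lexx ltW.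
have dfZ t : t \in `]s, r[ -> derivable Z t 1 by move=> /dZ[].
have ZZ : Z s <= Z r := ger0_derive1_le_cc dfZ dZ0 cZ sJ rJ (ltW sr).
have Vs : V s = Phi s `^ (1 - p) by rewrite /V Psis /powR gt_eqF// Phi_gt0.
(* The exponent 1 - p is negative, so Phi <= Psi gives the right direction at r; at s the two
   functions coincide. *)
have Vr : V r <= Phi r `^ (1 - p).
  rewrite /V /powR gt_eqF ?Phi_gt0// ler_expR ler_wnM2l ?subr_le0 ?(ltW p1)//.
  by rewrite ler_ln ?posrE ?Psi_gt0 ?Phi_gt0// PhiPsi.
rewrite -Vs -(ler_pM2l (expR_gt0 (B * (p - 1) * s))) mulrA -expRD.
rewrite (_ : B * (p - 1) * s + _ = B * (p - 1) * r); last by ring.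
by apply: le_trans ZZ _; rewrite /Z ler_wpM2l ?expR_ge0// lerD2r.
Qed.

End Superlinear_growth.

Section Blow_up.
Context {R : realType}.
Notation leb1 := (@lebesgue_measure R).
Implicit Types (Phi x y : R -> R) (B C p s r t : R).

Lemma blowup_limit Phi B C p s ts (X : R) : 0 < B -> 0 <= C -> 1 < p -> s < ts ->
  Phi t @[t --> ts^'-] --> +oo ->
  (forall r, s < r -> r < ts -> X <= expR (B * (p - 1) * (r - s)) * (Phi r `^ (1 - p) + C / B)) ->
  X <= expR (B * (p - 1) * (ts - s)) * (C / B).
Proof.
move=> B0 C0 p1 sts cPhi H.
set E := expR (B * (p - 1) * (ts - s)); have E0 : 0 < E by exact: expR_gt0.
have pm : 0 < p - 1 by rewrite subr_gt0.
apply/ler_addgt0Pr => e e0.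
have eE : 0 < E / e by rewrite divr_gt0.
(* Chosen so that Phi r >= M means Phi r^(1-p) <= e / E; a single r near ts is then enough. *)
pose M := (E / e) `^ (p - 1)^-1.
have M0 : 0 < M by exact: powR_gt0.
have ME : M `^ (p - 1) = E / e by rewrite /M -powRrM mulVf ?gt_eqF// powRr1// ltW.
have /cvgryPge/(_ M) n1 := cPhi.
have [r [[sr rts] Mr]] : exists r, (s < r /\ r < ts) /\ M <= Phi r.
  have [r h] := filter_ex (filterI (filterI (nbhs_left_gt sts) (nbhs_left_lt ts)) n1).
  by exists r; move: h => [[h1 h2] h3].
apply: le_trans (H r sr rts) _.
have P0 : 0 < Phi r := lt_le_trans M0 Mr.
have CB : 0 <= C / B by rewrite divr_ge0// ltW.
have hP : Phi r `^ (1 - p) <= e / E.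
  rewrite (_ : 1 - p = - (p - 1)); last by rewrite opprB.
  rewrite powRN -(invf_div E e) -ME lef_pV2 ?posrE ?powR_gt0//.
  by apply: ge0_ler_powR; rewrite ?nnegrE ?(ltW pm) ?(ltW M0) ?(ltW P0).
apply: (@le_trans _ _ (E * (e / E + C / B))); last first.
  by rewrite mulrDr mulrCA divff ?gt_eqF// mulr1 addrC.
apply: ler_pM; rewrite ?expR_ge0 ?addr_ge0 ?powR_ge0// ?lerD2r//.
by rewrite ler_expR ler_wpM2l ?mulr_ge0 ?(ltW B0) ?(ltW pm)// lerD2r ltW.
Qed.

(** Blow-up keeps the sublevel set away from ts, so its supremum is below ts. Continuity puts a
    positive supremum in the set; a supremum 0 is there by the hypothesis at 0. *)
Lemma last_sublevel_time Phi ts (P0 : R) : 0 < ts -> Phi 0 <= P0 ->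
  (forall t, t \in `]0, ts[ -> {for t, continuous Phi}) -> Phi t @[t --> ts^'-] --> +oo ->
  exists t1, [/\ 0 <= t1, t1 < ts, Phi t1 <= P0 & forall t, t1 < t -> t < ts -> P0 < Phi t].
Proof.
move=> ts0 P00 cPhi blow.
pose S := [set t | 0 <= t < ts /\ Phi t <= P0].
have /cvgryPge/(_ (P0 + 1)) [e /= e0 he] := blow.
have S0 : S 0 by split; rewrite ?lexx ?ts0.
have Sub t : S t -> t <= ts - e.
  move=> [/andP[t0 tts] tP]; rewrite leNgt; apply/negP => h.
  have : P0 + 1 <= Phi t by apply: he => //=; rewrite ger0_norm ?subr_ge0 ?ltW//; lra.
  by move=> h2; have := le_trans h2 tP; lra.
have hS : has_sup S by split; [exists 0|exists (ts - e) => t /Sub].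
pose t1 := sup S.
have t10 : 0 <= t1 by apply: ub_le_sup => //; exact: hS.2.
have t1s : t1 < ts.
  by apply: le_lt_trans (ge_sup hS.1 Sub) _; rewrite gtrBl.
exists t1; split=> //; last first.
  move=> t t1t tts; rewrite ltNge; apply/negP => h.
  have St : S t by split=> //; rewrite tts (le_trans t10 (ltW t1t)).
  by have := lt_le_trans t1t (ub_le_sup hS.2 St); rewrite ltxx.
move: (t10); rewrite le_eqVlt => /predU1P[<-//|t1_gt0].
rewrite leNgt; apply/negP => h.
have t1J : t1 \in `]0, ts[ by rewrite in_itv/= t1_gt0.
have [d /= d0 hd] : \forall t \near t1, P0 < Phi t.
  by have := cPhi t1 t1J => /(cvgr_gt _); apply.
have [t [tJ tP] td] := sup_adherent d0 hS.
have tt1 : t <= t1 by apply: ub_le_sup; [exact: hS.2|split].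
have : P0 < Phi t by apply: hd; rewrite /= ger0_norm ?subr_ge0//; rewrite -/t1 in td; lra.
by rewrite ltNge tP.
Qed.

End Blow_up.

Section Differential_inequalities.
Context {R : realType}.
Notation leb1 := (@lebesgue_measure R).
Variables (ts B p q : R).
Hypotheses (B0 : 0 < B) (p1 : 1 < p) (q1 : 1 < q).

Definition inner_continuous (f : R -> R) := forall t, t \in `]0, ts[ -> {for t, continuous f}.

Definition energy_growth (x y : R -> R) (K r : R) := forall a b, 0 < a -> a < b -> b < ts ->
  x b - x a <= \int[leb1]_(t in `[a, b]) (B * x t + K * y t `^ r).

Lemma inner_continuousD f g : inner_continuous f -> inner_continuous g ->
  inner_continuous (fun t => f t + g t).
Proof. by move=> cf cg t tJ; apply: (@continuousD R R^o R f g t); [exact: cf|exact: cg]. Qed.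

Lemma inner_continuousZ c f : inner_continuous f -> inner_continuous (fun t => c * f t).
Proof.
by move=> cf t tJ; apply: (@continuousM R R (cst c) f t); [exact: cst_continuous|exact: cf].
Qed.

Lemma inner_continuous_powR f r : 1 < r -> (forall t, 0 <= f t) -> inner_continuous f ->
  inner_continuous (fun t => f t `^ r).
Proof. by move=> r1 f0 cf t tJ; apply: continuous_powR_comp; [exact: ltW|exact: f0|exact: cf]. Qed.

Lemma inner_continuous_integrable f a b : inner_continuous f -> 0 < a -> b < ts ->
  leb1.-integrable `[a, b] (EFin \o f).
Proof.
move=> cf a0 bs; apply: continuous_compact_integrable; first exact: segment_compact.
apply: continuous_in_subspaceT => t; rewrite inE/= in_itv/= => /andP[h1 h2].
by apply: cf; rewrite in_itv/= (lt_le_trans a0 h1) (le_lt_trans h2 bs).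
Qed.

Variables (x y : R -> R) (K1 K2 : R).
Hypotheses (x0 : forall t, 0 <= x t) (y0 : forall t, 0 <= y t).
Hypotheses (cx : inner_continuous x) (cy : inner_continuous y).

Let cPhi : inner_continuous (fun t => x t + y t).
Proof. exact: inner_continuousD. Qed.

Let Phi0 t : 0 <= x t + y t.
Proof. by rewrite addr_ge0. Qed.

(** Where y vanishes, x has no source, and any C >= 0 serves as growth constant. *)
Lemma energy_growth_single a b C : 0 < a -> a < b -> b < ts -> 0 <= C -> energy_growth x y K1 p ->
  (forall t, t \in `[a, b] -> y t = 0) ->
  (x b + y b) - (x a + y a) <= \int[leb1]_(t in `[a, b]) (B * (x t + y t) + C * (x t + y t) `^ p).
Proof.
move=> a0 ab bs C0 Ex yab; have mab : measurable (`[a, b]%classic : set R) by exact: measurable_itv.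
rewrite !yab ?addr0; [|by rewrite in_itv/= lexx ltW|by rewrite in_itv/= lexx ltW].
apply: le_trans (Ex a b a0 ab bs) _; apply: le_Rintegral => //.
- apply: (inner_continuous_integrable _ _ _ _ a0 bs); apply: inner_continuousD; apply: inner_continuousZ; first exact: cx.
  by apply: inner_continuous_powR.
- apply: (inner_continuous_integrable _ _ _ _ a0 bs); apply: inner_continuousD; apply: inner_continuousZ; first exact: cPhi.
  by apply: inner_continuous_powR.
move=> t tab; rewrite (yab t tab) addr0 powR0 ?mulr0 ?addr0 ?lerDl ?mulr_ge0 ?powR_ge0//.
by rewrite gt_eqF// (lt_trans ltr01).
Qed.

Lemma energy_growth_sum a b C : 0 < a -> a < b -> b < ts ->
  energy_growth x y K1 p -> energy_growth y x K2 q ->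
  (forall t, t \in `[a, b] -> K2 * x t `^ q + K1 * y t `^ p <= C * (x t + y t) `^ p) ->
  (x b + y b) - (x a + y a) <= \int[leb1]_(t in `[a, b]) (B * (x t + y t) + C * (x t + y t) `^ p).
Proof.
move=> a0 ab bs Ex Ey hC; have mab : measurable (`[a, b]%classic : set R) by exact: measurable_itv.
have h := lerD (Ex a b a0 ab bs) (Ey a b a0 ab bs).
rewrite opprD addrACA; apply: le_trans h _.
have i1 : leb1.-integrable `[a, b] (EFin \o (fun t => B * x t + K1 * y t `^ p)).
  apply: (inner_continuous_integrable _ _ _ _ a0 bs); apply: inner_continuousD; apply: inner_continuousZ; first exact: cx.
  by apply: inner_continuous_powR.
have i2 : leb1.-integrable `[a, b] (EFin \o (fun t => B * y t + K2 * x t `^ q)).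
  apply: (inner_continuous_integrable _ _ _ _ a0 bs); apply: inner_continuousD; apply: inner_continuousZ; first exact: cy.
  by apply: inner_continuous_powR.
have i3 : leb1.-integrable `[a, b] (EFin \o (fun t => B * (x t + y t) + C * (x t + y t) `^ p)).
  apply: (inner_continuous_integrable _ _ _ _ a0 bs); apply: inner_continuousD; apply: inner_continuousZ; first exact: cPhi.
  by apply: inner_continuous_powR.
have <- : \int[leb1]_(t in `[a, b]) ((B * x t + K1 * y t `^ p) + (B * y t + K2 * x t `^ q)) =
   \int[leb1]_(t in `[a, b]) (B * x t + K1 * y t `^ p) + \int[leb1]_(t in `[a, b]) (B * y t + K2 * x t `^ q).
  exact: RintegralD.
apply: le_Rintegral => //; first by have := @integrableD _ _ _ leb1 _ mab _ _ i1 i2.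
move=> t tab; have := hC t tab.
by move: (x t) (y t) (x t `^ q) (y t `^ p) (C * _) => *; lra.
Qed.

End Differential_inequalities.

Section Strict_growth.
Context {R : realType}.
Notation leb1 := (@lebesgue_measure R).
Variables (ts B p A : R) (B0 : 0 < B) (p1 : 1 < p) (ts0 : 0 < ts) (A0 : 0 < A).

(* On some interval the growth constant A can be lowered to C; this makes the
   bound on the blow-up time strict when p = q. *)
Definition strict_growth (x y : R -> R) := exists s r C, [/\ 0 < s, s < r, r < ts, 0 <= C < A
  & forall t, s < t <= r -> (x t + y t) - (x s + y s) <=
     \int[leb1]_(v in `[s, t]) (B * (x v + y v) + C * (x v + y v) `^ p)].

Lemma strict_growth_single x y K1 t0 : (forall t, 0 <= x t) -> (forall t, 0 <= y t) ->
  inner_continuous ts x -> inner_continuous ts y -> energy_growth ts B x y K1 p ->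
  t0 \in `]0, ts[ -> 0 < x t0 -> (forall t, t \in `]0, ts[ -> 0 < x t -> y t = 0) ->
  strict_growth x y.
Proof.
move=> x0 y0 cx cy Ex t0J xt0 H.
have [d /= d0 hd] : \forall t \near t0, 0 < x t.
  by have := cx t0 t0J => /(cvgr_gt _); apply.
move: (t0J); rewrite in_itv/= => /andP[t00 t0s].
(* The interval stays both in the neighbourhood of t0 where x > 0 and below ts. *)
pose r := Num.min (t0 + d / 2) ((t0 + ts) / 2).
have r1 : r <= t0 + d / 2 by rewrite ge_min lexx.
have r2 : r <= (t0 + ts) / 2 by rewrite ge_min lexx orbT.
have t0r : t0 < r by rewrite lt_min; apply/andP; split; lra.
have A0' := A0; exists t0, r, (A / 2); split=> //; [lra|by apply/andP; split; lra|].
move=> t /andP[t0t tr].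
have A2 : 0 <= A / 2 by lra.
have tts : t < ts by lra.
apply: (energy_growth_single ts B p p1 x y K1 x0 y0 cx cy t0 t (A / 2) t00 t0t tts A2 Ex).
move=> v; rewrite in_itv/= => /andP[h1 h2]; apply: H; first by rewrite in_itv/=; apply/andP; split; lra.
by apply: hd; rewrite /= distrC ger0_norm ?subr_ge0//; lra.
Qed.

Lemma strict_growth_both x y K1 K2 t0 : (forall t, 0 <= x t) -> (forall t, 0 <= y t) ->
  inner_continuous ts x -> inner_continuous ts y ->
  energy_growth ts B x y K1 p -> energy_growth ts B y x K2 p -> K1 <= A -> K2 <= A ->
  t0 \in `]0, ts[ -> 0 < x t0 -> 0 < y t0 -> strict_growth x y.
Proof.
move=> x0 y0 cx cy Ex Ey K1A K2A t0J xt0 yt0.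
have lt := powR_sum_lt _ _ _ p1 xt0 yt0.
have P0 : 0 < (x t0 + y t0) `^ p by rewrite powR_gt0 ?addr_gt0.
(* This ratio is less than 1; by continuity it stays below a fixed c < 1 near t0, and A can be
   lowered to A * c there. *)
pose th := (x t0 `^ p + y t0 `^ p) / (x t0 + y t0) `^ p.
have th1 : th < 1 by rewrite ltr_pdivrMr// mul1r.
have th0 : 0 <= th by rewrite divr_ge0 ?addr_ge0 ?powR_ge0.
pose c := (1 + th) / 2.
have cth : th < c by rewrite /c; lra.
have c1 : c < 1 by rewrite /c; lra.
have c0 : 0 <= c by rewrite /c; lra.
pose g t := c * (x t + y t) `^ p + (-1) * (x t `^ p + y t `^ p).
have cg : inner_continuous ts g.
  apply: inner_continuousD; apply: inner_continuousZ.
    by apply: inner_continuous_powR => //; [move=> t; rewrite addr_ge0|exact: inner_continuousD].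
  by apply: inner_continuousD; apply: inner_continuous_powR.
have g0 : 0 < g t0.
  by rewrite /g mulN1r subr_gt0 -ltr_pdivrMr.
have [d /= d0 hd] : \forall t \near t0, 0 < g t.
  by have := cg t0 t0J => /(cvgr_gt _); apply.
move: (t0J); rewrite in_itv/= => /andP[t00 t0s].
pose r := Num.min (t0 + d / 2) ((t0 + ts) / 2).
have r1 : r <= t0 + d / 2 by rewrite ge_min lexx.
have r2 : r <= (t0 + ts) / 2 by rewrite ge_min lexx orbT.
have t0r : t0 < r by rewrite lt_min; apply/andP; split; lra.
exists t0, r, (A * c); split=> //; [lra| |].
  by rewrite mulr_ge0 ?(ltW A0)//= gtr_pMr.
move=> t /andP[t0t tr].
have tts : t < ts by lra.
apply: (energy_growth_sum ts B p p p1 p1 x y K1 K2 x0 y0 cx cy t0 t (A * c) t00 t0t tts Ex Ey).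
move=> v; rewrite in_itv/= => /andP[h1 h2].
have gv : 0 < g v by apply: hd; rewrite /= distrC ger0_norm ?subr_ge0//; lra.
have h3 : x v `^ p + y v `^ p <= c * (x v + y v) `^ p by move: gv; rewrite /g mulN1r subr_gt0 => /ltW.
rewrite -mulrA; apply: le_trans (ler_wpM2l (ltW A0) h3); rewrite mulrDr.
by apply: lerD; apply: ler_wpM2r; rewrite ?powR_ge0.
Qed.

Lemma strict_growth_exists x y K1 K2 : (forall t, 0 <= x t) -> (forall t, 0 <= y t) ->
  inner_continuous ts x -> inner_continuous ts y ->
  energy_growth ts B x y K1 p -> energy_growth ts B y x K2 p -> K1 <= A -> K2 <= A ->
  (forall t, t \in `]0, ts[ -> 0 < x t + y t) -> strict_growth x y.
Proof.
move=> x0 y0 cx cy Ex Ey K1A K2A Phi_gt0.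
have [[t [tJ xt yt]]|H] := pselect (exists t, [/\ t \in `]0, ts[, 0 < x t & 0 < y t]).
  exact: (strict_growth_both x y K1 K2 t).
have ts0' := ts0.
have hJ : ts / 2 \in `]0, ts[ by rewrite in_itv/=; apply/andP; split; lra.
(* Now x and y are never positive together. At ts / 2, an arbitrary time, one of them is positive,
   and the other vanishes wherever that one is positive. *)
have [xt|xt] := ltP 0 (x (ts / 2)).
  apply: (strict_growth_single x y K1 (ts / 2)) => // t tJ xt'.
  by apply/eqP; rewrite eq_le y0 andbT leNgt; apply/negP => yt; apply: H; exists t.
have yt : 0 < y (ts / 2) by have := Phi_gt0 _ hJ; lra.
have [s [r [C [s0 sr rs CA h]]]] : strict_growth y x.
  apply: (strict_growth_single y x K2 (ts / 2)) => // t tJ yt'.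
  by apply/eqP; rewrite eq_le x0 andbT leNgt; apply/negP => xt'; apply: H; exists t.
exists s, r, C; split; [exact: s0|exact: sr|exact: rs|exact: CA|].
move=> t /h; rewrite (addrC (x t)) (addrC (x s)).
by under eq_Rintegral do rewrite (addrC (y _)).
Qed.

End Strict_growth.

Section Blow_up_time.
Context {R : realType}.
Notation leb1 := (@lebesgue_measure R).

(** C is the constant that appears in T: A itself when p = q, and 2 A otherwise. *)
Lemma blowup_time_gt (ts B p q K1 K2 A C : R) (x y : R -> R) : 0 < ts -> 0 < B -> 1 < q -> q <= p ->
  0 < A -> A <= C -> (p != q -> A < C) -> (forall t, 0 <= x t) -> (forall t, 0 <= y t) ->
  inner_continuous ts x -> inner_continuous ts y ->
  energy_growth ts B x y K1 p -> energy_growth ts B y x K2 q -> 0 < x 0 + y 0 ->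
  x t + y t @[t --> 0^'+] --> x 0 + y 0 -> x t + y t @[t --> ts^'-] --> +oo ->
  K2 * (x 0 + y 0) `^ (q - p) <= A -> K1 <= A ->
  (B * (p - 1))^-1 * ln (1 + B / C * (x 0 + y 0) `^ (1 - p)) < ts.
Proof.
move=> ts0 B0 q1 qp A0 AC pqAC x0 y0 cx cy Ex Ey; set P0 := x 0 + y 0 => P00 c0 blow hK2 hK1.
have p1 : 1 < p := lt_le_trans q1 qp.
have C0 : 0 < C := lt_le_trans A0 AC.
pose Phi t := x t + y t.
have cPhi : inner_continuous ts Phi by exact: inner_continuousD.
have Phi0 t : 0 <= Phi t by rewrite addr_ge0.
pose g := B * (p - 1); have g0 : 0 < g by rewrite mulr_gt0// subr_gt0.
have AB : 0 < A / B by rewrite divr_gt0.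
(* The claim, exponentiated and multiplied by C / B. *)
suff main : P0 `^ (1 - p) + C / B < expR (g * ts) * (C / B).
  rewrite -/g mulrC ltr_pdivrMr// (mulrC ts) -(expRK (g * ts)) ltr_ln ?posrE ?expR_gt0//; last first.
    by rewrite ltr_pwDl// mulr_ge0 ?powR_ge0// divr_ge0// ltW.
  have CB : 0 < C / B by rewrite divr_gt0.
  rewrite -(ltr_pM2r CB); apply: le_lt_trans main; rewrite le_eqVlt; apply/orP; left; apply/eqP.
  by field; rewrite !gt_eqF.
have [t1 [t10 t1s Pt1 Pgt]] := last_sublevel_time Phi ts P0 ts0 (lexx P0) cPhi blow.
have gr s r : t1 < s -> s < r -> r < ts ->
    Phi s `^ (1 - p) + A / B <= expR (g * (r - s)) * (Phi r `^ (1 - p) + A / B).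
  move=> t1s' sr rs; apply: (superlinear_growth Phi B A p t1 ts s r t1s' sr rs B0 (ltW A0) p1 Phi0).
  - move=> t; rewrite in_itv/= => /andP[h1 h2]; apply: cPhi.
    by rewrite in_itv/= h2 (le_lt_trans t10 h1).
  - move=> t; rewrite in_itv/= => /andP[h1 h2]; apply: lt_trans P00 _; apply: Pgt.
      exact: lt_le_trans h1.
    exact: le_lt_trans h2 rs.
  move=> t /andP[st tr]; have s0 : 0 < s := le_lt_trans t10 t1s'.
  apply: (energy_growth_sum ts B p q p1 q1 x y K1 K2 x0 y0 cx cy s t A s0 st (le_lt_trans tr rs) Ex Ey).
  move=> v; rewrite in_itv/= => /andP[h1 h2].
  apply: (powR_sum_le _ _ _ _ _ _ _ P0) => //; last exact: ltW.
  by apply/ltW/Pgt; [exact: lt_le_trans h1|exact: le_lt_trans (le_trans h2 tr) rs].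
(* The growth inequalities hold only at positive times; continuity from the right extends them down
   to t1, also when t1 = 0. *)
have ct1 : Phi t @[t --> t1^'+] --> Phi t1.
  move: t10; rewrite le_eqVlt => /predU1P[<-//|t1_gt0].
  by apply: cvg_at_right_filter; apply: cPhi; rewrite in_itv/= t1_gt0.
have Phit1 : Phi t1 = P0.
  apply/eqP; rewrite eq_le Pt1/=; apply: (cvgr_to_ge ct1).
  by near=> t; apply/ltW/Pgt; near: t; [exact: nbhs_right_gt|exact: nbhs_right_lt].
have E1 r : t1 < r -> r < ts ->
    P0 `^ (1 - p) + A / B <= expR (g * (r - t1)) * (Phi r `^ (1 - p) + A / B).
  move=> t1r rs; rewrite -Phit1.
  have cpow : Phi t `^ (1 - p) + A / B @[t --> t1^'+] --> Phi t1 `^ (1 - p) + A / B.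
    apply: cvgD; last exact: cvg_cst.
    have cp : {for Phi t1, continuous (fun a : R => a `^ (1 - p))}.
      apply: differentiable_continuous; apply/derivable1_diffP.
      by apply: derivable_powR; rewrite in_itv/= Phit1 P00.
    exact: (cvg_comp _ _ ct1 cp).
  apply: (cvgr_to_le cpow).
  near=> s.
  have h1 : t1 < s by near: s; exact: nbhs_right_gt.
  have h2 : s < r by near: s; exact: nbhs_right_lt.
  apply: le_trans (gr s r h1 h2 rs) _; apply: ler_wpM2r.
    by rewrite addr_ge0 ?powR_ge0// ltW.
  by rewrite ler_expR ler_wpM2l ?(ltW g0)// lerD2l lerN2 ltW.
have E2 : P0 `^ (1 - p) + A / B <= expR (g * (ts - t1)) * (A / B).
  by apply: (blowup_limit Phi B A p t1 ts _ B0 (ltW A0) p1 t1s blow) => r; exact: E1.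
have ets : 1 < expR (g * ts) by rewrite -expR0 ltr_expR mulr_gt0.
have ett : expR (g * (ts - t1)) <= expR (g * ts).
  by rewrite ler_expR ler_wpM2l ?(ltW g0)// gerBl.
have E3 := le_trans E2 (ler_wpM2r (ltW AB) ett).
(* E3 says P0^(1-p) <= (expR (g * ts) - 1) * (A / B), and the right-hand side increases strictly
   when A is replaced by C. *)
have [AltC|CA] := ltP A C.
  have ABC : A / B < C / B by rewrite ltr_pM2r// invr_gt0.
  move: E3 ets ABC; move: (A / B) (C / B) (expR _) (P0 `^ _) => a c e z E3 ets ac.
  nra.
have {}AC : A = C by apply/eqP; rewrite eq_le AC CA.
have pq : p = q by apply/eqP/negPn/negP => /pqAC; rewrite AC ltxx.
rewrite -AC.
(* If t1 > 0, then strictness comes from the shorter time ts - t1 in E2. *)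
move: (t10); rewrite le_eqVlt => /predU1P[t1E|t1_gt0]; last first.
  by apply: le_lt_trans E2 _; rewrite ltr_pM2r// ltr_expR ltr_pM2l// gtrBl.
have K2A : K2 <= A by move: hK2; rewrite pq subrr powRr0 mulr1.
have Phi_gt0 t : t \in `]0, ts[ -> 0 < Phi t.
  by rewrite in_itv/= => /andP[h1 h2]; apply: lt_trans P00 _; apply: Pgt; rewrite -?t1E.
have Ey' : energy_growth ts B y x K2 p by rewrite pq.
(* If t1 = 0, the bounds over [0, s], [s, r] and [r, ts] are chained, the middle one being strict
   thanks to D < A. *)
have [s [r [D [s0 sr rs /andP[D0 DA] hD]]]] :=
  strict_growth_exists ts B p A p1 ts0 A0 x y K1 K2 x0 y0 cx cy Ex Ey' hK1 K2A Phi_gt0.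
have a1 : P0 `^ (1 - p) + A / B <= expR (g * s) * (Phi s `^ (1 - p) + A / B).
  by have := E1 s; rewrite -t1E subr0; apply; [exact: s0|exact: lt_trans sr rs].
have a2 : Phi s `^ (1 - p) + D / B <= expR (g * (r - s)) * (Phi r `^ (1 - p) + D / B).
  apply: (superlinear_growth Phi B D p 0 ts s r s0 sr rs B0 D0 p1 Phi0 cPhi _ hD).
  move=> t; rewrite in_itv/= => /andP[h1 h2]; apply: Phi_gt0.
  by rewrite in_itv/= (lt_le_trans s0 h1) (le_lt_trans h2 rs).
have a3 : Phi r `^ (1 - p) + A / B <= expR (g * (ts - r)) * (A / B).
  apply: (blowup_limit Phi B A p r ts _ B0 (ltW A0) p1 rs blow) => v rv vs.
  by apply: gr => //; rewrite -t1E; exact: lt_trans s0 sr.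
have e1 : 1 < expR (g * (r - s)) by rewrite -expR0 ltr_expR mulr_gt0// subr_gt0.
have DAB : D / B < A / B by rewrite ltr_pM2r// invr_gt0.
(* Replacing D by A in a2 adds (A - D) / B on the left and the same times a factor greater than 1 on
   the right. *)
have a4 : Phi s `^ (1 - p) + A / B < expR (g * (r - s)) * (Phi r `^ (1 - p) + A / B).
  by move: a2 e1 DAB; move: (expR _) (A / B) (D / B) (Phi s `^ _) (Phi r `^ _) => *; nra.
apply: le_lt_trans a1 _.
have -> : expR (g * ts) * (A / B) = expR (g * s) * (expR (g * (r - s)) * (expR (g * (ts - r)) * (A / B))).
  by rewrite !mulrA -!expRD; congr (expR _ * _ * _); ring.
rewrite ltr_pM2l ?expR_gt0//; apply: lt_le_trans a4 _.
by rewrite ler_pM2l ?expR_gt0.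
Unshelve. all: by end_near. Qed.

End Blow_up_time.

(** * Solutions of the system *)

Section Solution_energy.
Context {R : realType} {N : nat}.
Variables (Omega : set 'rV[R]_N) (ts : R).
Hypotheses (oO : open Omega) (ts0 : 0 < ts).
Notation mu := (leb R N).
Notation I := (ip mu (Omega : set (space R N))).
Notation leb1 := (@lebesgue_measure R).
Implicit Types (u F : R -> 'rV[R]_N -> R) (t : R).

Definition lap_sq u t := I (lap Omega (u t)) (lap Omega (u t)).

Lemma lap_sq_ge0 u t : 0 <= lap_sq u t.
Proof. exact: ip_ge0. Qed.

Section Solution.
Variables (delta h k : R -> R) (F u : R -> 'rV[R]_N -> R) (u0 : 'rV[R]_N -> R).
Hypothesis sol : solves Omega ts delta h k F u0 u.

Lemma solves_C_time T : 0 < T -> T < ts -> C_time T (W022 Omega) (W022_norm Omega) u.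
Proof.
move=> T0 Ts; have [ut [reg _ _]] := sol.
by have [] := reg T (introT andP (conj T0 Ts)).
Qed.

Lemma solves_W022 t : t \in `]0, ts[ -> W022 Omega (u t).
Proof.
rewrite in_itv/= => /andP[t0 tts]; have [Wu _] := solves_C_time t t0 tts.
by apply: Wu; rewrite in_itv/= lexx ltW.
Qed.

Lemma lap_sq_within T : 0 < T -> T < ts -> {within `[0, T], continuous (lap_sq u)}.
Proof. by move=> T0 Ts; exact: (C_time_ip_lap Omega oO _ _ (solves_C_time T T0 Ts)). Qed.

Lemma lap_sq_inner_continuous : inner_continuous ts (lap_sq u).
Proof.
move=> t; rewrite in_itv/= => /andP[t0 tts].
have T0 : 0 < (t + ts) / 2 by lra.
have Ts : (t + ts) / 2 < ts by lra.
have /(continuous_within_itvP _ T0)[c _ _] := lap_sq_within _ T0 Ts.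
by apply: c; rewrite in_itv/= t0/=; lra.
Qed.

Lemma lap_sq_cvg0 : lap_sq u t @[t --> 0^'+] --> lap_sq u 0.
Proof.
have ts0' := ts0.
have T0 : 0 < ts / 2 by lra.
have Ts : ts / 2 < ts by lra.
by have /(continuous_within_itvP _ T0)[_ c _] := lap_sq_within _ T0 Ts.
Qed.

Lemma lap_sq0 : W022 Omega u0 -> lap_sq u 0 = I (lap Omega u0) (lap Omega u0).
Proof.
move=> [[/(L2P Omega oO) [mu0 _] _] _]; have ts0' := ts0.
have T0 : 0 < ts / 2 by lra.
have Ts : ts / 2 < ts by lra.
have [Wu _] := solves_C_time _ T0 Ts.
have W0 : W022 Omega (u 0) by apply: Wu; rewrite in_itv/= lexx ltW.
have [[/(L2P Omega oO) [mu0' _] _] _] := W0.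
have [ut [_ _ u0E]] := sol.
(* u 0 and u0 agree only almost everywhere, but their chosen derivatives are equal by [eq_wD]. *)
suff E : lap Omega (u 0) = lap Omega u0 by rewrite /lap_sq E.
rewrite /lap; apply: eq_bigr => i _.
exact: (eq_wD Omega oO _ _ _ mu0' mu0 u0E).
Qed.

Lemma solves_energy_growth (v : R -> 'rV[R]_N -> R) (f e1 e2 : R -> R) (B p S : R) :
  (forall t, F t = fun x => f (v t x)) ->
  (forall t, t \in `]0, ts[ -> [/\ 0 < h t, 0 < k t, 0 < e1 t & 0 < e2 t]) ->
  (forall t, t \in `]0, ts[ -> h t / e2 t + k t / e1 t = 2 * delta t) ->
  (forall t, t \in `]0, ts[ -> h t * e2 t <= B) ->
  finite_sup ts (fun t => k t * e1 t) -> 1 < p -> 0 <= S ->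
  (forall s, 0 <= s -> 0 <= f s <= s `^ p) ->
  (forall t, t \in `]0, ts[ -> nonneg_ae Omega (v t)) ->
  (forall t, t \in `]0, ts[ -> (Lp_norm Omega (2 * p) (v t) <= S%:E * W022_norm Omega (v t))%E) ->
  inner_continuous ts (lap_sq v) ->
  energy_growth ts B (lap_sq u) (lap_sq v) (tsup ts (fun t => k t * e1 t) * S `^ (2 * p)) p.
Proof.
move=> FE pos edelta hB hsup p1 S0 hf v0 hS cv a b a0 ab bs.
pose K := tsup ts (fun t => k t * e1 t) * S `^ (2 * p).
apply: (solves_energy_inequality Omega oO ts delta h k F u u0 e1 e2
  (fun t => K * lap_sq v t `^ p) B a b sol pos edelta hB _ _ a0 ab bs).
  apply: aeW => t tJ; rewrite FE => sF.
  have hI := ip_power_source_le Omega oO (v t) f p S (lt_trans ltr01 p1) S0 (v0 t tJ) hf sF (hS t tJ).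
  have [_ k0 e0 _] := pos t tJ.
  apply: le_trans (ler_wpM2l (ltW (mulr_gt0 k0 e0)) hI) _.
  rewrite /K -(mulrA (tsup _ _)); apply: ler_wpM2r; first by rewrite mulr_ge0 ?powR_ge0.
  by apply: ub_le_sup => //; exists t.
apply: inner_continuousZ; apply: inner_continuous_powR => // t; exact: ip_ge0.
Qed.

End Solution.

End Solution_energy.

Theorem theorem1p1 (R : realType) (N : nat) (hN : (2 <= N)%N)
    (Omega : set 'rV[R]_N)
    (hOmega : bounded_domain Omega) (hbd : smooth_boundary Omega)
    (tstar : R) (htstar : 0 < tstar)
    (delta1 h1 k1 delta2 h2 k2 : R -> R)
    (hdelta1 : pos_bounded tstar delta1) (hdelta2 : pos_bounded tstar delta2)
    (hh1 : pos_bounded tstar h1) (hh2 : pos_bounded tstar h2)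
    (hk1 : pos_bounded tstar k1) (hk2 : pos_bounded tstar k2)
    (f1 f2 : R -> R)
    (hf1 : forall s : R, 0 <= s -> 0 <= f1 s) (hf2 : forall s : R, 0 <= s -> 0 <= f2 s)
    (p q : R) (hpq : q <= p) (hq : 1 < q)
    (hf1p : forall s : R, 0 <= s -> f1 s <= s `^ p)
    (hf2q : forall s : R, 0 <= s -> f2 s <= s `^ q)
    (hadm_p : admissible N (2 * p)) (hadm_q : admissible N (2 * q))
    (u0 v0 : 'rV[R]_N -> R) (hu0 : W022 Omega u0) (hv0 : W022 Omega v0)
    (hu0_ge0 : nonneg_ae Omega u0) (hv0_ge0 : nonneg_ae Omega v0)
    (u v : R -> 'rV[R]_N -> R)
    (hsol : nonneg_solution Omega tstar delta1 h1 k1 delta2 h2 k2 f1 f2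
              u0 v0 u v)
    (hPhi0 : 0 < energy Omega u0 v0)
    (hblowup : energy Omega (u t) (v t) @[t --> tstar^'-] --> +oo)
    (S : R -> R) (hS : Sobolev_constants Omega S)
    (eps1 eps2 eps3 eps4 : R -> R)
    (heps_gt0 : forall t, t \in `]0, tstar[ ->
       [/\ 0 < eps1 t, 0 < eps2 t, 0 < eps3 t & 0 < eps4 t])
    (heps12 : forall t, t \in `]0, tstar[ ->
       h1 t / eps2 t + k1 t / eps1 t = 2 * delta1 t)
    (heps34 : forall t, t \in `]0, tstar[ ->
       h2 t / eps4 t + k2 t / eps3 t = 2 * delta2 t)
    (hsup_h1 : finite_sup tstar (fun t => h1 t * eps2 t))
    (hsup_h2 : finite_sup tstar (fun t => h2 t * eps4 t))
    (hsup_k2 : finite_sup tstar (fun t => k2 t * eps3 t))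
    (hsup_k1 : finite_sup tstar (fun t => k1 t * eps1 t)) :
  let Phi t := energy Omega (u t) (v t) in
  let Phi0 := energy Omega u0 v0 in
  let B := Num.max (tsup tstar (fun t => h1 t * eps2 t))
                   (tsup tstar (fun t => h2 t * eps4 t)) in
  let A := Num.max
    (tsup tstar (fun t => k2 t * eps3 t) * S (2 * q) `^ (2 * q)
       * Phi0 `^ (q - p))
    (tsup tstar (fun t => k1 t * eps1 t) * S (2 * p) `^ (2 * p)) in
  let At := S (2 * p) `^ (2 * p) *
    Num.max (tsup tstar (fun t => k2 t * eps3 t))
            (tsup tstar (fun t => k1 t * eps1 t)) in
  let T := if p == q
    then (B * (p - 1))^-1 * ln (1 + B / At * Phi0 `^ (1 - p))
    else (B * (p - 1))^-1 * ln (1 + B / (2 * A) * Phi0 `^ (1 - p)) in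
  T < tstar /\ exists M, forall t, t \in `[0, T] -> Phi t <= M.
Proof.
move=> Phi Phi0 B A At T.
have [_ oO _ _] := hOmega.
have [sol1 sol2 uv0] := hsol.
pose x := lap_sq Omega u; pose y := lap_sq Omega v.
have PhiE t : Phi t = x t + y t by exact: (energyE Omega oO).
have Phi0E : Phi0 = x 0 + y 0.
  have xE := lap_sq0 Omega tstar oO htstar _ _ _ _ _ _ sol1 hu0.
  have yE := lap_sq0 Omega tstar oO htstar _ _ _ _ _ _ sol2 hv0.
  by rewrite /x /y xE yE; exact: (energyE Omega oO).
have x0 t : 0 <= x t by exact: lap_sq_ge0.
have y0 t : 0 <= y t by exact: lap_sq_ge0.
have cx : inner_continuous tstar x by exact: (lap_sq_inner_continuous _ _ oO _ _ _ _ _ _ sol1).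
have cy : inner_continuous tstar y by exact: (lap_sq_inner_continuous _ _ oO _ _ _ _ _ _ sol2).
have hp : 1 < p := lt_le_trans hq hpq.
have [Sp0 SpP] := hS _ hadm_p; have [Sq0 SqP] := hS _ hadm_q.
have tsup_ge (c : R -> R) t : finite_sup tstar c -> t \in `]0, tstar[ -> c t <= tsup tstar c.
  by move=> hc tJ; apply: ub_le_sup => //; exists t.
(* A sample time, at which the positive products show that the suprema are positive. *)
have tJ : tstar / 2 \in `]0, tstar[ by rewrite in_itv/=; apply/andP; split; lra.
have h10 t : t \in `]0, tstar[ -> 0 < h1 t by case: hh1 => + _; apply.
have h20 t : t \in `]0, tstar[ -> 0 < h2 t by case: hh2 => + _; apply.
have k10 t : t \in `]0, tstar[ -> 0 < k1 t by case: hk1 => + _; apply.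
have k20 t : t \in `]0, tstar[ -> 0 < k2 t by case: hk2 => + _; apply.
have B0 : 0 < B.
  have [_ e0 _ _] := heps_gt0 _ tJ.
  rewrite lt_max; apply/orP; left; apply: lt_le_trans (tsup_ge _ _ hsup_h1 tJ).
  by rewrite mulr_gt0// h10.
pose K1 := tsup tstar (fun t => k1 t * eps1 t) * S (2 * p) `^ (2 * p).
pose K2 := tsup tstar (fun t => k2 t * eps3 t) * S (2 * q) `^ (2 * q).
have K10 : 0 < K1.
  have [e0 _ _ _] := heps_gt0 _ tJ.
  rewrite mulr_gt0 ?powR_gt0//; apply: lt_le_trans (tsup_ge _ _ hsup_k1 tJ).
  by rewrite mulr_gt0// k10.
have Ex : energy_growth tstar B x y K1 p.
  apply: (solves_energy_growth _ _ oO _ _ _ _ _ _ sol1 v f1 eps1 eps2 B p (S (2 * p)) (fun t => erefl)).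
  - by move=> t tJ'; have [? ? ? ?] := heps_gt0 _ tJ'; split=> //; [exact: h10|exact: k10].
  - exact: heps12.
  - by move=> t tJ'; rewrite le_max (tsup_ge _ _ hsup_h1 tJ').
  - exact: hsup_k1.
  - exact: hp.
  - exact: ltW.
  - by move=> s s0; rewrite hf1// hf1p.
  - by move=> t /uv0[].
  - by move=> t tJ'; apply: SpP; exact: (solves_W022 _ _ _ _ _ _ _ _ sol2).
  - exact: cy.
have Ey : energy_growth tstar B y x K2 q.
  apply: (solves_energy_growth _ _ oO _ _ _ _ _ _ sol2 u f2 eps3 eps4 B q (S (2 * q)) (fun t => erefl)).
  - by move=> t tJ'; have [? ? ? ?] := heps_gt0 _ tJ'; split=> //; [exact: h20|exact: k20].
  - exact: heps34.
  - by move=> t tJ'; rewrite le_max (tsup_ge _ _ hsup_h2 tJ') orbT.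
  - exact: hsup_k2.
  - exact: hq.
  - exact: ltW.
  - by move=> s s0; rewrite hf2// hf2q.
  - by move=> t /uv0[].
  - by move=> t tJ'; apply: SqP; exact: (solves_W022 _ _ _ _ _ _ _ _ sol1).
  - exact: cx.
have P00 : 0 < x 0 + y 0 by rewrite -Phi0E.
have c0 : x t + y t @[t --> 0^'+] --> x 0 + y 0.
  apply: cvgD; first exact: (lap_sq_cvg0 _ _ oO htstar _ _ _ _ _ _ sol1).
  exact: (lap_sq_cvg0 _ _ oO htstar _ _ _ _ _ _ sol2).
have blow : x t + y t @[t --> tstar^'-] --> +oo.
  by apply: cvg_trans hblowup; apply: near_eq_cvg; apply: nearW => t; rewrite -PhiE.
have Ts : T < tstar.
  rewrite /T Phi0E; case: eqP => [pq|/eqP pq].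
    have At0 : 0 < At.
      rewrite /At mulr_gt0 ?powR_gt0// lt_max; apply/orP; right.
      by rewrite -(pmulr_lgt0 _ (powR_gt0 (2 * p) Sp0)).
    apply: (blowup_time_gt tstar B p q K1 K2 At At x y) => //.
    - by rewrite pq eqxx.
    - rewrite pq subrr powRr0 mulr1 /At /K2 mulrC pq ler_wpM2l ?powR_ge0//.
      by rewrite le_max lexx.
    - by rewrite /At /K1 mulrC ler_wpM2l ?powR_ge0// le_max lexx orbT.
  have A0 : 0 < A by rewrite lt_max K10 orbT.
  apply: (blowup_time_gt tstar B p q K1 K2 A (2 * A) x y) => //.
  - by rewrite ler_pMl// ler1n.
  - by rewrite ltr_pMl// ltr1n.
  - by rewrite -Phi0E /A le_max lexx.
  - by rewrite /A le_max lexx orbT.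
split=> //.
(* A positive time between T and tstar, whatever the sign of T; Lap u and Lap v are continuous in
   L^2 on the compact interval [0, T'], so their squared norms are bounded there. *)
pose T' := (Num.max T 0 + tstar) / 2.
have mT : Num.max T 0 < tstar by rewrite gt_max Ts htstar.
have m0 : 0 <= Num.max T 0 by rewrite le_max lexx orbT.
have mTT : T <= Num.max T 0 by rewrite le_max lexx.
have T'0 : 0 < T' by rewrite /T'; lra.
have T's : T' < tstar by rewrite /T'; lra.
have TT' : T <= T' by rewrite /T'; lra.
have [a _ ha] := EVT_max (ltW T'0) (lap_sq_within _ _ oO _ _ _ _ _ _ sol1 T' T'0 T's).
have [b _ hb] := EVT_max (ltW T'0) (lap_sq_within _ _ oO _ _ _ _ _ _ sol2 T' T'0 T's).
exists (x a + y b) => t; rewrite in_itv/= => /andP[t0 tT]; rewrite PhiE.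
by apply: lerD; [apply: ha|apply: hb]; rewrite in_itv/= t0 (le_trans tT TT').
Qed.
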